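(* There exists an absolute constant $c>0$ such that the following holds. Let $u$ solve the free wave equation $\Box u=0$ in $\mathbb{R}^{1+5}_{t,x}$ with radial data $(u,u_t)(0)=(f,g)\in\dot H^1\times L^2(\mathbb{R}^5)$. Then for every $a>0$, $$\max_{\pm}\ \limsup_{t\to\pm\infty}\int_{a+|t|}^\infty (u_t^2+u_r^2)(t,r)\,r^4\,dr\ \ge\ c\,\|\pi_a^\perp(f,g)\|_{\dot H^1\times L^2(r>a)}^2,$$ where $\pi_a=\mathrm{Id}-\pi_a^\perp$ is the orthogonal projection onto the plane $\{(c_1r^{-3},c_2r^{-3}) : c_1,c_2\in\mathbb{R}\}$ in the space $\dot H^1\times L^2(r>a)$. Moreover, the left-hand side of this inequality vanishes for all data whose restriction to $r>a$ lies in this plane.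
   Context: $\dot H^1\times L^2(r>a)$ denotes the Hilbert space of (restrictions to $\{x\in\mathbb{R}^5:|x|>a\}$ of) radial pairs $(f,g)$ with norm $\|(f,g)\|^2_{\dot H^1\times L^2(r>a)}=\int_a^\infty (f_r^2+g^2)\,r^4\,dr$ (no boundary condition at $r=a$; $f\to 0$ at infinity). For radial functions in five dimensions, $\Box u=0$ reads $u_{tt}-u_{rr}-\frac4r u_r=0$. *)

(* Defs.v *)
From HB Require Import structures.
From mathcomp Require Import all_boot all_order all_algebra.
From mathcomp Require Import all_classical all_reals all_analysis.
Set Implicit Arguments.
Unset Strict Implicit.
Unset Printing Implicit Defensive.
Import Order.TTheory GRing.Theory Num.Theory.
Import numFieldNormedType.Exports.
Local Open Scope classical_set_scope.
Local Open Scope ring_scope.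

(* A radial function on R^5 is given by its profile r |-> f r; only the values *)
(* at r > 0 matter. Elements of Hdot^1 have a representative that is locally   *)
(* absolutely continuous on (0, oo), and profiles of Hdot^1 functions always   *)
(* stand for that representative, so that f_r is the classical derivative      *)
(* derive1 f, which exists almost everywhere. The surface measure of the unit  *)
(* sphere is omitted from all the integrals.                                   *)
Section RadialSpaces.
Context {R : realType}.
Notation mu := (@lebesgue_measure R).
Implicit Types (f g : R -> R) (F G P Q : (R -> R) * (R -> R)).

Definition L2sq (a : R) g : \bar R :=
  (\int[mu]_(r in `]a, +oo[) ((g r) ^+ 2 * r ^+ 4)%:E)%E.

Definition rad_L2 g :=
  measurable_fun `](0 : R), +oo[ g /\ (L2sq 0 g < +oo)%E.

(* No condition at r = 0: points are removable for Hdot^1(R^5). *)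
Definition rad_Hdot1 f :=
  [/\ {ae mu, forall r, 0 < r -> derivable f r 1},
      rad_L2 (derive1 f),
      (forall r s, 0 < r -> r < s ->
         f s - f r = \int[mu]_(x in `[r, s]) derive1 f x)
    & f r @[r --> +oo] --> 0].

(* Squared norm and inner product of Hdot^1 x L^2 (r > a); a = 0 is the        *)
(* whole space R^5.                                                            *)
Definition energy (a : R) F : \bar R :=
  (\int[mu]_(r in `]a, +oo[)
     (((derive1 F.1 r) ^+ 2 + (F.2 r) ^+ 2) * r ^+ 4)%:E)%E.

Definition energy_dot (a : R) F G : R :=
  \int[mu]_(r in `]a, +oo[)
    ((derive1 F.1 r * derive1 G.1 r + F.2 r * G.2 r) * r ^+ 4).

Definition plane : set ((R -> R) * (R -> R)) :=
  [set P | exists c1 c2 : R,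
     P = ((fun r => c1 * r ^- 3), (fun r => c2 * r ^- 3))].

Definition is_orth_proj (a : R) F P :=
  plane P /\ forall Q, plane Q -> energy_dot a (F - P) Q = 0.

(* For a > 0 and F of finite energy there is exactly one P such that           *)
(* is_orth_proj a F P, so the default value is never used.                     *)
Definition orth_proj (a : R) F : (R -> R) * (R -> R) :=
  xget 0 [set P | is_orth_proj a F P].

Definition orth_perp (a : R) F := F - orth_proj a F.

(* The finite energy solutions of u_tt - u_rr - (4/r) u_r = 0 on R^(1+5), with *)
(* ut = u_t:                                                                   *)
(*   (u, ut) in C(R; Hdot^1 x L^2), u_t exists in the L^2 sense, and           *)
(*   d/dt <u_t, psi>_{L^2} = - <grad u, grad psi>_{L^2} for psi in H^1,        *)
(* which is the distributional equation, as C_c^oo is dense in H^1. Testing    *)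
(* against radial psi is enough because u is radial.                           *)
Record is_free_wave (u ut : R -> R -> R) : Prop := {
  wave_Hdot1 : forall t, rad_Hdot1 (u t);
  wave_L2 : forall t, rad_L2 (ut t);
  wave_cont : forall t0,
    energy 0 ((u t, ut t) - (u t0, ut t0)) @[t --> t0] --> 0%E;
  wave_dt : forall t,
    L2sq 0 (fun r => h^-1 * (u (t + h) r - u t r) - ut t r) @[h --> 0^']
      --> 0%E;
  wave_eqn : forall psi, rad_Hdot1 psi -> rad_L2 psi -> forall t : R,
    is_derive t (1 : R)
      (fun s => \int[mu]_(r in `]0%R, +oo[) (ut s r * psi r * r ^+ 4))
      (- \int[mu]_(r in `]0%R, +oo[) (derive1 (u t) r * derive1 psi r * r ^+ 4))
}.

(* f is compared pointwise (continuous representatives), g almost everywhere. *)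
Definition has_data (u ut : R -> R -> R) f g :=
  (forall r, 0 < r -> u 0 r = f r) /\
  {ae mu, forall r, 0 < r -> ut 0 r = g r}.

Definition exterior_energy (a : R) (u ut : R -> R -> R) (t : R) : \bar R :=
  energy (a + `|t|) (u t, ut t).

Definition max_limsup_exterior (a : R) (u ut : R -> R -> R) : \bar R :=
  maxe (limf_esup (exterior_energy a u ut) (pinfty_nbhs R))
       (limf_esup (exterior_energy a u ut) (ninfty_nbhs R)).

Definition in_plane_outside (a : R) f g :=
  exists c1 c2 : R,
    (forall r, a < r -> f r = c1 * r ^- 3) /\
    {ae mu, forall r, a < r -> g r = c2 * r ^- 3}.

End RadialSpaces.

(* Main.v *)
Require Import Defs.
From HB Require Import structures.
From mathcomp Require Import all_boot all_order all_algebra.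
From mathcomp Require Import all_classical all_reals all_analysis.
From mathcomp Require Import measurable_realfun ring lra.

(** In dimension five the radial wave equation is a one-dimensional one in
    disguise. Put X = r^2 u_r and Y = r^2 u_t, so that the energy outside the
    ball of radius b is the integral of X^2 + Y^2 over (b, oo), and put
      w = X - 3 r M_1 X = r^2 u_r + 3 r u,
      v = Y - M_0 Y = r^2 u_t - (the integral of x u_t over (r, oo)),
    where M_m X (r) is the integral of x^(-m-1) X(x) over (r, oo). Then
    w_t = v_r and v_t = w_r, so that w - v is constant along the lines
    r - t = const, and w + v along r + t = const.

    The map X |-> X - (2m+1) r^m M_m X annihilates r^(-m-1), and on (a, oo) it
    preserves the L^2 norm of the component of X orthogonal to r^(-m-1)
    (hardy_norm, perp_norm). As r^(-2) and r^(-1) are the profiles that the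
    plane gives to X and Y, the integral of w^2 + v^2 over (a, oo) at time 0 is
    exactly the squared norm of the projection of the data onto the orthogonal
    complement of the plane (energy_orth_perp).

    For t >= 0 the energy outside the ball of radius a + t is at least half of
    the integral of (w - v)^2 there, which by transport is half of its integral
    over (a, oo) at time 0; for t <= 0 the same holds with w + v
    (exterior_energy_ge). Since (w - v)^2 + (w + v)^2 = 2 (w^2 + v^2), one of
    the two time directions keeps half of the integral of w^2 + v^2 over
    (a, oo), and c = 1/2 works (max_limsup_ge).

    The equation holds in the weak sense only, so transport is proved by
    duality: the pairing of w - v with a test function that moves with speed
    one has zero time derivative (flux_derive), which gives the integrated form
    of the transport (transport); testing against mollifiers at Lebesgue points
    turns it into an identity almost everywhere (riemann_shift).

    If the data lie in the plane outside the ball of radius a, then w and v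
    vanish there at time 0, hence for r > a + |t| at time t. So X and Y are
    C1(t) r^(-2) and C2(t) r^(-1) in that region (hardy_eq0), and the equation
    forces C2' = 0 and C1' = -3 C2 (profile_evolution). The coefficients grow
    at most linearly, and the exterior energy is O(1/|t|). *)

Set Implicit Arguments.
Unset Strict Implicit.
Unset Printing Implicit Defensive.
Import Order.TTheory GRing.Theory Num.Theory.
Import numFieldNormedType.Exports.
Local Open Scope classical_set_scope.
Local Open Scope ring_scope.

(** * Square integrable functions *)

Section SquareIntegrable.
Context {R : realType}.
Notation mu := (@lebesgue_measure R).
Implicit Types (D E : set R) (X Y : R -> R).

Definition intg D X := mu.-integrable D (EFin \o X).

Definition sq D X := measurable_fun D X /\ intg D (fun x => X x ^+ 2).

Lemma intgD D X Y : measurable D -> intg D X -> intg D Y ->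
  intg D (fun x => X x + Y x).
Proof. by move=> mD iX iY; rewrite /intg; apply: (integrableD _ iX iY). Qed.

Lemma intgZ D c X : measurable D -> intg D X -> intg D (fun x => c * X x).
Proof. by move=> mD iX; rewrite /intg; apply: (integrableZl _ c iX). Qed.

Lemma intgN D X : measurable D -> intg D X -> intg D (fun x => - X x).
Proof. by move=> mD iX; rewrite /intg; apply: (integrableN iX). Qed.

Lemma intgB D X Y : measurable D -> intg D X -> intg D Y ->
  intg D (fun x => X x - Y x).
Proof. by move=> mD iX iY; exact: (intgD mD iX (intgN mD iY)). Qed.

Lemma intg_meas D X : intg D X -> measurable_fun D X.
Proof. by move=> /measurable_int /measurable_EFinP. Qed.

Lemma intg_le D X Y : measurable D -> measurable_fun D X ->
  (forall x, D x -> `|X x| <= Y x) -> intg D Y -> intg D X.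
Proof.
move=> mD mX XY iY; apply: (le_integrable _ _ _ iY) => //.
  exact/measurable_EFinP.
by move=> x Dx /=; rewrite lee_fin (le_trans (XY _ Dx))// ler_norm.
Qed.

Lemma intg_eq D X Y : measurable D -> {in D, X =1 Y} -> intg D X -> intg D Y.
Proof.
move=> mD XY; rewrite /intg; apply: eq_integrable => // x xD /=; by rewrite XY.
Qed.

Lemma intgS D E X : measurable D -> measurable E -> E `<=` D ->
  intg D X -> intg E X.
Proof. by move=> mD mE ED; exact: integrableS. Qed.

Lemma sq_meas D X : sq D X -> measurable_fun D X. Proof. by case. Qed.

Lemma sq_intgM D X Y : measurable D -> sq D X -> sq D Y ->
  intg D (fun x => X x * Y x).
Proof.
move=> mD [mX iX] [mY iY].
apply: (@intg_le _ _ (fun x => X x ^+ 2 + Y x ^+ 2)) => //.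
- exact: measurable_funM.
- move=> x _; rewrite normrM -(@real_normK _ (X x)) ?num_real//.
  rewrite -(@real_normK _ (Y x)) ?num_real//.
  have := sqr_ge0 (`|X x| - `|Y x|); have := normr_ge0 (X x).
  have := normr_ge0 (Y x); nra.
- exact: intgD.
Qed.

Lemma sqD D X Y : measurable D -> sq D X -> sq D Y -> sq D (fun x => X x + Y x).
Proof.
move=> mD sX sY; split; first by apply: measurable_funD; [case: sX|case: sY].
apply: (@intg_eq _ (fun x => X x * X x + (2 * (X x * Y x) + Y x * Y x))) => //.
  by move=> x _; ring.
apply: intgD => //; first exact: sq_intgM.
by apply: intgD => //; [apply: intgZ => //|]; exact: sq_intgM.
Qed.

Lemma sq_le D X Y : measurable D -> measurable_fun D X ->
  (forall x, D x -> `|X x| <= `|Y x|) -> sq D Y -> sq D X.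
Proof.
move=> mD mX XY [mY iY]; split => //; apply: (intg_le mD _ _ iY).
  exact: measurable_funX.
move=> x Dx; rewrite normrX -(@real_normK _ (Y x)) ?num_real//.
by rewrite ler_pXn2r ?nnegrE//; exact: XY.
Qed.

Lemma sqZ D c X : measurable D -> sq D X -> sq D (fun x => c * X x).
Proof.
move=> mD [mX iX]; split; first by apply: measurable_funM.
apply: (@intg_eq _ (fun x => c ^+ 2 * X x ^+ 2)) => //; last exact: intgZ.
by move=> x _; ring.
Qed.

Lemma sqN D X : measurable D -> sq D X -> sq D (fun x => - X x).
Proof.
by move=> mD [mX iX]; split; [exact: measurable_funN|under eq_fun do rewrite sqrrN].
Qed.

Lemma sqB D X Y : measurable D -> sq D X -> sq D Y -> sq D (fun x => X x - Y x).
Proof. by move=> mD sX sY; exact: sqD mD sX (sqN mD sY). Qed.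

Lemma sqS D E X : measurable D -> measurable E -> E `<=` D -> sq D X -> sq E X.
Proof.
move=> mD mE ED [mX iX]; split; first exact: measurable_funS mX.
exact: intgS iX.
Qed.

Lemma sq_eq D X Y : measurable D -> {in D, X =1 Y} -> sq D X -> sq D Y.
Proof.
move=> mD XY [mX iX]; split; first exact: eq_measurable_fun mX.
by apply: (intg_eq mD _ iX) => x xD; rewrite XY.
Qed.

Lemma sq_intg0 D X : sq D X -> intg D (fun x => X x ^+ 2).
Proof. by case. Qed.

Lemma sqP D X : measurable D -> sq D X <-> measurable_fun D X /\
  (\int[mu]_(x in D) (X x ^+ 2)%:E < +oo)%E.
Proof.
move=> mD; split=> -[mX iX]; split => //.
  by apply: (integrable_lty _ iX).
apply/integrableP; split.
  by apply/measurable_EFinP/measurable_funX.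
by under eq_integral do rewrite gee0_abs ?lee_fin ?sqr_ge0//.
Qed.

Lemma EFin_sq D X : measurable D -> sq D X ->
  (\int[mu]_(x in D) (X x ^+ 2)%:E)%E = (\int[mu]_(x in D) (X x ^+ 2))%:E.
Proof.
move=> mD [mX iX]; rewrite /Rintegral fineK//.
exact: integrable_fin_num.
Qed.

(** The Cauchy-Schwarz inequality, from the nonnegativity of the integral of
    (X - t Y)^2, a quadratic polynomial in t. *)
Lemma ip_sqr_le D X Y : measurable D -> sq D X -> sq D Y ->
  (\int[mu]_(x in D) (X x * Y x)) ^+ 2 <=
    (\int[mu]_(x in D) (X x ^+ 2)) * (\int[mu]_(x in D) (Y x ^+ 2)).
Proof.
move=> mD sX sY; set I := \int[mu]_(x in D) (X x * Y x).
set A := \int[mu]_(x in D) (X x ^+ 2); set B := \int[mu]_(x in D) (Y x ^+ 2).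
have A0 : 0 <= A by apply: Rintegral_ge0 => x _; exact: sqr_ge0.
have B0 : 0 <= B by apply: Rintegral_ge0 => x _; exact: sqr_ge0.
have h t : 0 <= A - 2 * t * I + t ^+ 2 * B.
  have iXY := sq_intgM mD sX sY.
  have iX := sq_intg0 sX; have iY := sq_intg0 sY.
  have -> : A - 2 * t * I + t ^+ 2 * B =
      \int[mu]_(x in D) ((X x ^+ 2 - (2 * t) * (X x * Y x)) + t ^+ 2 * Y x ^+ 2).
    rewrite RintegralD//; [|by apply: intgB => //; exact: intgZ|exact: intgZ].
    by rewrite RintegralB//; [rewrite !RintegralZl|exact: intgZ].
  apply: Rintegral_ge0 => x _.
  have -> : X x ^+ 2 - (2 * t) * (X x * Y x) + t ^+ 2 * Y x ^+ 2 = (X x - t * Y x) ^+ 2.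
    by ring.
  exact: sqr_ge0.
have [B00|B00] := eqVneq B 0.
  (* For B = 0 the polynomial is affine in t; with a nonzero slope it would
     take the value -1. *)
  have [->|I0] := eqVneq I 0; first by rewrite B00 mulr0 expr0n.
  have := h ((A + 1) / (2 * I)); rewrite B00 mulr0 addr0.
  have -> : A - 2 * ((A + 1) / (2 * I)) * I = - 1 by field.
  by rewrite ler0N1.
have Bp : 0 < B by rewrite lt_neqAle eq_sym B00.
(* The minimum over t is attained at I / B. *)
have := h (I / B).
have -> : A - 2 * (I / B) * I + (I / B) ^+ 2 * B = B^-1 * (A * B - I ^+ 2) by field.
by rewrite pmulr_rge0 ?invr_gt0// subr_ge0.
Qed.

End SquareIntegrable.

(** * Exchanging integrals over a triangle *)

Section Fubini_triangle.
Context {R : realType}.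
Notation mu := (@lebesgue_measure R).
Implicit Types (F H : R -> R).

Lemma intg_patch (D : set R) F : measurable D -> intg D F <-> intg setT (F \_ D).
Proof.
move=> mD; rewrite /intg; split => h.
  by rewrite -restrict_EFin; apply/(integrable_mkcond _ _).1.
by apply/(integrable_mkcond _ _).2 => //; rewrite restrict_EFin.
Qed.

Lemma measurable_natbool d (T : measurableType d) (D : set T) (p : T -> bool) :
  measurable D -> measurable_fun D p -> measurable_fun D (fun y => (p y)%:R : R).
Proof.
move=> mD mp; have -> : (fun y => (p y)%:R : R) = (fun y => if p y then 1 else 0).
  by apply/funext => y; case: (p y).
by apply: measurable_fun_if.
Qed.

Lemma intgM_bool (D : set R) F (p : R -> bool) : measurable D -> intg D F ->
  measurable_fun D p -> intg D (fun y => F y * (p y)%:R).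
Proof.
move=> mD iF mp; have mF := intg_meas iF.
have mp' : measurable_fun D (fun y => (p y)%:R : R).
  exact: measurable_natbool.
apply: (@intg_le _ _ _ (fun x => `|F x|)) => //; first exact: measurable_funM.
  by move=> x _; rewrite normrM; case: (p x); rewrite ?normr1 ?mulr1// normr0 mulr0.
exact: integrable_norm.
Qed.

(** Fubini applies because the integrand is dominated by |F x| |H y|. With the
    condition y <= x written as a factor, both iterated integrals range over
    the whole line. *)
Lemma fubini_le F H : intg setT F -> intg setT H ->
  \int[mu]_x (F x * \int[mu]_y (H y * ((y : R) <= x)%R%:R)) =
  \int[mu]_y (H y * \int[mu]_x (F x * ((y : R) <= x)%R%:R)).
Proof.
move=> iF iH; have mF := intg_meas iF; have mH := intg_meas iH.
pose K (z : R * R) := F z.1 * H z.2 * (z.2 <= z.1)%R%:R.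
have mle : measurable_fun [set: measurableTypeR R * measurableTypeR R]
    (fun z : R * R => (z.2 <= z.1 : bool)).
  by apply: measurable_fun_ler; [exact: measurable_snd|exact: measurable_fst].
have mK : measurable_fun [set: measurableTypeR R * measurableTypeR R] K.
  apply: measurable_funM.
    apply: measurable_funM.
      exact: (measurableT_comp mF measurable_fst).
    exact: (measurableT_comp mH measurable_snd).
  exact: measurable_natbool.
have iHx x : intg setT (fun y => H y * ((y : R) <= x)%R%:R).
  by apply: intgM_bool => //; apply: measurable_fun_ler.
have iFy y : intg setT (fun x => F x * ((y : R) <= x)%R%:R).
  by apply: intgM_bool => //; apply: measurable_fun_ler.
have iK : ((mu \x mu)%E).-integrable setT (EFin \o K).
  apply/integrable12ltyP; first exact/measurable_EFinP.
  apply: (@le_lt_trans _ _ (\int[mu]_x ((`|F x|)%:E * \int[mu]_y (`|H y|)%:E))%E).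
    apply: ge0_le_integral => //.
    - by move=> x _; apply: integral_ge0.
    - have mK' : measurable_fun setT (abse \o (EFin \o K)).
        by apply: measurableT_comp => //; exact/measurable_EFinP.
      exact: (@measurable_fun_fubini_tonelli_F _ _ _ _ R mu _ mK' (fun z => abse_ge0 _)).
    - by apply: emeasurable_funM => //; apply/measurable_EFinP/measurableT_comp.
    - move=> x _; rewrite -ge0_integralZl//; last exact/measurable_EFinP/measurableT_comp.
      apply: ge0_le_integral => //.
      + apply/measurable_EFinP/measurableT_comp => //.
        apply: (@measurable_funM _ _ _ _ (fun y => F x * H y)).
          by apply: measurable_funM.
        apply: (@measurable_natbool _ _ _ (fun y => ((y : R) <= x)%R)) => //.
        by apply: measurable_fun_ler.
      + by apply/measurable_EFinP/measurable_funM => //; exact: measurableT_comp.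
      + move=> y _; rewrite /= -EFinM lee_fin /K /= !normrM.
        by case: (y <= x); rewrite ?normr1 ?mulr1// normr0 mulr0 mulr_ge0.
  have /integrable_norm/integrable_fin_num := iH => /(_ measurableT) Hf.
  rewrite -(fineK Hf) ge0_integralZr//; last 2 first.
  - exact/measurable_EFinP/measurableT_comp.
  - by rewrite lee_fin; apply/fine_ge0/integral_ge0 => y _; rewrite lee_fin /=.
  have /integrable_norm/integrable_fin_num := iF => /(_ measurableT) Ff.
  by rewrite -(fineK Ff) -EFinM ltry.
have := Fubini iK => /= E.
rewrite /Rintegral; congr fine.
transitivity (\int[mu]_x \int[mu]_y (K (x, y))%:E)%E.
  apply: eq_integral => x _; rewrite -RintegralZl//; last exact: iHx.
  rewrite /Rintegral fineK.
    by apply: eq_integral => y _; rewrite /K/= mulrA.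
  by apply: integrable_fin_num => //; exact: intgZ.
apply: (etrans E).
apply: eq_integral => y _; rewrite -RintegralZl//; last exact: iFy.
rewrite /Rintegral fineK.
  by apply: eq_integral => x _; rewrite /K/=; congr EFin; ring.
by apply: integrable_fin_num => //; exact: intgZ.
Qed.

Lemma fubini_triangle F H a b : a <= b -> intg `[a, b] F -> intg `[a, b] H ->
  \int[mu]_(x in `[a, b]) (F x * \int[mu]_(y in `[a, x]) H y) =
  \int[mu]_(y in `[a, b]) (H y * \int[mu]_(x in `[y, b]) F x).
Proof.
move=> ab iF iH.
have /(intg_patch _ _).1 iF' := iF; have /(intg_patch _ _).1 iH' := iH.
have := fubini_le (iF' (measurable_itv _)) (iH' (measurable_itv _)).
rewrite [in X in _ -> X = _]Rintegral_mkcond [in X in _ -> _ = X]Rintegral_mkcond.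
move=> E; transitivity
  (\int[mu]_x ((F \_ `[a, b]) x * \int[mu]_y ((H \_ `[a, b]) y * ((y : R) <= x)%R%:R))).
  apply: eq_Rintegral => x _.
  rewrite !patchE; case: ifPn => [|_]; last by rewrite mul0r.
  rewrite inE/= in_itv/= => /andP[ay yb]; congr (_ * _).
  rewrite [LHS]Rintegral_mkcond; apply: eq_Rintegral => y _; rewrite !patchE.
  rewrite !mem_setE !in_itv/=.
  have [yx|xy] := leP (y : R) x; last by rewrite mulr0 andbF.
  by rewrite mulr1 (le_trans yx yb)/= ?andbT.
rewrite E; apply: eq_Rintegral => y _.
rewrite !patchE; case: ifPn => [|_]; last by rewrite mul0r.
rewrite inE/= in_itv/= => /andP[ay yb]; congr (_ * _).
rewrite [RHS]Rintegral_mkcond; apply: eq_Rintegral => x _; rewrite !patchE.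
rewrite !mem_setE !in_itv/=.
have [yx|xy] := leP (y : R) x; last by rewrite mulr0.
by rewrite mulr1 (le_trans ay yx)/=.
Qed.

End Fubini_triangle.

(** * Absolutely continuous functions *)

Section AbsolutelyContinuous.
Context {R : realType}.
Notation mu := (@lebesgue_measure R).
Implicit Types (f h F H : R -> R) (a b : R).

(** Absolute continuity, F being the derivative of f almost everywhere. The
    integral formula is the form in which it is known for Hdot^1 profiles. *)
Definition ac a b f F := intg `[a, b] F /\
  forall x, a <= x -> x <= b -> f x - f a = \int[mu]_(t in `[a, x]) F t.

Lemma Rintegral_split a c b F : a <= c -> c <= b -> intg `[a, b] F ->
  \int[mu]_(t in `[a, b]) F t =
  \int[mu]_(t in `[a, c]) F t + \int[mu]_(t in `[c, b]) F t.
Proof.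
move=> ac cb iF.
have := @Rintegral_itvB _ _ (BLeft a) (BRight b) c iF.
rewrite !bnd_simp => /(_ ac cb) /eqP; rewrite subr_eq => /eqP ->.
rewrite addrC Rintegral_itv_obnd_cbnd//.
apply: integrableS iF => //; apply: subset_itvr.
by rewrite bnd_simp.
Qed.

Lemma subset_itvcc a b c d : a <= c -> d <= b -> `[c, d] `<=` `[a, b]%classic.
Proof.
move=> ac db x /=; rewrite !in_itv/= => /andP[cx xd].
by rewrite (le_trans ac cx) (le_trans xd db).
Qed.

Lemma intg_itvS a b c d F : a <= c -> d <= b -> intg `[a, b] F -> intg `[c, d] F.
Proof. by move=> ac db; apply: intgS => //; exact: subset_itvcc. Qed.

Lemma ac_sub a b c d f F : a <= c -> c <= d -> d <= b -> ac a b f F -> ac c d f F.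
Proof.
move=> lac cd db [iF fF]; split; first exact: intg_itvS iF.
move=> x cx xd; have xb := le_trans xd db.
have /eqP := fF x (le_trans lac cx) xb; rewrite subr_eq => /eqP ->.
have /eqP := fF c lac (le_trans cx xb); rewrite subr_eq => /eqP ->.
rewrite (@Rintegral_split a c x)//; first by ring.
exact: intg_itvS iF.
Qed.

Lemma ac_eq a b f F : a <= b -> ac a b f F ->
  f b - f a = \int[mu]_(t in `[a, b]) F t.
Proof. by move=> ab [_ ->]. Qed.

Lemma ac_continuous a b f F : a <= b -> ac a b f F ->
  {within `[a, b], continuous f}.
Proof.
move=> ab [iF fF].
have := parameterized_integral_continuous ab iF => cF.
have : {within `[a, b], continuous (fun x => f a + parameterized_integral mu a x F)}.
  by move=> x; apply: cvgD; [exact: cvg_cst|exact: cF].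
apply: subspace_eq_continuous => x; rewrite inE/= in_itv/= => /andP[ax xb].
have E : parameterized_integral mu a x F = f x - f a by rewrite (fF _ ax xb).
rewrite /from_subspace E; exact: subrKC.
Qed.

Lemma within_continuous_meas a b f : {within `[a, b], continuous f} ->
  measurable_fun `[a, b] f.
Proof. by move=> cf; apply: subspace_continuous_measurable_fun. Qed.

Lemma within_continuous_bounded a b f : {within `[a, b], continuous f} ->
  exists M, 0 < M /\ forall x, a <= x -> x <= b -> `|f x| <= M.
Proof.
move=> cf; have /compact_bounded[M [Mr Mf]] := continuous_compact cf (@segment_compact _ a b).
exists (`|M| + 1); split; first by rewrite ltr_wpDl.
move=> x ax xb; apply: (Mf (`|M| + 1)); first by rewrite ltr_pwDr// ler_norm.
by exists x => //=; rewrite in_itv/= ax.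
Qed.

Lemma intgM_continuous a b f F : {within `[a, b], continuous f} ->
  intg `[a, b] F -> intg `[a, b] (fun x => f x * F x).
Proof.
move=> cf iF; have [M [M0 fM]] := within_continuous_bounded cf.
apply: (@intg_le _ _ _ (fun x => M * `|F x|)) => //.
- apply: measurable_funM; first exact: within_continuous_meas.
  exact: intg_meas.
- move=> x /=; rewrite in_itv/= => /andP[ax xb].
  by rewrite normrM ler_wpM2r// fM.
- by apply: intgZ => //; exact: integrable_norm.
Qed.

Lemma ac_intgM a b f F G : a <= b -> ac a b f F -> intg `[a, b] G ->
  intg `[a, b] (fun x => f x * G x).
Proof. by move=> ab /(ac_continuous ab); exact: intgM_continuous. Qed.

Lemma ac_intgMr a b f F G : a <= b -> ac a b f F -> intg `[a, b] G ->
  intg `[a, b] (fun x => G x * f x).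
Proof.
move=> ab acf iG; apply: (intg_eq _ _ (ac_intgM ab acf iG)) => // x _.
exact: mulrC.
Qed.

(** The product rule. Writing the increments of f and h as integrals of F and
    H, it becomes the exchange of integrals in fubini_triangle. *)
Lemma ac_mul a b f F h H : a <= b -> ac a b f F -> ac a b h H ->
  ac a b (fun x => f x * h x) (fun x => F x * h x + f x * H x).
Proof.
move=> ab acf ach; split.
  apply: intgD => //; last by apply: (ac_intgM ab acf); case: ach.
  by apply: (ac_intgMr ab ach); case: acf.
move=> c ac' cb; have {}acf := ac_sub (lexx a) ac' cb acf.
have {}ach := ac_sub (lexx a) ac' cb ach.
move: b ac' cb acf ach {ab} => _ ac' _ acf ach.
have [iF fF] := acf; have [iH hH] := ach.
have iFh : intg `[a, c] (fun x => F x * h x).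
  exact: (ac_intgMr ac' ach).
have ifH : intg `[a, c] (fun x => f x * H x) by exact: (ac_intgM ac' acf).
rewrite RintegralD//.
have := fubini_triangle ac' iF iH.
rewrite (_ : \int[mu]_(x in _) (F x * _) =
   \int[mu]_(x in `[a, c]) (F x * h x - h a * F x)); last first.
  apply: eq_Rintegral => x; rewrite inE/= in_itv/= => /andP[ax xc].
  by rewrite -hH//; ring.
rewrite (_ : \int[mu]_(y in _) (H y * _) =
   \int[mu]_(x in `[a, c]) (f c * H x - f x * H x)); last first.
  apply: eq_Rintegral => x; rewrite inE/= in_itv/= => /andP[ax xc].
  have [_ /(_ c xc (lexx _)) <-] := ac_sub ax xc (lexx c) acf.
  by ring.
rewrite !RintegralB//; [|exact: intgZ..].
rewrite !RintegralZl// -(fF c)// -(hH c)// => E.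
set I := \int[mu]_(x in _) (F x * h x) in E *.
set J := \int[mu]_(x in _) (f x * H x) in E *.
lra.
Qed.

Lemma ac_C1 a b f F : (forall x, a <= x -> x <= b -> is_derive x 1 f (F x)) ->
  {within `[a, b], continuous F} -> ac a b f F.
Proof.
move=> df cF; split.
  by apply: continuous_compact_integrable => //; exact: segment_compact.
move=> x ax xb; move: (ax); rewrite le_eqVlt => /predU1P[<-|lax].
  by rewrite set_itv1 Rintegral_set1 subrr.
have cf y : a <= y -> y <= b -> {for y, continuous f}.
  move=> ay yb; apply/differentiable_continuous/derivable1_diffP.
  by have [] := df _ ay yb.
rewrite /Rintegral (@continuous_FTC2 _ F f)//=.
- by apply: continuous_subspaceW cF; exact: subset_itvcc.
- split.
  + move=> y; rewrite in_itv/= => /andP[ay yx].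
    by have [] := df _ (ltW ay) (le_trans (ltW yx) xb).
  + by apply: cvg_at_right_filter; apply: cf => //; exact: le_trans xb.
  + by apply: cvg_at_left_filter; apply: cf.
- move=> y; rewrite in_itv/= => /andP[ay yx].
  have d := df _ (ltW ay) (le_trans (ltW yx) xb).
  by rewrite derive1E; exact: derive_val.
Qed.

Lemma ac_ext a b f g F G : a <= b -> ac a b f F ->
  (forall x, a <= x -> x <= b -> f x = g x) ->
  (forall x, a <= x -> x <= b -> F x = G x) -> ac a b g G.
Proof.
move=> ab [iF fF] fg FG; split.
  by apply: (intg_eq _ _ iF) => // x; rewrite inE/= in_itv/= => /andP[? ?]; exact: FG.
move=> x ax xb; rewrite -!fg// fF//; apply: eq_Rintegral => y.
rewrite inE/= in_itv/= => /andP[ay yx]; rewrite FG//.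
exact: le_trans xb.
Qed.

Lemma acZ a b c f F : ac a b f F -> ac a b (fun x => c * f x) (fun x => c * F x).
Proof.
move=> [iF fF]; split; first exact: intgZ.
move=> x ax xb; rewrite -mulrBr fF// RintegralZl//.
exact: intg_itvS iF.
Qed.

End AbsolutelyContinuous.

(** * Integrals over half-lines *)

Section HalfLine.
Context {R : realType}.
Notation mu := (@lebesgue_measure R).
Implicit Types (f g F X Y Z : R -> R) (a b r s : R) (n : nat).

Lemma cvg_powN n : (x ^- n.+1 : R) @[x --> +oo] --> (0 : R).
Proof.
apply/cvgrPdist_lt => e e0; near=> x.
have x1 : 1 <= x by near: x; exact/nbhs_pinfty_ge/num_real.
have x0 : 0 < x by exact: lt_le_trans x1.
have xn0 : 0 < x ^+ n.+1 by exact: exprn_gt0.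
rewrite sub0r normrN gtr0_norm ?invr_gt0// invf_plt ?posrE//.
apply: (@lt_le_trans _ _ x); first by near: x; exact/nbhs_pinfty_gt/num_real.
exact: ler_eXnr.
Unshelve. all: by end_near. Qed.

Lemma is_derive_powN n (x : R) : x != 0 ->
  is_derive x 1 (fun y : R => y ^- n) (- n%:R * x ^- n.+1).
Proof.
move=> x0; have d : is_derive x 1 (fun y : R => y ^+ n) ((n%:R * x ^+ n.-1) *: 1).
  have := @is_deriveX R R id n x 1 1 (is_derive_id x 1).
  by rewrite (_ : id ^+ n = fun y : R => y ^+ n)//; apply/funext => y; rewrite exprfctE.
have xn0 : x ^+ n != 0 by rewrite expf_neq0.
have -> : - n%:R * x ^- n.+1 = - (x ^+ n) ^- 2 *: ((n%:R * x ^+ n.-1) *: 1).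
  rewrite /GRing.scale/= mulr1.
  case: n {d} xn0 => [|n] xn0; first by rewrite oppr0 !mul0r mulr0.
  rewrite /= !exprS expr0 mulr1; have : x ^+ n != 0 by rewrite expf_neq0.
  move: (x ^+ n) => y y0; field; by rewrite x0 y0.
exact: (@is_deriveV R (fun y : R => y ^+ n) x _ 1 xn0 d).
Qed.

Lemma powN_continuous n (x : R) : x != 0 -> {for x, continuous (fun y : R => y ^- n)}.
Proof.
move=> x0; apply/differentiable_continuous/derivable1_diffP.
by have [] := is_derive_powN n x0.
Qed.

Lemma measurable_powN n a : 0 <= a -> measurable_fun `]a, +oo[ (fun y : R => y ^- n).
Proof.
move=> a0; apply: open_continuous_measurable_fun => //.
move=> x; rewrite inE/= in_itv/= andbT => ax.
by apply: powN_continuous; rewrite gt_eqF// (le_lt_trans a0).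
Qed.

Lemma integral_powN n a : 0 < a ->
  (\int[mu]_(x in `]a, +oo[) (x ^- n.+2)%:E)%E = (n.+1%:R^-1 * a ^- n.+1)%:E.
Proof.
move=> a0; pose P (x : R) := - n.+1%:R^-1 * x ^- n.+1.
have dP (x : R) : 0 < x -> is_derive x 1 P (x ^- n.+2).
  move=> x0; have xn0 : x != 0 by rewrite gt_eqF.
  have := is_deriveZ (- n.+1%:R^-1 : R) (is_derive_powN n.+1 xn0).
  by rewrite /GRing.scale/= mulrA mulrNN mulVf ?mul1r// pnatr_eq0.
have cP x : 0 < x -> {for x, continuous P}.
  by move=> x0; apply/differentiable_continuous/derivable1_diffP; case: (dP x x0).
rewrite integral_itv_obnd_cbnd; last first.
  by apply/measurable_EFinP; exact: (measurable_powN _ (ltW a0)).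
rewrite (@ge0_continuous_FTC2y _ _ P _ 0).
- by rewrite -EFinB sub0r /P mulNr opprK.
- by move=> x ax; rewrite invr_ge0 exprn_ge0// (le_trans (ltW a0)).
- apply: continuous_in_subspaceT => x; rewrite inE/= in_itv/= andbT => ax.
  by apply: powN_continuous; rewrite gt_eqF// (lt_le_trans a0).
- rewrite -(mulr0 (- n.+1%:R^-1 : R)); apply: cvgM; first exact: cvg_cst.
  exact: cvg_powN.
- by move=> x ax; case: (dP x (lt_trans a0 ax)).
- by apply: cvg_at_right_filter; exact: cP.
- move=> x; rewrite in_itv/= andbT => ax.
  by rewrite derive1E; have := dP x (lt_trans a0 ax) => d; exact: derive_val.
Qed.

Lemma intg_powN n a : 0 < a -> intg `]a, +oo[ (fun x => x ^- n.+2).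
Proof.
move=> a0; apply/integrableP; split.
  by apply/measurable_EFinP; exact: (measurable_powN _ (ltW a0)).
under eq_integral => x xa.
  rewrite /= ger0_norm; last first.
    by move: xa; rewrite inE/= in_itv/= andbT => ax; rewrite invr_ge0 exprn_ge0// (le_trans (ltW a0))// ltW.
  over.
by rewrite integral_powN// ltry.
Qed.

Lemma Rintegral_powN n a : 0 < a ->
  \int[mu]_(x in `]a, +oo[) (x ^- n.+2) = n.+1%:R^-1 * a ^- n.+1.
Proof. by move=> a0; rewrite /Rintegral integral_powN. Qed.

Lemma sq_powN n a : 0 < a -> sq `]a, +oo[ (fun x => x ^- n.+1).
Proof.
move=> a0; split; first exact: measurable_powN (ltW a0).
have := @intg_powN n.*2 a a0; apply: intg_eq => // x _.
by rewrite -exprVn -exprVn -exprM muln2 doubleS.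
Qed.

Lemma subset_itvoy a b : a <= b -> `]b, +oo[ `<=` `]a, +oo[%classic.
Proof.
by move=> ab x /=; rewrite !in_itv/= !andbT; exact: le_lt_trans.
Qed.

Lemma subset_itvccoy a b c : a < b -> `[b, c] `<=` `]a, +oo[%classic.
Proof.
by move=> ab x /=; rewrite !in_itv/= andbT => /andP[bx _]; exact: lt_le_trans bx.
Qed.

Lemma intg_oyS a b F : a <= b -> intg `]a, +oo[ F -> intg `]b, +oo[ F.
Proof. by move=> ab; apply: intgS => //; exact: subset_itvoy. Qed.

Lemma intg_ccS a b c F : a < b -> intg `]a, +oo[ F -> intg `[b, c] F.
Proof. by move=> ab; apply: intgS => //; exact: subset_itvccoy. Qed.

Lemma sq_oyS a b F : a <= b -> sq `]a, +oo[ F -> sq `]b, +oo[ F.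
Proof. by move=> ab; apply: sqS => //; exact: subset_itvoy. Qed.

Lemma RintegralN (D : set R) X : measurable D -> intg D X ->
  \int[mu]_(x in D) (- X x) = - \int[mu]_(x in D) X x.
Proof.
move=> mD iX; rewrite -mulN1r -RintegralZl//.
by apply: eq_Rintegral => x _; rewrite mulN1r.
Qed.

Definition tail F r := \int[mu]_(x in `]r, +oo[) F x.

Lemma tail_split a b F : a <= b -> intg `]a, +oo[ F ->
  tail F a = \int[mu]_(x in `[a, b]) F x + tail F b.
Proof.
move=> ab iF; have := @Rintegral_itvB _ F (BRight a) +oo%O b iF.
rewrite bnd_simp => /(_ ab erefl) /eqP; rewrite subr_eq => /eqP E.
rewrite /tail E addrC Rintegral_itv_obnd_cbnd//.
by apply: intgS iF => // x /=; rewrite !in_itv/= andbT => /andP[].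
Qed.

Lemma tail_ac a b c F : a < b -> intg `]a, +oo[ F ->
  ac b c (tail F) (fun x => - F x).
Proof.
move=> ab iF; split; first by apply: intgN => //; exact: intg_ccS iF.
move=> x bx xc; rewrite (@tail_split b x)//; last exact: intg_oyS (ltW ab) iF.
by rewrite RintegralN//; [ring|exact: intg_ccS iF].
Qed.

Lemma cvg_Rintegral_oy a F : intg `]a, +oo[ F ->
  \int[mu]_(x in `[a, b]) F x @[b --> +oo] --> tail F a.
Proof.
move=> iF; apply/cvg_pinftyP => u uy.
have mF : measurable_fun `]a, +oo[ F by exact: intg_meas.
pose f_ n := EFin \o (F \_ `]a, u n]).
have fin n : (\int[mu]_(x in `]a, +oo[) f_ n x = (\int[mu]_(x in `[a, u n]) F x)%:E)%E.
  rewrite /f_ -restrict_EFin -integral_mkcondr.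
  have -> : `]a, +oo[ `&` `]a, u n] = `]a, u n]%classic.
    by apply/seteqP; split => x /=; rewrite !in_itv/= andbT; [case|move=> /andP[->]].
  have iau : intg `]a, u n] F.
    by apply: intgS iF => // x /=; rewrite !in_itv/= andbT => /andP[].
  rewrite -Rintegral_itv_obnd_cbnd// /Rintegral fineK//.
  exact: integrable_fin_num.
have [|||||_ _] := @dominated_convergence _ _ _ mu `]a, +oo[%classic (measurable_itv _)
  f_ (EFin \o F) (EFin \o (fun x => `|F x|)).
- move=> n; apply/measurable_EFinP; apply/measurable_restrict => //.
  by apply: measurable_funS mF => // x [].
- exact/measurable_EFinP.
- apply/aeW => x; rewrite /= in_itv/= andbT => ax.
  apply: cvg_near_cst.
  have /cvgryPge/(_ x)[N _ uN] := uy; exists N => // n /uN /= xu.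
  by rewrite /f_ /= patchE mem_set//= in_itv/= ax.
- exact: integrable_norm.
- apply/aeW => x n _; rewrite /f_ /= lee_fin patchE.
  by case: ifPn => // _; rewrite normr0.
under eq_fun do rewrite fin.
have -> : (\int[mu]_(x in `]a, +oo[) (EFin \o F) x = (tail F a)%:E)%E.
  by rewrite /tail /Rintegral fineK//; exact: integrable_fin_num.
by move=> /fine_cvgP[_].
Qed.

Lemma tail_cvg0 a F : intg `]a, +oo[ F -> tail F b @[b --> +oo] --> 0.
Proof.
move=> iF; rewrite -(subrr (tail F a)).
have : (tail F a - \int[mu]_(x in `[a, b]) F x) @[b --> +oo] --> tail F a - tail F a.
  by apply: cvgB; [exact: cvg_cst|exact: cvg_Rintegral_oy].
apply: cvg_trans; apply: near_eq_cvg; near=> b.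
have ab : a <= b by near: b; exact/nbhs_pinfty_ge/num_real.
by rewrite (@tail_split a b)// addrC addKr.
Unshelve. all: by end_near. Qed.

Lemma ac_cvg0_tail a f F : intg `]a, +oo[ F ->
  (forall r s, a < r -> r < s -> f s - f r = \int[mu]_(x in `[r, s]) F x) ->
  f r @[r --> +oo] --> 0 -> forall r, a < r -> f r = - tail F r.
Proof.
move=> iF fF f0 r ar.
have h : (f s - f r) @[s --> +oo] --> tail F r.
  have := cvg_Rintegral_oy (intg_oyS (ltW ar) iF).
  apply: cvg_trans; apply: near_eq_cvg; near=> s.
  have rs : r < s by near: s; exact/nbhs_pinfty_gt/num_real.
  by rewrite -fF.
have h' : (f s - f r) @[s --> +oo] --> 0 - f r.
  by apply: cvgB => //; exact: cvg_cst.
have := cvg_unique _ h h'; rewrite sub0r => ->//.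
by rewrite opprK.
Unshelve. all: by end_near. Qed.

(** Monotone convergence. It serves to show that the Hardy transform is square
    integrable, as the identity behind hardy_norm is first available on
    bounded intervals only. *)
Lemma intg_bounded a X C : measurable_fun `]a, +oo[ X ->
  (forall x, a < x -> 0 <= X x) ->
  (forall b, a <= b -> intg `[a, b] X /\ \int[mu]_(x in `[a, b]) X x <= C) ->
  intg `]a, +oo[ X.
Proof.
move=> mX X0 XC; apply/integrableP; split; first exact/measurable_EFinP.
under eq_integral => x xa.
  rewrite /= ger0_norm; last by apply: X0; move: xa; rewrite inE/= in_itv/= andbT.
  over.
pose F n := `]a, a + n%:R]%classic.
have UF : \bigcup_i F i = `]a, +oo[%classic.
  apply/seteqP; split => [x [n _]|x]; rewrite /F /= !in_itv/= andbT.
    by move=> /andP[].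
  move=> ax; exists (Num.truncn (x - a)).+1 => //=; rewrite in_itv/= ax/=.
  by rewrite -lerBlDl ltW// truncnS_gt.
have h : (\int[mu]_(x in F n) (X x)%:E)%E @[n --> \oo] -->
    (\int[mu]_(x in \bigcup_i F i) (X x)%:E)%E.
  apply: ge0_nondecreasing_set_cvg_integral.
  - move=> n m nm; apply/subsetPset => x; rewrite /F/= !in_itv/= => /andP[-> /=].
    by move=> /le_trans; apply; rewrite lerD2l ler_nat.
  - by move=> n; exact: measurable_itv.
  - move=> n; apply/measurable_EFinP; apply: measurable_funS mX => // x.
    by rewrite /F/= !in_itv/= andbT => /andP[].
  - by move=> n x; rewrite /F/= in_itv/= lee_fin => /andP[/X0].
rewrite UF in h.
apply: (@le_lt_trans _ _ C%:E); last exact: ltry.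
apply: (cvge_le _ h).
apply: nearW => n.
have an : a <= a + n%:R by rewrite lerDl.
have [ian le] := XC _ an; rewrite -lee_fin in le; apply: le_trans le.
rewrite /F integral_itv_obnd_cbnd; last first.
  apply/measurable_EFinP; apply: measurable_funS mX => // x.
  by rewrite /= !in_itv/= andbT => /andP[].
rewrite /Rintegral fineK//.
exact: integrable_fin_num.
Qed.

End HalfLine.

(** * Integrals of functions that agree almost everywhere *)

Section AlmostEverywhere.
Import HBNNSimple.
Context {R : realType}.
Notation mu := (@lebesgue_measure R).

Lemma ae_filterS (P Q : R -> Prop) : (forall r, P r -> Q r) ->
  {ae mu, forall r, P r} -> {ae mu, forall r, Q r}.
Proof. by move=> PQ; apply: (@filterS _ _ (ae_filter_ringOfSetsType mu)). Qed.

Lemma ae_filterS2 (P P' Q : R -> Prop) : (forall r, P r -> P' r -> Q r) ->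
  {ae mu, forall r, P r} -> {ae mu, forall r, P' r} -> {ae mu, forall r, Q r}.
Proof. by move=> PQ; apply: (@filterS2 _ _ (ae_filter_ringOfSetsType mu)). Qed.

(** This holds without measurability of F and G: a simple function below F
    falls below G once it is replaced by zero on a measurable null set.
    Generality of this kind is used for the derivative of a difference, which
    is known almost everywhere only, and not as a measurable function. *)
Lemma ge0_ae_le_integral (F G : R -> \bar R) :
  (forall x, 0 <= F x)%E -> (forall x, 0 <= G x)%E ->
  {ae mu, forall x, F x = G x} ->
  (\int[mu]_x F x <= \int[mu]_x G x)%E.
Proof.
move=> F0 G0 [N [mN N0 FGN]].
rewrite !ge0_integralTE//; apply: ub_ereal_sup => _ [h /= hF <-].
pose h' := proj_nnsfun h (measurableC mN).
have h'G x : ((h' x)%:E <= G x)%E.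
  rewrite /h'/= /mindic indicE; have [xN|xN] := boolP (x \in ~` N); last by rewrite mulr0 G0.
  rewrite mulr1; suff <- : F x = G x by exact: hF.
  by apply: contrapT => FG; move: xN; rewrite inE; apply; exact: FGN.
have -> : sintegral mu h = sintegral mu h'.
  rewrite -!integralT_nnsfun; apply: ae_eq_integral => //.
  - exact/measurable_EFinP.
  - exact/measurable_EFinP.
  - exists N; split => // x; apply: contra_notP => xN _ /=.
    by rewrite /mindic indicE mem_set ?mulr1.
by apply: ereal_sup_ubound; exists h'.
Qed.

Lemma ge0_ae_integral (F G : R -> \bar R) :
  (forall x, 0 <= F x)%E -> (forall x, 0 <= G x)%E ->
  {ae mu, forall x, F x = G x} -> (\int[mu]_x F x = \int[mu]_x G x)%E.
Proof.
move=> F0 G0 FG; apply/eqP; rewrite eq_le !ge0_ae_le_integral//.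
by apply: ae_filterS FG => x ->.
Qed.

Lemma ae_integral (D : set R) (F G : R -> \bar R) :
  {ae mu, forall x, D x -> F x = G x} ->
  (\int[mu]_(x in D) F x = \int[mu]_(x in D) G x)%E.
Proof.
move=> FG; rewrite [LHS]integral_mkcond [RHS]integral_mkcond [LHS]integralE [RHS]integralE.
have FG' : {ae mu, forall x, (F \_ D) x = (G \_ D) x}.
  apply: ae_filterS FG => x FGx; rewrite !patchE.
  by case: ifPn => //; rewrite inE.
by congr (_ - _)%E; apply: ge0_ae_integral => //;
  apply: ae_filterS FG' => x FGx;
  rewrite ?funeposE ?funenegE FGx.
Qed.

Lemma ae_Rintegral (D : set R) (F G : R -> R) :
  {ae mu, forall x, D x -> F x = G x} ->
  \int[mu]_(x in D) F x = \int[mu]_(x in D) G x.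
Proof.
move=> FG; rewrite /Rintegral; congr fine; apply: ae_integral.
by apply: ae_filterS FG => x FGx /FGx ->.
Qed.

End AlmostEverywhere.

(** * The Hardy transforms *)

Section Hardy.
Context {R : realType}.
Notation mu := (@lebesgue_measure R).
Implicit Types (f g F X Y Z : R -> R) (a b r s : R) (m n : nat).

Lemma ac_continuous_at f F : (forall a b, 0 < a -> a <= b -> ac a b f F) ->
  forall x, 0 < x -> {for x, continuous f}.
Proof.
move=> acf x x0; have h0 : 0 < x / 2 by rewrite divr_gt0.
have h1 : x / 2 < x by rewrite ltr_pdivrMr// ltr_pMr// ltr1n.
have h2 : x < x + 1 by rewrite ltrDl.
have h3 := lt_trans h1 h2.
have := ac_continuous (ltW h3) (acf _ _ h0 (ltW h3)).
by move=> /continuous_within_itvP => /(_ h3) [+ _ _]; apply; rewrite in_itv/= h1.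
Qed.

Lemma continuous_at_meas f a : 0 <= a ->
  (forall x, 0 < x -> {for x, continuous f}) -> measurable_fun `]a, +oo[ f.
Proof.
move=> a0 cf; apply: open_continuous_measurable_fun => //.
move=> x; rewrite inE/= in_itv/= andbT => ax; apply: cf.
exact: le_lt_trans ax.
Qed.

Lemma ac_pow n a b : ac a b (fun x => x ^+ n) (fun x : R => n%:R * x ^+ n.-1).
Proof.
apply: ac_C1 => [x _ _|].
  have := @is_deriveX R R id n x 1 1 (is_derive_id x 1).
  rewrite (_ : id ^+ n = fun y : R => y ^+ n); last by apply/funext => y; rewrite exprfctE.
  by rewrite /GRing.scale/= mulr1.
apply: continuous_in_subspaceT => x _; apply: cvgM; first exact: cvg_cst.
exact: exprn_continuous.
Qed.

(** The inner product of X with x^(-m-1), which is the profile of r^2 f_r (for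
    m = 1) and of r^2 f (for m = 0) when f is a multiple of r^(-3). *)
Definition mom m X r := tail (fun x => x ^- m.+1 * X x) r.

(** For m = 1 and X = r^2 u_r this is r^2 u_r + 3 r u; for m = 0 and
    X = r^2 u_t it is r^2 u_t minus the integral of x u_t over (r, oo). The
    coefficient 2m+1 makes the transform of r^(-m-1) vanish. *)
Definition hardy m X r := X r - m.*2.+1%:R * r ^+ m * mom m X r.

Lemma sq_meas0 X a : 0 <= a -> sq `]0, +oo[ X -> measurable_fun `]a, +oo[ X.
Proof. by move=> a0 sX; have [] := sq_oyS a0 sX. Qed.

Lemma intg_mom m X a : 0 < a -> sq `]0, +oo[ X ->
  intg `]a, +oo[ (fun x => x ^- m.+1 * X x).
Proof.
by move=> a0 sX; apply: sq_intgM => //; [exact: sq_powN|exact: sq_oyS (ltW a0) sX].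
Qed.

Lemma mom_ac m X a b : 0 < a -> sq `]0, +oo[ X ->
  ac a b (mom m X) (fun x => - (x ^- m.+1 * X x)).
Proof.
move=> a0 sX; have h0 : 0 < a / 2 by rewrite divr_gt0.
apply: (@tail_ac _ (a / 2)); last exact: intg_mom.
by rewrite ltr_pdivrMr// ltr_pMr// ltr1n.
Qed.

Lemma mom_meas m X a : 0 <= a -> sq `]0, +oo[ X -> measurable_fun `]a, +oo[ (mom m X).
Proof.
move=> a0 sX; apply: continuous_at_meas => //.
by apply: ac_continuous_at => b c b0 bc; exact: mom_ac.
Qed.

Lemma hardy_meas m X a : 0 <= a -> sq `]0, +oo[ X -> measurable_fun `]a, +oo[ (hardy m X).
Proof.
move=> a0 sX; apply: measurable_funB; first exact: sq_meas0.
apply: measurable_funM; last exact: mom_meas.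
by apply: measurable_funM => //; exact: measurable_funX.
Qed.

(** Cauchy-Schwarz against x^(-m-1). *)
Lemma mom_bound m X a : 0 < a -> sq `]0, +oo[ X ->
  a ^+ m.*2.+1 * mom m X a ^+ 2 <= m.*2.+1%:R^-1 * tail (fun x => X x ^+ 2) a.
Proof.
move=> a0 sX.
have := @ip_sqr_le R `]a, +oo[%classic (fun x => x ^- m.+1) X (measurable_itv _)
  (sq_powN m a0) (sq_oyS (ltW a0) sX).
rewrite -[X in X <= _]/(mom m X a ^+ 2).
rewrite (_ : \int[mu]_(x in _) (x ^- m.+1) ^+ 2 = m.*2.+1%:R^-1 * a ^- m.*2.+1).
  move=> h; have an : 0 < a ^+ m.*2.+1 by exact: exprn_gt0.
  by rewrite mulrC -ler_pdivlMr// (le_trans h)// -/(tail _ a) -!mulrA (mulrC (a ^- _)).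
rewrite -(Rintegral_powN m.*2 a0); apply: eq_Rintegral => x _.
by rewrite -exprVn -exprVn -exprM muln2 doubleS.
Qed.

Lemma mom_cvg0 m X : sq `]0, +oo[ X ->
  r ^+ m.*2.+1 * mom m X r ^+ 2 @[r --> +oo] --> 0.
Proof.
move=> sX.
have h : (m.*2.+1%:R^-1 * tail (fun x => X x ^+ 2) r) @[r --> +oo] --> 0.
  rewrite -(mulr0 (m.*2.+1%:R^-1)); apply: cvgM; first exact: cvg_cst.
  by apply: (@tail_cvg0 _ 0); exact: sq_intg0.
apply: (squeeze_cvgr _ (cvg_cst 0) h).
near=> r; have r0 : 0 < r by near: r; exact/nbhs_pinfty_gt/num_real.
by rewrite mom_bound// andbT mulr_ge0 ?sqr_ge0// exprn_ge0// ltW.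
Unshelve. all: by end_near. Qed.

(** The terms of hardy^2 - X^2 that contain the moment form a total
    derivative; this is where the same coefficient 2m+1 is needed once more. *)
Lemma hardy_ac m X a b : 0 < a -> a <= b -> sq `]0, +oo[ X ->
  ac a b (fun r => m.*2.+1%:R * (r ^+ m.*2.+1 * mom m X r ^+ 2))
         (fun r => hardy m X r ^+ 2 - X r ^+ 2).
Proof.
move=> a0 ab sX.
have acM := @mom_ac m X a b a0 sX.
apply: (ac_ext ab (acZ m.*2.+1%:R
  (ac_mul ab (ac_pow m.*2.+1 a b) (ac_mul ab acM acM)))) => x ax xb; first by rewrite expr2.
have x0 : x != 0 by rewrite gt_eqF// (lt_le_trans a0).
rewrite /hardy -[m.*2.+1.-1]/(m.*2) !exprS -addnn !exprD.
have xm : x ^+ m != 0 by rewrite expf_neq0.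
move: (x ^+ m) xm => y y0; move: (_%:R) => c; field.
by rewrite x0 y0.
Qed.

Lemma hardy_sq m X a : 0 < a -> sq `]0, +oo[ X -> sq `]a, +oo[ (hardy m X).
Proof.
move=> a0 sX; split; first exact: hardy_meas (ltW a0) sX.
apply: (@intg_bounded _ _ _ (tail (fun x => X x ^+ 2) 0 + tail (fun x => X x ^+ 2) 0)).
- by apply: measurable_funX; exact: hardy_meas (ltW a0) sX.
- by move=> x _; exact: sqr_ge0.
move=> b ab; have acP := hardy_ac m a0 ab sX.
have b0 : 0 < b := lt_le_trans a0 ab.
have iX : intg `[a, b] (fun x => X x ^+ 2).
  exact: intg_ccS a0 (sq_intg0 sX).
have iT : intg `[a, b] (fun x => hardy m X x ^+ 2).
  have := intgD (measurable_itv _) acP.1 iX; apply: intg_eq => // x _.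
  by rewrite subrK.
split => //.
have tb c : 0 < c -> tail (fun x => X x ^+ 2) c <= tail (fun x => X x ^+ 2) 0.
  move=> c0; rewrite (tail_split (ltW c0) (sq_intg0 sX)) lerDr.
  by apply: Rintegral_ge0 => x _; exact: sqr_ge0.
have := ac_eq ab acP; rewrite RintegralB// => E.
have -> : \int[mu]_(x in `[a, b]) hardy m X x ^+ 2 = \int[mu]_(x in `[a, b]) X x ^+ 2 +
  (m.*2.+1%:R * (b ^+ m.*2.+1 * mom m X b ^+ 2) -
   m.*2.+1%:R * (a ^+ m.*2.+1 * mom m X a ^+ 2)) by rewrite E addrC subrK.
have c0 : 0 < m.*2.+1%:R :> R by rewrite ltr0n.
apply: lerD.
  apply: le_trans (tb _ a0).
  rewrite (tail_split ab (intg_oyS (ltW a0) (sq_intg0 sX))) lerDl.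
  by apply: Rintegral_ge0 => x _; exact: sqr_ge0.
apply: le_trans (tb _ b0).
rewrite lerBlDr (@le_trans _ _ (tail (fun x => X x ^+ 2) b))//.
  rewrite mulrC -ler_pdivlMr// [X in _ <= X]mulrC; exact: mom_bound.
rewrite lerDl; by rewrite mulr_ge0// ?(ltW c0)// mulr_ge0 ?sqr_ge0// exprn_ge0// ltW.
Qed.

(** The boundary term of hardy_ac at infinity vanishes by mom_cvg0. The
    subtracted quantity is the squared norm in L^2(a, oo) of the projection of
    X onto r^(-m-1), so the transform is this projection's complement followed
    by an isometry. *)
Lemma hardy_norm m X a : 0 < a -> sq `]0, +oo[ X ->
  tail (fun x => hardy m X x ^+ 2) a =
  tail (fun x => X x ^+ 2) a - m.*2.+1%:R * (a ^+ m.*2.+1 * mom m X a ^+ 2).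
Proof.
move=> a0 sX; have iX := sq_intg0 (sq_oyS (ltW a0) sX).
have iT := sq_intg0 (hardy_sq m a0 sX).
set c := m.*2.+1%:R; set P := fun r => c * (r ^+ m.*2.+1 * mom m X r ^+ 2).
have h1 : P b - P a @[b --> +oo] --> 0 - P a.
  apply: cvgB; last exact: cvg_cst.
  by rewrite -(mulr0 c); apply: cvgM; [exact: cvg_cst|exact: mom_cvg0].
have h2 := cvg_Rintegral_oy (intgB (measurable_itv _) iT iX).
have {}h2 : P b - P a @[b --> +oo] --> tail (fun x => hardy m X x ^+ 2 - X x ^+ 2) a.
  apply: cvg_trans h2; apply: near_eq_cvg; near=> b.
  have ab : a <= b by near: b; exact/nbhs_pinfty_ge/num_real.
  by rewrite -(ac_eq ab (hardy_ac m a0 ab sX)).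
have : 0 - P a = tail (fun x => hardy m X x ^+ 2 - X x ^+ 2) a.
  exact: (cvg_unique _ h1 h2).
rewrite sub0r.
rewrite (_ : tail _ a = tail (fun x => hardy m X x ^+ 2) a - tail (fun x => X x ^+ 2) a);
  last exact: RintegralB.
by move/eqP; rewrite eq_sym subr_eq addrC => /eqP.
Unshelve. all: by end_near. Qed.

Lemma mom_pow m c r : 0 < r ->
  mom m (fun x => c * x ^- m.+1) r = c * (m.*2.+1%:R^-1 * r ^- m.*2.+1).
Proof.
move=> r0; rewrite /mom /tail -(Rintegral_powN m.*2 r0) -RintegralZl//; last exact: intg_powN.
apply: eq_Rintegral => x _; rewrite mulrCA; congr (_ * _).
by rewrite -invfM -exprD addnn doubleS.
Qed.

Lemma tail_pow m c b : 0 < b ->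
  tail (fun r => (c * r ^- m.+1) ^+ 2) b = c ^+ 2 * (m.*2.+1%:R^-1 * b ^- m.*2.+1).
Proof.
move=> b0; rewrite -(Rintegral_powN m.*2 b0) -RintegralZl//; last exact: intg_powN.
apply: eq_Rintegral => r _; rewrite exprMn; congr (_ * _).
by rewrite -exprVn -exprVn -exprM muln2 doubleS.
Qed.

Lemma hardy_pow m c r : 0 < r -> hardy m (fun x => c * x ^- m.+1) r = 0.
Proof.
move=> r0; rewrite /hardy mom_pow//.
have c0 : m.*2.+1%:R != 0 :> R by rewrite pnatr_eq0.
have r1 : r != 0 by rewrite gt_eqF.
have -> : r ^+ m.*2.+1 = r * (r ^+ m * r ^+ m) by rewrite exprS -addnn exprD.
rewrite exprS; move: (expf_neq0 m r1) c0; move: (r ^+ m) (_%:R) => y k y0 k0.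
by field; rewrite k0 r1 y0.
Qed.

(** The kernel of the transform consists of the multiples of r^(-m-1): the
    derivative of r^(2m+1) mom m X is - r^m hardy m X, so this product is
    constant, and then hardy m X = 0 determines X. *)
Lemma hardy_eq0 m X b : 0 < b -> sq `]0, +oo[ X ->
  {ae mu, forall r, b < r -> hardy m X r = 0} ->
  exists c, {ae mu, forall r, b < r -> X r = c * r ^- m.+1}.
Proof.
move=> b0 sX T0.
have acM x y : b < x -> x <= y ->
    ac x y (fun r => r ^+ m.*2.+1 * mom m X r) (fun r => - (r ^+ m * hardy m X r)).
  move=> bx xy; have x0 := lt_trans b0 bx.
  apply: (ac_ext xy (ac_mul xy (ac_pow m.*2.+1 x y) (@mom_ac m X x y x0 sX))) => // z xz zy.
  have z0 : z != 0 by rewrite gt_eqF// (lt_le_trans x0).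
  rewrite /hardy -[m.*2.+1.-1]/(m.*2) !exprS -addnn !exprD.
  have xm : z ^+ m != 0 by rewrite expf_neq0.
  move: (z ^+ m) xm => t t0; move: (_%:R) => c; field.
  by rewrite z0 t0.
pose c := (b + 1) ^+ m.*2.+1 * mom m X (b + 1).
have constM x : b < x -> x ^+ m.*2.+1 * mom m X x = c.
  suff h y z : b < y -> y <= z -> y ^+ m.*2.+1 * mom m X y = z ^+ m.*2.+1 * mom m X z.
    move=> bx; have [xb|xb] := leP x (b + 1); first exact: h.
    by rewrite /c (h (b + 1) x)// ?ltW// ltrDl.
  move=> byy yz; have y0 := lt_trans b0 byy.
  apply/eqP; rewrite eq_sym -subr_eq0 (ac_eq yz (acM y z byy yz)).
  rewrite (@ae_Rintegral _ _ _ (cst 0)).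
    by rewrite Rintegral_cst//= mul0r.
  apply: ae_filterS T0 => t T0.
  by rewrite /= in_itv/= => /andP[yx _]; rewrite T0 ?mulr0 ?oppr0// (lt_le_trans byy).
exists (m.*2.+1%:R * c).
apply: ae_filterS T0 => x T0 bx.
have := T0 bx; rewrite /hardy => /eqP; rewrite subr_eq0 => /eqP ->.
rewrite -(constM _ bx); have x0 : x != 0 by rewrite gt_eqF// (lt_trans b0).
rewrite !exprS -addnn !exprD; have xm : x ^+ m != 0 by rewrite expf_neq0.
by move: (x ^+ m) xm => t t0; field; rewrite t0 x0.
Qed.

End Hardy.

(** * The orthogonal projection onto the plane *)

Section RadialData.
Context {R : realType}.
Notation mu := (@lebesgue_measure R).
Implicit Types (f g F X Y Z : R -> R) (a b r s c d : R) (m n : nat).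

Lemma rad_L2_sq g : rad_L2 g <-> sq `]0, +oo[ (fun r => r ^+ 2 * g r).
Proof.
have E : L2sq 0 g = (\int[mu]_(r in `]0%R, +oo[) ((r ^+ 2 * g r) ^+ 2)%:E)%E.
  by rewrite /L2sq; apply: eq_integral => r _; congr EFin; ring.
split=> [[mg gy]|/(sqP _ (measurable_itv _))[mg gy]].
  apply/sqP => //; split; last by rewrite -E.
  by apply: measurable_funM => //; exact: measurable_funX.
split; last by rewrite E.
have : measurable_fun `](0 : R), +oo[ (fun r => r ^- 2 * (r ^+ 2 * g r)).
  by apply: measurable_funM => //; exact: measurable_powN.
apply: eq_measurable_fun => r; rewrite inE/= in_itv/= andbT => r0.
by rewrite mulrA mulVf ?mul1r// expf_neq0// gt_eqF.
Qed.

Lemma energyE a f g : 0 <= a ->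
  sq `]a, +oo[ (fun r => r ^+ 2 * derive1 f r) -> sq `]a, +oo[ (fun r => r ^+ 2 * g r) ->
  energy a (f, g) = (tail (fun r => (r ^+ 2 * derive1 f r) ^+ 2) a +
                     tail (fun r => (r ^+ 2 * g r) ^+ 2) a)%:E.
Proof.
move=> a0 sX sY; rewrite /tail -RintegralD//; [|exact: sq_intg0..].
rewrite /Rintegral fineK; last first.
  apply: integrable_fin_num => //; exact: (intgD _ (sq_intg0 sX) (sq_intg0 sY)).
by rewrite /energy; apply: eq_integral => r _ /=; congr EFin; ring.
Qed.

Lemma Hdot1_sq f : rad_Hdot1 f -> sq `]0, +oo[ (fun r => r ^+ 2 * derive1 f r).
Proof. by case=> _ /rad_L2_sq. Qed.

Lemma Hdot1_intg f a : 0 < a -> rad_Hdot1 f -> intg `]a, +oo[ (derive1 f).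
Proof.
move=> a0 /Hdot1_sq sX; have := intg_mom 1 a0 sX.
apply: intg_eq => // r; rewrite inE/= in_itv/= andbT => ar.
by rewrite mulrA mulVf ?mul1r// expf_neq0// gt_eqF// (lt_trans a0).
Qed.

Lemma Hdot1_ac f a b : 0 < a -> rad_Hdot1 f -> ac a b f (derive1 f).
Proof.
move=> a0 Hf; have h0 : 0 < a / 2 by rewrite divr_gt0.
split.
  apply: intg_ccS (Hdot1_intg h0 Hf).
  by rewrite ltr_pdivrMr// ltr_pMr// ltr1n.
move=> x ax xb; case: Hf => _ _ + _; move: ax; rewrite le_eqVlt => /predU1P[<- _|ax].
  by rewrite subrr set_itv1 Rintegral_set1.
exact.
Qed.

(** As f vanishes at infinity, it is minus the integral of f_r over (r, oo). *)
Lemma Hdot1_mom f r : 0 < r -> rad_Hdot1 f ->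
  f r = - mom 1 (fun x => x ^+ 2 * derive1 f x) r.
Proof.
move=> r0 Hf; have h0 : 0 < r / 2 by rewrite divr_gt0.
case: (Hf) => _ _ fF fy.
rewrite (@ac_cvg0_tail _ (r / 2) f (derive1 f))//.
- congr (- _); apply: eq_Rintegral => x; rewrite inE/= in_itv/= andbT => ar.
  by rewrite mulrA mulVf ?mul1r// expf_neq0// gt_eqF// (lt_trans r0).
- exact: Hdot1_intg.
- by move=> x y ax xy; apply: fF => //; exact: lt_trans ax.
- by rewrite ltr_pdivrMr// ltr_pMr// ltr1n.
Qed.

Lemma Hdot1_hardy f r : 0 < r -> rad_Hdot1 f ->
  hardy 1 (fun x => x ^+ 2 * derive1 f x) r = r ^+ 2 * derive1 f r + 3 * r * f r.
Proof.
move=> r0 Hf; rewrite (Hdot1_mom r0 Hf) /hardy expr1.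
by rewrite mulrN.
Qed.

Lemma mom_sub_pow m X a d : 0 < a -> sq `]0, +oo[ X ->
  mom m (fun r => X r - d * r ^- m.+1) a =
  mom m X a - d * (m.*2.+1%:R^-1 * a ^- m.*2.+1).
Proof.
move=> a0 sX; have iM := intg_mom m a0 sX; have iP := @intg_powN R m.*2 a a0.
rewrite -(Rintegral_powN m.*2 a0) -RintegralZl// /mom /tail -RintegralB//; last exact: intgZ.
apply: eq_Rintegral => x _; rewrite mulrBr; congr (_ - _).
by rewrite mulrCA -invfM -exprD addnn doubleS.
Qed.

(** The condition on the moment says that X - d r^(-m-1) is orthogonal to
    r^(-m-1) on (a, oo), so that Pythagoras gives the right-hand side of
    hardy_norm. *)
Lemma perp_norm m X a d : 0 < a -> sq `]0, +oo[ X ->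
  mom m (fun r => X r - d * r ^- m.+1) a = 0 ->
  tail (fun r => (X r - d * r ^- m.+1) ^+ 2) a = tail (fun r => hardy m X r ^+ 2) a.
Proof.
move=> a0 sX; have iM := intg_mom m a0 sX; have iP := @intg_powN R m.*2 a a0.
rewrite mom_sub_pow// => /eqP; rewrite subr_eq0 => /eqP Em.
rewrite hardy_norm// Em.
have {}Em : \int[mu]_(r in `]a, +oo[) (r ^- m.+1 * X r) =
  d * (m.*2.+1%:R^-1 * a ^- m.*2.+1) := Em.
have iX := sq_intg0 (sq_oyS (ltW a0) sX).
have -> : tail (fun r => (X r - d * r ^- m.+1) ^+ 2) a =
  \int[mu]_(r in `]a, +oo[) ((X r ^+ 2 - (2 * d) * (r ^- m.+1 * X r)) + d ^+ 2 * r ^- m.*2.+2).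
  apply: eq_Rintegral => x _; have -> : x ^- m.*2.+2 = x ^- m.+1 * x ^- m.+1.
    by rewrite -invfM -exprD addnn doubleS.
  by ring.
rewrite RintegralD//; [|by apply: intgB => //; exact: intgZ|exact: intgZ].
rewrite RintegralB//; [|exact: intgZ].
rewrite !RintegralZl// Rintegral_powN// Em -/(tail _ a).
have c0 : m.*2.+1%:R != 0 :> R by rewrite pnatr_eq0.
have : a ^+ m.*2.+1 != 0 by rewrite expf_neq0// gt_eqF.
move: (_ ^+ m.*2.+1) (_%:R) c0 => y k k0 y0.
by field; rewrite k0 y0.
Qed.

Lemma mom_perp0 m X a : 0 < a -> sq `]0, +oo[ X ->
  exists d, mom m (fun r => X r - d * r ^- m.+1) a = 0.
Proof.
move=> a0 sX; exists (mom m X a * m.*2.+1%:R * a ^+ m.*2.+1); rewrite mom_sub_pow//.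
have c0 : m.*2.+1%:R != 0 :> R by rewrite pnatr_eq0.
have : a ^+ m.*2.+1 != 0 by rewrite expf_neq0// gt_eqF.
move: (_ ^+ m.*2.+1) (_%:R) c0 => y k k0 y0.
by field; rewrite k0 y0.
Qed.

Definition plane_elt (c1 c2 : R) : (R -> R) * (R -> R) :=
  ((fun r => c1 * r ^- 3), (fun r => c2 * r ^- 3)).

Lemma is_derive_plane_elt c r : 0 < r -> is_derive r 1 (fun x : R => c * x ^- 3) (- (3 * c) * r ^- 4).
Proof.
move=> r0; have rn0 : r != 0 by rewrite gt_eqF.
have := is_deriveZ c (is_derive_powN 3 rn0).
by rewrite /GRing.scale/= => h; apply: (is_derive_eq h); ring.
Qed.

Lemma derive1_perp f c1 c2 g : rad_Hdot1 f ->
  {ae mu, forall r, 0 < r -> r ^+ 2 * derive1 ((f, g) - plane_elt c1 c2).1 r =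
     r ^+ 2 * derive1 f r - (- (3 * c1)) * r ^- 2}.
Proof.
case=> df _ _ _; apply: ae_filterS df => r df r0.
have d1 : is_derive r 1 f (derive1 f r) by rewrite derive1E; exact: derivableP (df r0).
have d2 := is_deriveB d1 (is_derive_plane_elt c1 r0).
rewrite (_ : derive1 ((f, g) - plane_elt c1 c2).1 r = derive1 f r - (- (3 * c1) * r ^- 4)).
  by field; rewrite gt_eqF.
by rewrite derive1E; exact: (@derive_val _ _ _ _ _ _ _ d2).
Qed.

Lemma sq_sub_pow m X a d : 0 < a -> sq `]0, +oo[ X ->
  sq `]a, +oo[ (fun r => X r - d * r ^- m.+1).
Proof.
move=> a0 sX; apply: sqB => //; first exact: sq_oyS (ltW a0) sX.
by apply: sqZ => //; exact: sq_powN.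
Qed.

Lemma energy_dot_plane f g c1 c2 e1 e2 a : 0 < a -> rad_Hdot1 f -> rad_L2 g ->
  energy_dot a ((f, g) - plane_elt c1 c2) (plane_elt e1 e2) =
  - (3 * e1) * mom 1 (fun r => r ^+ 2 * derive1 f r - (- (3 * c1)) * r ^- 2) a +
  e2 * mom 0 (fun r => r ^+ 2 * g r - c2 * r ^- 1) a.
Proof.
move=> a0 Hf Lg; have sX := Hdot1_sq Hf; have /rad_L2_sq sY := Lg.
rewrite /mom /tail.
have i1 : intg `]a, +oo[ (fun x => x ^- 2 * (x ^+ 2 * derive1 f x - (- (3 * c1)) * x ^- 2)).
  by apply: sq_intgM => //; [exact: sq_powN|exact: (@sq_sub_pow 1)].
have i2 : intg `]a, +oo[ (fun x => x ^- 1 * (x ^+ 2 * g x - c2 * x ^- 1)).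
  by apply: sq_intgM => //; [exact: (@sq_powN _ 0)|exact: (@sq_sub_pow 0)].
rewrite -(@RintegralZl _ _ _ mu _ _ (- (3 * e1)) _ i1)//.
rewrite -(@RintegralZl _ _ _ mu _ _ e2 _ i2)// -RintegralD//; [|exact: intgZ..].
apply: ae_Rintegral.
apply: ae_filterS (derive1_perp c1 c2 g Hf) => r.
rewrite /= in_itv/= andbT => h ar; have r0 := lt_trans a0 ar.
have rn0 : r != 0 by rewrite gt_eqF.
rewrite -(h r0).
have -> : derive1 (fun x : R => e1 * x ^- 3) r = - (3 * e1) * r ^- 4.
  by rewrite derive1E; exact: (@derive_val _ _ _ _ _ _ _ (is_derive_plane_elt e1 r0)).
set D := derive1 _ r.
have -> : (g - (fun r : R => c2 * r ^- 3)) r = g r - c2 * r ^- 3 by [].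
rewrite ?expr1.
by field.
Qed.

(** Orthogonality to the plane splits into one moment condition for each
    component (energy_dot_plane), and perp_norm applies to each of them. Every
    orthogonal projection satisfies these conditions, hence so does the one
    that is picked. *)
Lemma energy_orth_perp a f g : 0 < a -> rad_Hdot1 f -> rad_L2 g ->
  energy a (orth_perp a (f, g)) =
  (tail (fun r => hardy 1 (fun x => x ^+ 2 * derive1 f x) r ^+ 2) a +
   tail (fun r => hardy 0 (fun x => x ^+ 2 * g x) r ^+ 2) a)%:E.
Proof.
move=> a0 Hf Lg; have sX := Hdot1_sq Hf; have /rad_L2_sq sY := Lg.
have [d1 h1] := mom_perp0 1 a0 sX; have [d2 h2] := mom_perp0 0 a0 sY.
(* The radial derivative of c r^(-3) is -3 c r^(-4), whence the factor -1/3. *)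
have ex : is_orth_proj a (f, g) (plane_elt (- (d1 / 3)) d2).
  split; first by exists (- (d1 / 3)), d2.
  move=> _ [e1 [e2 ->]]; rewrite -/(plane_elt e1 e2) energy_dot_plane// h2.
  have -> : - (3 * - (d1 / 3)) = d1 by field.
  by rewrite h1 !mulr0 addr0.
have : is_orth_proj a (f, g) (orth_proj a (f, g)).
  exact: (@xgetPex _ 0 [set P | is_orth_proj a (f, g) P] (ex_intro _ _ ex)).
rewrite /orth_perp => -[[c1 [c2 ->]] orth]; rewrite -/(plane_elt c1 c2) in orth *.
have m1 : mom 1 (fun r => r ^+ 2 * derive1 f r - (- (3 * c1)) * r ^- 2) a = 0.
  have := orth (plane_elt 1 0) (ex_intro _ _ (ex_intro _ _ erefl)).
  by rewrite energy_dot_plane// mul0r addr0 => /eqP; rewrite mulf_eq0 mulr1 oppr_eq0 pnatr_eq0/= => /eqP.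
have m2 : mom 0 (fun r => r ^+ 2 * g r - c2 * r ^- 1) a = 0.
  have := orth (plane_elt 0 1) (ex_intro _ _ (ex_intro _ _ erefl)).
  by rewrite energy_dot_plane// mulr0 oppr0 mul0r add0r mul1r.
rewrite -(perp_norm a0 sX m1) -(perp_norm a0 sY m2).
have i1 := sq_intg0 (sq_sub_pow 1 (- (3 * c1)) a0 sX).
have i2 := sq_intg0 (sq_sub_pow 0 c2 a0 sY).
rewrite /tail -RintegralD//.
rewrite /Rintegral fineK; last first.
  apply: integrable_fin_num => //.
  exact: (intgD _ i1 i2).
apply: ae_integral.
apply: ae_filterS (derive1_perp c1 c2 g Hf) => r.
rewrite /= in_itv/= andbT => h ar; have r0 := lt_trans a0 ar.
have rn0 : r != 0 by rewrite gt_eqF.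
rewrite -(h r0); congr EFin; set D := derive1 _ r.
have -> : (g - (fun r : R => c2 * r ^- 3)) r = g r - c2 * r ^- 3 by [].
rewrite ?expr1.
by field.
Qed.

End RadialData.

(** * Differentiating inner products *)

Section L2Calculus.
Context {R : realType}.
Notation mu := (@lebesgue_measure R).
Implicit Types (f g F X Y Z : R -> R) (a b r s c d t h : R) (D : set R).

Lemma is_derive_cvgP f t d : is_derive t (1 : R) f d <->
  h^-1 * (f (t + h) - f t) @[h --> 0^'] --> d.
Proof.
have E : (fun h => h^-1 * (f (t + h) - f t)) =
         (fun h => h^-1 *: ((f \o shift t) (h *: (1 : R)) - f t)).
  by apply/funext => h; rewrite /= /shift [h *: 1]mulr1 [t + h]addrC.
rewrite E; split => [[df <-]|dh]; first exact: df.
by apply: DeriveDef; [apply/cvg_ex; exists d|exact: cvg_lim dh].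
Qed.

Lemma ipBl D X Y Z : measurable D -> sq D X -> sq D Y -> sq D Z ->
  \int[mu]_(r in D) ((X r - Y r) * Z r) =
  \int[mu]_(r in D) (X r * Z r) - \int[mu]_(r in D) (Y r * Z r).
Proof.
move=> mD sX sY sZ; rewrite -RintegralB//; [|exact: sq_intgM..].
by apply: eq_Rintegral => r _; rewrite mulrBl.
Qed.

Lemma ipBr D X Y Z : measurable D -> sq D X -> sq D Y -> sq D Z ->
  \int[mu]_(r in D) (Z r * (X r - Y r)) =
  \int[mu]_(r in D) (Z r * X r) - \int[mu]_(r in D) (Z r * Y r).
Proof.
move=> mD sX sY sZ; rewrite -RintegralB//; [|exact: sq_intgM..].
by apply: eq_Rintegral => r _; rewrite mulrBr.
Qed.

Lemma ipZr D c X Z : measurable D -> sq D X -> sq D Z ->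
  \int[mu]_(r in D) (Z r * (c * X r)) = c * \int[mu]_(r in D) (Z r * X r).
Proof.
move=> mD sX sZ; rewrite -RintegralZl//; last exact: sq_intgM.
by apply: eq_Rintegral => r _; rewrite mulrCA.
Qed.

Lemma cvg0_sqr (T : Type) (G : set_system T) {FG : Filter G} (f : T -> R) :
  f x ^+ 2 @[x --> G] --> 0 -> f x @[x --> G] --> 0.
Proof.
move=> f20; apply/cvgr0Pnorm_lt => e e0.
have e20 : 0 < e ^+ 2 by rewrite exprn_gt0.
move/cvgr0Pnorm_lt : f20 => /(_ _ e20); apply: filterS => x.
by rewrite ger0_norm ?sqr_ge0// -real_normK ?num_real// ltr_pXn2r ?nnegrE// ltW.
Qed.

Lemma ip_cvg0 (T : Type) (G : set_system T) {FG : Filter G} D (X : T -> R -> R) Y :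
  measurable D -> (\forall x \near G, sq D (X x)) -> sq D Y ->
  \int[mu]_(r in D) (X x r ^+ 2) @[x --> G] --> 0 ->
  \int[mu]_(r in D) (X x r * Y r) @[x --> G] --> 0.
Proof.
move=> mD sX sY X0; apply: cvg0_sqr.
set C := \int[mu]_(r in D) (Y r ^+ 2).
have h : (\int[mu]_(r in D) (X x r ^+ 2)) * C @[x --> G] --> 0.
  by rewrite -(mul0r C); apply: cvgM => //; exact: cvg_cst.
apply: (squeeze_cvgr _ (cvg_cst 0) h).
by apply: filterS sX => x sX; rewrite sqr_ge0/= ip_sqr_le.
Qed.

Lemma ip_cvg0M (T : Type) (G : set_system T) {FG : Filter G} D (X Y : T -> R -> R) :
  measurable D -> (\forall x \near G, sq D (X x)) -> (\forall x \near G, sq D (Y x)) ->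
  \int[mu]_(r in D) (X x r ^+ 2) @[x --> G] --> 0 ->
  \int[mu]_(r in D) (Y x r ^+ 2) @[x --> G] --> 0 ->
  \int[mu]_(r in D) (X x r * Y x r) @[x --> G] --> 0.
Proof.
move=> mD sX sY X0 Y0; apply: cvg0_sqr.
have h : (\int[mu]_(r in D) (X x r ^+ 2)) * (\int[mu]_(r in D) (Y x r ^+ 2)) @[x --> G] --> 0.
  by rewrite -(mul0r 0); apply: cvgM.
apply: (squeeze_cvgr _ (cvg_cst 0) h).
by apply: filterS2 sX sY => x sX sY; rewrite sqr_ge0/= ip_sqr_le.
Qed.

(** A product rule adapted to weak solutions: U is only continuous in L^2, and
    the derivative of its pairing is known for the frozen second factor K t.
    The motion of K is differentiable in L^2. *)
Lemma is_derive_ip D (U K : R -> R -> R) K' t d : measurable D ->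
  (forall s, sq D (U s)) -> (forall s, sq D (K s)) -> sq D K' ->
  \int[mu]_(r in D) ((U s r - U t r) ^+ 2) @[s --> t] --> 0 ->
  \int[mu]_(r in D) ((h^-1 * (K (t + h) r - K t r) - K' r) ^+ 2) @[h --> 0^'] --> 0 ->
  is_derive t (1 : R) (fun s => \int[mu]_(r in D) (U s r * K t r)) d ->
  is_derive t (1 : R) (fun s => \int[mu]_(r in D) (U s r * K s r))
    (d + \int[mu]_(r in D) (U t r * K' r)).
Proof.
move=> mD sU sK sK' Uc Kd /is_derive_cvgP dU; apply/is_derive_cvgP.
have {}Uc : \int[mu]_(r in D) ((U (t + h) r - U t r) ^+ 2) @[h --> 0^'] --> 0.
  apply: (cvg_trans _ Uc).
  have : t + h @[h --> 0^'] --> t.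
    rewrite -[X in _ --> X]addr0; apply: cvgD; first exact: cvg_cst.
    exact/cvg_within.
  by move=> /cvg_app; apply.
have sUB h : sq D (fun r => U (t + h) r - U t r) by exact: sqB.
have sKB h : sq D (fun r => h^-1 * (K (t + h) r - K t r) - K' r).
  by apply: sqB => //; apply: sqZ => //; exact: sqB.
pose dU' h r := U (t + h) r - U t r.
pose dK h r := h^-1 * (K (t + h) r - K t r) - K' r.
(* The difference quotient of the pairing is its value for the frozen K t, plus the pairing of U t with K', plus three products that tend to 0
   because one of their factors does so in L^2. *)
have e1 : \int[mu]_(r in D) (dU' h r * dK h r) @[h --> 0^'] --> 0.
  by apply: (@ip_cvg0M _ _ _ D dU' dK) => //; exact: nearW.
have e2 : \int[mu]_(r in D) (dU' h r * K' r) @[h --> 0^'] --> 0.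
  by apply: (@ip_cvg0 _ _ _ D dU' K') => //; exact: nearW.
have e3 : \int[mu]_(r in D) (dK h r * U t r) @[h --> 0^'] --> 0.
  by apply: (@ip_cvg0 _ _ _ D dK (U t)) => //; exact: nearW.
have e4 : \int[mu]_(r in D) (U t r * K' r) @[h --> (0:R)^'] -->
  \int[mu]_(r in D) (U t r * K' r) by exact: cvg_cst.
set I := \int[mu]_(r in D) (U t r * K' r) in e4 *.
have e5 : \int[mu]_(r in D) (dU' h r * dK h r) + \int[mu]_(r in D) (dU' h r * K' r) +
    \int[mu]_(r in D) (dK h r * U t r) + (h^-1 * (\int[mu]_(r in D) (U (t + h) r * K t r) -
    \int[mu]_(r in D) (U t r * K t r)) + I) @[h --> (0:R)^'] --> 0 + 0 + 0 + (d + I).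
  by apply: cvgD; [apply: cvgD => //; exact: cvgD|exact: cvgD].
rewrite !add0r in e5; apply: (cvg_trans _ e5); apply: near_eq_cvg.
near=> h => /=.
have sKh : sq D (fun r => h^-1 * (K (t + h) r - K t r)) by apply: sqZ => //; exact: sqB.
have sKd : sq D (fun r => K (t + h) r - K t r) by exact: sqB.
have -> : \int[mu]_(r in D) (dK h r * U t r) = \int[mu]_(r in D) (U t r * dK h r).
  by apply: eq_Rintegral => r _; rewrite mulrC.
rewrite /I /dU' /dK !ipBl// !ipBr// !ipZr// !ipBr//.
by move: (h^-1) => k; ring.
Unshelve. all: by end_near. Qed.

End L2Calculus.

(** * Test functions *)

Section Pairings.
Context {R : realType}.
Notation mu := (@lebesgue_measure R).
Implicit Types (f g F X Y Z : R -> R) (a b r s c d t h : R) (D : set R).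

(** The bound c / r is the decay of P / r for P bounded, the slowest one that
    occurs below. *)
Lemma sq_dom a c X : 0 < a -> 0 <= c -> measurable_fun `]a, +oo[ X ->
  (forall r, a < r -> `|X r| <= c * r^-1) ->
  sq `]a, +oo[ X /\ \int[mu]_(r in `]a, +oo[) X r ^+ 2 <= c ^+ 2 * a^-1.
Proof.
move=> a0 c0 mX Xc.
have sP : sq `]a, +oo[ (fun r => c * r ^- 1).
  by apply: sqZ => //; exact: (sq_powN 0).
have le r : a < r -> `|X r| <= `|c * r ^- 1|.
  move=> ar; rewrite [X in _ <= X]ger0_norm ?expr1 ?Xc// mulr_ge0// invr_ge0 ltW//.
  exact: lt_trans ar.
have sX : sq `]a, +oo[ X.
  by apply: (sq_le _ _ _ sP) => // r; rewrite /= in_itv/= andbT; exact: le.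
split => //.
have -> : c ^+ 2 * a^-1 = \int[mu]_(r in `]a, +oo[) (c * r ^- 1) ^+ 2.
  rewrite -[a^-1]/(a ^- 0.+1) -[a ^- 0.+1]mul1r -[X in X * a ^- _]invr1.
  rewrite -(Rintegral_powN 0 a0) -RintegralZl//; last exact: intg_powN.
  by apply: eq_Rintegral => r _; rewrite exprMn expr1 exprVn.
apply: le_Rintegral => //; [exact: sq_intg0 sX|exact: sq_intg0 sP|].
move=> r; rewrite /= in_itv/= andbT => ar.
rewrite -(@real_normK _ (X r)) ?num_real// -(@real_normK _ (c * _)) ?num_real//.
by rewrite ler_pXn2r ?nnegrE//; exact: le.
Qed.

Lemma ac_int_oy a P p : (forall b, a <= b -> ac a b P p) ->
  intg `]a, +oo[ p -> P r @[r --> +oo] --> 0 ->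
  \int[mu]_(r in `]a, +oo[) p r = - P a.
Proof.
move=> acP ip P0; have h1 := cvg_Rintegral_oy ip.
have h2 : \int[mu]_(r in `[a, b]) p r @[b --> +oo] --> 0 - P a.
  have : P b - P a @[b --> +oo] --> 0 - P a by apply: cvgB => //; exact: cvg_cst.
  apply: cvg_trans; apply: near_eq_cvg; near=> b.
  have ab : a <= b by near: b; exact/nbhs_pinfty_ge/num_real.
  by rewrite (ac_eq ab (acP _ ab)).
by rewrite -(sub0r (P a)); exact: (cvg_unique _ h1 h2).
Unshelve. all: by end_near. Qed.

Lemma Rintegral_oyS a b p : a <= b -> (forall r, a < r -> r <= b -> p r = 0) ->
  \int[mu]_(r in `]a, +oo[) p r = \int[mu]_(r in `]b, +oo[) p r.
Proof.
move=> ab p0; rewrite [LHS]Rintegral_mkcond [RHS]Rintegral_mkcond.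
apply: eq_Rintegral => r _; rewrite !patchE !mem_setE !in_itv/= !andbT.
have [br|rb] := ltP b r; first by rewrite (le_lt_trans ab br).
by case: ifPn => // ar; rewrite p0.
Qed.

(** The test function is p, supported in [a, b]; P is its primitive, p1 and p2
    are its derivatives. P enters through the dual of hardy 0, which maps p to
    p - P / r, and it is constant but in general not zero beyond b. The
    uniform quadratic remainders give differentiability in L^2 of the
    translates of P, p and p1. *)
Record test (a b : R) (P p p1 p2 : R -> R) : Prop := Test {
  test_bound : exists2 C, 0 <= C & forall y,
    [/\ `|P y| <= C, `|p y| <= C, `|p1 y| <= C & `|p2 y| <= C];
  test_taylor : exists2 C, 0 <= C & forall y k,
    [/\ `|P (y + k) - P y - k * p y| <= C * k ^+ 2,
        `|p (y + k) - p y - k * p1 y| <= C * k ^+ 2 &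
        `|p1 (y + k) - p1 y - k * p2 y| <= C * k ^+ 2];
  test_cont : continuous p2;
  test_left : forall y, y <= a -> [/\ P y = 0, p y = 0, p1 y = 0 & p2 y = 0];
  test_right : forall y, b <= y -> [/\ P y = P b, p y = 0, p1 y = 0 & p2 y = 0] }.

Lemma taylor_is_derive f F C : (forall y k, `|f (y + k) - f y - k * F y| <= C * k ^+ 2) ->
  forall y, is_derive y (1 : R) f (F y).
Proof.
move=> fF y; apply/is_derive_cvgP; apply/cvgrPdist_lt => e e0.
have Cp : 0 < `|C| + 1 by rewrite ltr_wpDl.
near=> k.
have k0 : k != 0 by near: k; exact: nbhs_dnbhs_neq.
have -> : F y - k^-1 * (f (y + k) - f y) = - (k^-1 * (f (y + k) - f y - k * F y)).
  by field.
rewrite normrN normrM normfV -ltr_pdivlMl ?invr_gt0 ?normr_gt0// invrK.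
apply: (le_lt_trans (fF y k)); rewrite -real_normK ?num_real// expr2 mulrA mulrC.
rewrite ltr_pM2l ?normr_gt0//.
apply: (@le_lt_trans _ _ ((`|C| + 1) * `|k|)).
  by rewrite ler_wpM2r// (le_trans (ler_norm C))// lerDl.
rewrite -ltr_pdivlMl//; near: k; apply: dnbhs0_lt.
by rewrite mulr_gt0// invr_gt0.
Unshelve. all: by end_near. Qed.

Lemma is_derive_continuous f F : (forall y, is_derive y (1 : R) f (F y)) -> continuous f.
Proof.
move=> df y; apply/differentiable_continuous/derivable1_diffP.
by have [] := df y.
Qed.

Section FixedTest.
Context {a b : R} {P p p1 p2 : R -> R} (tst : test a b P p p1 p2).

Lemma test_dP y : is_derive y (1 : R) P (p y).
Proof.
have [C _ h] := test_taylor tst; apply: (@taylor_is_derive _ _ C) => z k.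
by have [] := h z k.
Qed.

Lemma test_dp y : is_derive y (1 : R) p (p1 y).
Proof.
have [C _ h] := test_taylor tst; apply: (@taylor_is_derive _ _ C) => z k.
by have [] := h z k.
Qed.

Lemma test_dp1 y : is_derive y (1 : R) p1 (p2 y).
Proof.
have [C _ h] := test_taylor tst; apply: (@taylor_is_derive _ _ C) => z k.
by have [] := h z k.
Qed.

Lemma test_cP : continuous P. Proof. exact: is_derive_continuous test_dP. Qed.
Lemma test_cp : continuous p. Proof. exact: is_derive_continuous test_dp. Qed.
Lemma test_cp1 : continuous p1. Proof. exact: is_derive_continuous test_dp1. Qed.
Lemma test_cp2 : continuous p2. Proof. exact: test_cont tst. Qed.

Lemma test_acP c d : ac c d P p.
Proof.
apply: ac_C1 => [y _ _|]; first exact: test_dP.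
by apply: continuous_subspaceT; exact: test_cp.
Qed.

Lemma test_acp c d : ac c d p p1.
Proof.
apply: ac_C1 => [y _ _|]; first exact: test_dp.
by apply: continuous_subspaceT; exact: test_cp1.
Qed.

Lemma test_sup q : q = p \/ q = p1 \/ q = p2 ->
  continuous q /\ exists2 C, 0 <= C & forall y, `|q y| <= C /\ (b <= y -> q y = 0).
Proof.
have [C C0 h] := test_bound tst; have h' := test_right tst.
case=> [->|[->|->]]; (split; [by [exact: test_cp|exact: test_cp1|exact: test_cp2]|]);
  by exists C => // y; split; [have [] := h y|move=> /h' []].
Qed.

Lemma sq_pow_test (c : R) n q : 0 < c -> q = p \/ q = p1 \/ q = p2 -> sq `]c, +oo[ (fun r => r ^+ n * q r).
Proof.
move=> c0 /test_sup [cq [C C0 h]].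
have B0 : 0 <= `|b| by [].
apply: (sq_dom (c := `|b| ^+ n.+1 * C) c0 _ _ _).1.
- by rewrite mulr_ge0// exprn_ge0.
- apply: measurable_funM; first exact: measurable_funX.
  by apply: measurable_funTS; exact: continuous_measurable_fun.
- move=> r ar; have r0 := lt_trans c0 ar.
  have [br|rb] := leP b r.
    by have [_ ->] := h r; rewrite // mulr0 normr0 mulr_ge0// ?mulr_ge0 ?exprn_ge0// invr_ge0 ltW.
  rewrite ler_pdivlMr// normrM normrX (gtr0_norm r0).
  rewrite mulrAC -exprSr; apply: ler_pM => //; last by have [] := h r.
    by rewrite exprn_ge0// ltW.
  rewrite ler_pXn2r ?nnegrE ?(ltW r0)//.
  by rewrite (le_trans (ltW rb))// ler_norm.
Qed.

Lemma sq_powN_test (c : R) n q : 0 < c -> q = P \/ q = p -> sq `]c, +oo[ (fun r => r ^- n.+1 * q r).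
Proof.
move=> c0 qP; have [C C0 h] := test_bound tst.
have cq : continuous q by case: qP => ->; [exact: test_cP|exact: test_cp].
have hq y : `|q y| <= C by case: qP => ->; have [] := h y.
apply: (sq_le _ _ _ (sqZ C _ (sq_powN n c0))) => //.
- apply: measurable_funM; first exact: (measurable_powN _ (ltW c0)).
  by apply: measurable_funTS; exact: continuous_measurable_fun.
- by move=> r _; rewrite !normrM mulrC ler_wpM2r// (le_trans (hq r))// ler_norm.
Qed.

End FixedTest.

End Pairings.

(** * Pairings at a fixed time *)

Section FixedTime.
Context {R : realType}.
Notation mu := (@lebesgue_measure R).
Implicit Types (f g F X Y Z : R -> R) (r s c d t h : R) (D : set R) (m n : nat).

Lemma sq_ext0 (a : R) X : 0 < a -> measurable_fun `](0 : R), +oo[ X ->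
  (forall r, 0 < r -> r <= a -> X r = 0) -> sq `]a, +oo[ X -> sq `]0, +oo[ X.
Proof.
move=> a0 mX X0 /(sqP _ (measurable_itv _))[_ iX].
apply/sqP => //; split => //; apply: le_lt_trans iX.
rewrite [X in (X <= _)%E]integral_mkcond [X in (_ <= X)%E]integral_mkcond.
rewrite (@eq_integral _ _ _ mu setT ((fun x => (X x ^+ 2)%:E) \_ `]a, +oo[))// => r _.
rewrite !patchE !mem_setE !in_itv/= !andbT.
have [ar|ra] := ltP a r; first by rewrite (lt_trans a0 ar).
by case: ifPn => // r0; rewrite X0// expr0n.
Qed.

Lemma mom_sq m X (a : R) : 0 < a -> sq `]0, +oo[ X -> sq `]a, +oo[ (fun r => r ^+ m * mom m X r).
Proof.
move=> a0 sX; have := sqZ (- m.*2.+1%:R^-1) (measurable_itv _)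
  (sqB (measurable_itv _) (hardy_sq m a0 sX) (sq_oyS (ltW a0) sX)).
apply: sq_eq => // r _; rewrite /hardy.
have c0 : m.*2.+1%:R != 0 :> R by rewrite pnatr_eq0.
by move: (_%:R) c0 => k k0; field.
Qed.

Lemma Hdot1_meas f (a : R) : 0 <= a -> rad_Hdot1 f -> measurable_fun `]a, +oo[ f.
Proof.
move=> a0 Hf; apply: continuous_at_meas => //.
by apply: ac_continuous_at => b c b0 bc; exact: Hdot1_ac.
Qed.

Lemma Hdot1_sqr f (a : R) : 0 < a -> rad_Hdot1 f -> sq `]a, +oo[ f.
Proof.
move=> a0 Hf; apply: (sq_le _ _ _ (sqZ a^-1 _ (mom_sq 1 a0 (Hdot1_sq Hf)))) => //.
  exact: Hdot1_meas (ltW a0) Hf.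
move=> r; rewrite /= in_itv/= andbT => ar; have r0 := lt_trans a0 ar.
rewrite (Hdot1_mom r0 Hf) normrN expr1 mulrA normrM ler_peMl//.
rewrite gtr0_norm ?mulr_gt0 ?invr_gt0// ler_pdivlMl// mulr1.
exact: ltW.
Qed.

Context {a b : R} {P p p1 p2 : R -> R} (a0 : 0 < a) (tst : test a b P p p1 p2).

Let mD : measurable (`]a, +oo[%classic : set R). Proof. exact: measurable_itv. Qed.

Lemma sq_p n : sq `]a, +oo[ (fun r => r ^+ n * p r).
Proof. by apply: (sq_pow_test tst _ a0); left. Qed.

Lemma sq_p1 n : sq `]a, +oo[ (fun r => r ^+ n * p1 r).
Proof. by apply: (sq_pow_test tst _ a0); right; left. Qed.

Lemma sq_p2 n : sq `]a, +oo[ (fun r => r ^+ n * p2 r).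
Proof. by apply: (sq_pow_test tst _ a0); right; right. Qed.

Lemma sq_NP n : sq `]a, +oo[ (fun r => r ^- n.+1 * P r).
Proof. by apply: (sq_powN_test tst _ a0); left. Qed.

Lemma sq_Np n : sq `]a, +oo[ (fun r => r ^- n.+1 * p r).
Proof. by apply: (sq_powN_test tst _ a0); right. Qed.

Lemma sq_p0 : sq `]a, +oo[ p.
Proof. by apply: sq_eq (sq_p 0) => // r _; rewrite mul1r. Qed.

Lemma near_right : \forall r \near +oo, b <= r.
Proof. exact/nbhs_pinfty_ge/num_real. Qed.

(** By Hdot1_hardy the integrand contains r^2 f_r + 3 r f, and one integration
    by parts moves the derivative onto p. *)
Lemma hardy1_pairing f : rad_Hdot1 f ->
  \int[mu]_(r in `]a, +oo[) (hardy 1 (fun x => x ^+ 2 * derive1 f x) r * p r) =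
  \int[mu]_(r in `]a, +oo[) (f r * (r * p r - r ^+ 2 * p1 r)).
Proof.
move=> Hf; have sX := Hdot1_sq Hf; have sf := Hdot1_sqr a0 Hf.
have s2p1 := sq_p1 2.
have s1p : sq `]a, +oo[ (fun r => r ^+ 1 * p r) by exact: (sq_p 1).
have s0p := sq_p0.
have sK : sq `]a, +oo[ (fun r => r * p r - r ^+ 2 * p1 r) by exact: sqB.
have i1 : intg `]a, +oo[ (fun r => hardy 1 (fun x => x ^+ 2 * derive1 f x) r * p r).
  by apply: sq_intgM => //; exact: hardy_sq.
have i2 : intg `]a, +oo[ (fun r => f r * (r * p r - r ^+ 2 * p1 r)) by exact: sq_intgM.
apply/eqP; rewrite -subr_eq0 -RintegralB//; apply/eqP.
have [pa p1a] : p a = 0 /\ p1 a = 0 by have [] := test_left tst (lexx a).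
rewrite (_ : 0 = - (f a * (a ^+ 2 * p a))); last by rewrite pa !mulr0 oppr0.
apply: (@ac_int_oy _ _ (fun r => f r * (r ^+ 2 * p r))).
- move=> c lac; have := ac_mul lac (Hdot1_ac c a0 Hf) (ac_mul lac (ac_pow 2 a c) (test_acp tst a c)).
  move=> h; apply: (ac_ext lac h) => // r ar _.
  by rewrite Hdot1_hardy ?(lt_le_trans a0 ar)//= expr1; ring.
- exact: intgB.
- apply: cvg_near_cst; near=> r; have br : b <= r by near: r; exact: near_right.
  by have [_ -> _ _] := test_right tst br; rewrite !mulr0.
Unshelve. all: by end_near. Qed.

(** An integration by parts with mom 0 Y and P as primitives. P need not
    vanish at infinity, but mom 0 Y does. *)
Lemma hardy0_pairing Y : sq `]0, +oo[ Y ->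
  \int[mu]_(r in `]a, +oo[) (hardy 0 Y r * p r) =
  \int[mu]_(r in `]a, +oo[) (Y r * (p r - r ^- 1 * P r)).
Proof.
move=> sY; have sYa := sq_oyS (ltW a0) sY.
have s0p := sq_p0.
have s1P := sq_NP 0.
have i1 : intg `]a, +oo[ (fun r => Y r * (p r - r ^- 1 * P r)).
  by apply: sq_intgM => //; exact: sqB.
have i2 : intg `]a, +oo[ (fun r => hardy 0 Y r * p r).
  by apply: sq_intgM => //; exact: hardy_sq.
apply/eqP; rewrite eq_sym -subr_eq0 -RintegralB//; apply/eqP.
have Pa : P a = 0 by have [] := test_left tst (lexx a).
rewrite (_ : 0 = - (mom 0 Y a * P a)); last by rewrite Pa !mulr0 oppr0.
apply: (@ac_int_oy _ _ (fun r => mom 0 Y r * P r)).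
- move=> c lac; have h := ac_mul lac (mom_ac 0 c a0 sY) (test_acP tst a c).
  apply: (ac_ext lac h) => // r _ _; rewrite /hardy expr0 -[(0.*2.+1)%:R]/(1 : R).
  by move: (r ^- 1) => k; ring.
- exact: intgB.
- rewrite -(mul0r (P b)); apply: cvgM.
    exact: (@tail_cvg0 _ a _ (intg_mom 0 a0 sY)).
  apply: cvg_near_cst; near=> r; have br : b <= r by near: r; exact: near_right.
  by have [-> _ _ _] := test_right tst br.
Unshelve. all: by end_near. Qed.

(** The function whose pairing with u_t, for the weight r^4, is the pairing of
    p with hardy 0 (psi_pairing, hardy0_pairing). The weak equation is tested
    against it. *)
Definition psi r := r ^- 2 * p r - r ^- 3 * P r.
Definition dpsi r := r ^- 2 * p1 r - 3 * (r ^- 3 * p r) + 3 * (r ^- 4 * P r).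

Lemma psi_derive r : 0 < r -> is_derive r (1 : R) psi (dpsi r).
Proof.
move=> r0; have rn0 : r != 0 by rewrite gt_eqF.
have := is_deriveB (is_deriveM (is_derive_powN 2 rn0) (test_dp tst r))
  (is_deriveM (is_derive_powN 3 rn0) (test_dP tst r)).
by move=> h; apply: (is_derive_eq h); rewrite /dpsi /GRing.scale/=; ring.
Qed.

Lemma continuous_powN_mul n (q : R -> R) r : 0 < r -> continuous q ->
  {for r, continuous (fun x : R => x ^- n * q x)}.
Proof.
move=> r0 cq; apply: cvgM; last exact: cq.
by apply: powN_continuous; rewrite gt_eqF.
Qed.

Lemma dpsi_continuous r : 0 < r -> {for r, continuous dpsi}.
Proof.
move=> r0.
have c1 := @continuous_powN_mul 2 _ _ r0 (test_cp1 tst).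
have c2 := @continuous_powN_mul 3 _ _ r0 (test_cp tst).
have c3 := @continuous_powN_mul 4 _ _ r0 (test_cP tst).
exact: (cvgD (cvgB c1 (cvgM (cvg_cst (3 : R)) c2)) (cvgM (cvg_cst (3 : R)) c3)).
Qed.

Lemma psi_continuous r : 0 < r -> {for r, continuous psi}.
Proof.
move=> r0; have c1 := @continuous_powN_mul 2 _ _ r0 (test_cp tst).
have c2 := @continuous_powN_mul 3 _ _ r0 (test_cP tst).
exact: (cvgB c1 c2).
Qed.

Lemma derive1_psi r : 0 < r -> derive1 psi r = dpsi r.
Proof. by move=> r0; have h := psi_derive r0; rewrite derive1E; exact: derive_val. Qed.

Lemma psi_L2 : rad_L2 psi.
Proof.
apply/rad_L2_sq; apply: (sq_ext0 a0).
- apply: measurable_funM; first exact: measurable_funX.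
  apply: continuous_at_meas => //; exact: psi_continuous.
- move=> r r0 ra; have [Pr pr _ _] := test_left tst ra.
  by rewrite /psi Pr pr !mulr0 subrr mulr0.
- have s0p : sq `]a, +oo[ (fun r => r ^+ 0 * p r) by exact: (sq_p 0).
  have := sqB mD s0p (sq_NP 0).
  apply: sq_eq => // r; rewrite inE/= in_itv/= andbT => ar.
  have rn0 : r != 0 by rewrite gt_eqF// (lt_trans a0).
  by rewrite /psi; field.
Qed.

Lemma psi_Hdot1 : rad_Hdot1 psi.
Proof.
split.
- by apply/aeW => r r0; have [] := psi_derive r0.
- apply/rad_L2_sq; apply: (sq_ext0 a0).
  + apply: measurable_funM; first exact: measurable_funX.
    have : measurable_fun `](0 : R), +oo[ dpsi.
      by apply: continuous_at_meas => //; exact: dpsi_continuous.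
    apply: eq_measurable_fun => r; rewrite inE/= in_itv/= andbT => r0.
    by rewrite derive1_psi.
  + move=> r r0 ra; have [Pr pr p1r _] := test_left tst ra.
    by rewrite derive1_psi// /dpsi Pr pr p1r !mulr0 subrr addr0 mulr0.
  + have s0p : sq `]a, +oo[ (fun r => r ^+ 0 * p1 r).
      by exact: (sq_p1 0).
    have := sqD mD (sqB mD s0p (sqZ 3 mD (sq_Np 0)))
                   (sqZ 3 mD (sq_NP 1)).
    apply: sq_eq => // r; rewrite inE/= in_itv/= andbT => ar.
    have r0 := lt_trans a0 ar; have rn0 : r != 0 by rewrite gt_eqF.
    by rewrite derive1_psi// /dpsi; field.
- move=> r s r0 rs.
  have h : ac r s psi dpsi.
    apply: ac_C1 => [x rx _|]; first by apply: psi_derive; exact: lt_le_trans rx.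
    apply: continuous_in_subspaceT => x; rewrite inE/= in_itv/= => /andP[rx _].
    by apply: dpsi_continuous; exact: lt_le_trans rx.
  rewrite (ac_eq (ltW rs) h); apply: eq_Rintegral => x; rewrite inE/= in_itv/= => /andP[rx _].
  by rewrite derive1_psi// (lt_le_trans r0).
- rewrite /psi -(subrr (0 : R)) -[X in X - _](mul0r 0) -[X in _ - X](mul0r (P b)).
  apply: cvgB; apply: cvgM; try exact: cvg_powN.
    apply: cvg_near_cst; near=> r; have br : b <= r by near: r; exact: near_right.
    by have [_ -> _ _] := test_right tst br.
  apply: cvg_near_cst; near=> r; have br : b <= r by near: r; exact: near_right.
  by have [-> _ _ _] := test_right tst br.
Unshelve. all: by end_near. Qed.

Lemma psi_pairing g : rad_L2 g ->
  \int[mu]_(r in `]0, +oo[) (g r * psi r * r ^+ 4) =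
  \int[mu]_(r in `]a, +oo[) (r ^+ 2 * g r * (p r - r ^- 1 * P r)).
Proof.
move=> Lg; rewrite (Rintegral_oyS (ltW a0)); last first.
  move=> r r0 ra; have [Pr pr _ _] := test_left tst ra.
  by rewrite /psi Pr pr !mulr0 subrr mulr0 mul0r.
apply: eq_Rintegral => r; rewrite inE/= in_itv/= andbT => ar.
have rn0 : r != 0 by rewrite gt_eqF// (lt_trans a0).
by rewrite /psi; field.
Qed.

(** With Q = r^4 psi' one has Q' = r^2 p2 - r p1: the terms without a
    derivative of p cancel, as the equation v_t = w_r requires. Q is constant
    near infinity, where f vanishes. *)
Lemma dpsi_pairing f : rad_Hdot1 f ->
  \int[mu]_(r in `]0, +oo[) (derive1 f r * derive1 psi r * r ^+ 4) =
  - \int[mu]_(r in `]a, +oo[) (f r * (r ^+ 2 * p2 r - r * p1 r)).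
Proof.
move=> Hf; have sX := sq_oyS (ltW a0) (Hdot1_sq Hf); have sf := Hdot1_sqr a0 Hf.
have s2p2 := sq_p2 2.
have s1p1 : sq `]a, +oo[ (fun r => r ^+ 1 * p1 r).
  by exact: (sq_p1 1).
have sK : sq `]a, +oo[ (fun r => r ^+ 2 * p2 r - r * p1 r) by exact: sqB.
have s0p : sq `]a, +oo[ (fun r => r ^+ 0 * p1 r).
  by exact: (sq_p1 0).
have sL := sqD mD (sqB mD s0p (sqZ 3 mD (sq_Np 0)))
               (sqZ 3 mD (sq_NP 1)).
have i1 := sq_intgM mD sX sL.
have i2 := sq_intgM mD sf sK.
rewrite (Rintegral_oyS (ltW a0)); last first.
  move=> r r0 ra; have [Pr pr p1r _] := test_left tst ra.
  by rewrite derive1_psi// /dpsi Pr pr p1r !mulr0 subrr addr0 mulr0 mul0r.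
set I := \int[mu]_(r in _) (f r * _).
have -> : \int[mu]_(r in `]a, +oo[) (derive1 f r * derive1 psi r * r ^+ 4) =
  \int[mu]_(r in `]a, +oo[) (r ^+ 2 * derive1 f r *
    (r ^+ 0 * p1 r - 3 * (r ^- 0.+1 * p r) + 3 * (r ^- 1.+1 * P r))).
  apply: eq_Rintegral => r; rewrite inE/= in_itv/= andbT => ar.
  have r0 := lt_trans a0 ar; have rn0 : r != 0 by rewrite gt_eqF.
  by rewrite derive1_psi// /dpsi; field.
apply/eqP; rewrite -subr_eq0 opprK /I -RintegralD//; apply/eqP.
have [Pa pa p1a _] := test_left tst (lexx a).
pose Q r := r ^+ 2 * p1 r - 3 * (r * p r) + 3 * P r.
rewrite (_ : 0 = - (f a * Q a)); last by rewrite /Q Pa pa p1a; ring.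
apply: (@ac_int_oy _ _ (fun r => f r * Q r)).
- move=> c lac.
  have dQ r : is_derive r (1 : R) Q (r ^+ 2 * p2 r - r * p1 r).
    have := is_deriveD (is_deriveB (is_deriveM (@is_deriveX R R id 2 r 1 1 (is_derive_id r 1)) (test_dp1 tst r))
      (is_deriveZ (3:R) (is_deriveM (is_derive_id r (1:R)) (test_dp tst r)))) (is_deriveZ (3:R) (test_dP tst r)).
    move=> h; apply: (is_derive_eq h); rewrite /GRing.scale/=.
    by rewrite -[(id ^+ 2) r]/(r * r) expr1; ring.
  have acQ : ac a c Q (fun r => r ^+ 2 * p2 r - r * p1 r).
    apply: ac_C1.
    apply: continuous_subspaceT => r; apply: cvgB; apply: cvgM => //.
    + exact: exprn_continuous.
    + exact: (test_cp2 tst).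
    + exact: (test_cp1 tst).
  have h := ac_mul lac (Hdot1_ac c a0 Hf) acQ.
  apply: (ac_ext lac h) => // r ar _.
  have rn0 : r != 0 by rewrite gt_eqF// (lt_le_trans a0).
  by rewrite /Q; field.
- exact: intgD.
- have [_ _ _ f0] := Hf; rewrite -(mul0r (3 * P b)); apply: cvgM => //.
  apply: cvg_near_cst; near=> r; have br : b <= r by near: r; exact: near_right.
  by rewrite /Q; have [-> -> -> _] := test_right tst br; rewrite !mulr0 subrr add0r.
Unshelve. all: by end_near. Qed.

End FixedTime.

(** * Dependence of the solution on time *)

Section WaveInTime.
Context {R : realType}.
Notation mu := (@lebesgue_measure R).
Implicit Types (f g F X Y Z : R -> R) (r s c d t h : R) (D : set R) (m n : nat).

Lemma cvg0_le_EFin (T : Type) (G : set_system T) {FG : Filter G} (f : T -> R) (g : T -> \bar R) :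
  (forall x, 0 <= f x) -> (forall x, (f x)%:E <= g x)%E ->
  g x @[x --> G] --> 0%E -> f x @[x --> G] --> 0.
Proof.
move=> f0 fg g0; apply: (@fine_cvg _ _ _ _ (EFin \o f)).
apply: (squeeze_cvge _ (cvg_cst 0%E) g0).
by apply: nearW => x /=; rewrite lee_fin f0 fg.
Qed.

Lemma Rintegral_sqr_ge0 D X : 0 <= \int[mu]_(r in D) (X r ^+ 2).
Proof. by apply: Rintegral_ge0 => r _; exact: sqr_ge0. Qed.

Lemma sq_int_oyS (a b : R) X : a <= b -> sq `]a, +oo[ X ->
  \int[mu]_(r in `]b, +oo[) (X r ^+ 2) <= \int[mu]_(r in `]a, +oo[) (X r ^+ 2).
Proof.
move=> ab sX; have := tail_split ab (sq_intg0 sX); rewrite {1}/tail => ->.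
by rewrite lerDr; exact: Rintegral_sqr_ge0.
Qed.

Lemma sq_powN_mul n (a : R) X : 0 < a -> sq `]a, +oo[ X -> sq `]a, +oo[ (fun r => r ^- n * X r).
Proof.
move=> a0 sX; apply: (sq_le _ _ _ (sqZ (a ^- n) _ sX)) => //.
  apply: measurable_funM; first exact: (measurable_powN _ (ltW a0)).
  exact: sq_meas sX.
move=> r; rewrite /= in_itv/= andbT => ar; have r0 := lt_trans a0 ar.
have rn : 0 < r ^+ n by exact: exprn_gt0.
have an : 0 < a ^+ n by exact: exprn_gt0.
rewrite !normrM ler_wpM2r// !gtr0_norm ?invr_gt0//.
by rewrite lef_pV2 ?posrE// lerXn2r ?nnegrE ?ltW.
Qed.

Lemma is_derive_const F x y :
  (forall s, Num.min x y <= s -> s <= Num.max x y -> is_derive s (1 : R) F 0) -> F x = F y.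
Proof.
wlog xy : x y / x <= y => [h dF|].
  have [xy|yx] := leP x y; first exact: h.
  by apply/esym/h; [exact: ltW|rewrite minC maxC].
rewrite min_l// max_r// => dF.
have [||z _] := @MVT_segment R F (fun=> 0) x y xy.
- by move=> s; rewrite in_itv/= => /andP[/ltW xs /ltW sy]; exact: dF.
- apply: continuous_in_subspaceT => s; rewrite inE/= in_itv/= => /andP[xs sy].
  by apply/differentiable_continuous/derivable1_diffP; case: (dF s xs sy).
by rewrite mul0r => /eqP; rewrite subr_eq0 => /eqP.
Qed.

Definition wave_X (u : R -> R -> R) t r := r ^+ 2 * derive1 (u t) r.
Definition wave_Y (ut : R -> R -> R) t r := r ^+ 2 * ut t r.

Context {u ut : R -> R -> R} (wv : is_free_wave u ut).

Lemma wave_sqX t : sq `]0, +oo[ (wave_X u t). Proof. exact: Hdot1_sq (wave_Hdot1 wv t). Qed.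

Lemma wave_sqY t : sq `]0, +oo[ (wave_Y ut t). Proof. exact/rad_L2_sq/(wave_L2 wv t). Qed.

Lemma wave_squ (a : R) t : 0 < a -> sq `]a, +oo[ (u t).
Proof. by move=> a0; exact: Hdot1_sqr (wave_Hdot1 wv t). Qed.

Lemma energy_diff s t :
  energy 0 ((u s, ut s) - (u t, ut t)) =
  (\int[mu]_(r in `]0%R, +oo[) ((wave_X u s r - wave_X u t r) ^+ 2 + (wave_Y ut s r - wave_Y ut t r) ^+ 2))%:E.
Proof.
have sX := sqB (measurable_itv _) (wave_sqX s) (wave_sqX t).
have sY := sqB (measurable_itv _) (wave_sqY s) (wave_sqY t).
rewrite /Rintegral fineK; last first.
  by apply: integrable_fin_num => //; exact: (intgD _ (sq_intg0 sX) (sq_intg0 sY)).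
apply: ae_integral; have [ds _ _ _] := wave_Hdot1 wv s; have [dt _ _ _] := wave_Hdot1 wv t.
apply: ae_filterS2 ds dt => r ds dt.
rewrite /= in_itv/= andbT => r0; congr EFin.
have d1 : is_derive r 1 (u s) (derive1 (u s) r) by rewrite derive1E; exact: derivableP (ds r0).
have d2 : is_derive r 1 (u t) (derive1 (u t) r) by rewrite derive1E; exact: derivableP (dt r0).
rewrite (_ : derive1 (u s - u t) r = derive1 (u s) r - derive1 (u t) r); last first.
  by rewrite derive1E; exact: (@derive_val _ _ _ _ _ _ _ (is_deriveB d1 d2)).
rewrite -[(ut s - ut t) r]/(ut s r - ut t r) /wave_X /wave_Y; ring.
Qed.

Lemma wave_contY (a : R) t : 0 <= a ->
  \int[mu]_(r in `]a, +oo[) ((wave_Y ut s r - wave_Y ut t r) ^+ 2) @[s --> t] --> 0.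
Proof.
move=> a0; apply: (cvg0_le_EFin _ _ (wave_cont wv t)) => s; first exact: Rintegral_sqr_ge0.
have sX := sqB (measurable_itv _) (wave_sqX s) (wave_sqX t).
have sY := sqB (measurable_itv _) (wave_sqY s) (wave_sqY t).
rewrite energy_diff lee_fin RintegralD//; [|exact: sq_intg0..].
rewrite (le_trans (sq_int_oyS a0 sY))// lerDr; exact: Rintegral_sqr_ge0.
Qed.

Lemma wave_sqt (a : R) t : 0 < a -> sq `]a, +oo[ (ut t).
Proof.
move=> a0; have := sq_powN_mul 2 a0 (sq_oyS (ltW a0) (wave_sqY t)).
apply: sq_eq => // r; rewrite inE/= in_itv/= andbT => ar.
by rewrite /wave_Y mulrA mulVf ?mul1r// expf_neq0// gt_eqF// (lt_trans a0).
Qed.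

Definition dquot t h r := h^-1 * (u (t + h) r - u t r) - ut t r.

Lemma wave_sq_dquot (a : R) t h : 0 < a -> sq `]a, +oo[ (dquot t h).
Proof.
move=> a0; apply: sqB => //.
  by apply: sqZ => //; apply: sqB => //; exact: wave_squ.
exact: wave_sqt.
Qed.

(** The weight r^4 is at least a^4 on (a, oo). *)
Lemma dquot_cvg0 (a : R) t : 0 < a ->
  \int[mu]_(r in `]a, +oo[) (dquot t h r ^+ 2) @[h --> 0^'] --> 0.
Proof.
move=> a0.
have h4 : a ^+ 4 * \int[mu]_(r in `]a, +oo[) (dquot t h r ^+ 2) @[h --> 0^'] --> 0.
  apply: (cvg0_le_EFin _ _ (wave_dt wv t)) => h.
    by rewrite mulr_ge0 ?Rintegral_sqr_ge0// exprn_ge0// ltW.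
  have sZ := sq_intg0 (wave_sq_dquot t h a0).
  rewrite -RintegralZl// /Rintegral fineK; last first.
    by apply: integrable_fin_num => //; exact: intgZ.
  apply: (@le_trans _ _ (\int[mu]_(r in `]a, +oo[) ((dquot t h r) ^+ 2 * r ^+ 4)%:E)%E).
    apply: ge0_le_integral => //.
    - by move=> r _; rewrite lee_fin mulr_ge0 ?sqr_ge0// exprn_ge0// ltW.
    - by apply/measurable_EFinP; exact: intg_meas (intgZ _ _ sZ).
    - apply/measurable_EFinP/measurable_funM; first exact: intg_meas sZ.
      exact: measurable_funX.
    - move=> r; rewrite /= in_itv/= andbT => ar.
      rewrite lee_fin mulrC ler_wpM2l ?sqr_ge0// ler_pXn2r ?nnegrE ?(ltW ar) ?(ltW a0)//.
      by rewrite ltW// (lt_trans a0).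
  apply: ge0_subset_integral => //.
  - apply/measurable_EFinP/measurable_funM; last exact: measurable_funX.
    apply: measurable_funX; apply: measurable_funB; last by have [] := wave_L2 wv t.
    apply: measurable_funM => //; apply: measurable_funB;
      exact: Hdot1_meas (wave_Hdot1 wv _).
  - move=> r; rewrite /= in_itv/= andbT => r0.
    by rewrite lee_fin mulr_ge0 ?sqr_ge0// exprn_ge0// ltW.
  - exact: subset_itvoy (ltW a0).
have a4 : a ^+ 4 != 0 by rewrite expf_neq0// gt_eqF.
have h5 : a ^- 4 * (a ^+ 4 * \int[mu]_(r in `]a, +oo[) (dquot t h r ^+ 2)) @[h --> 0^'] -->
    a ^- 4 * 0 by apply: cvgM => //; exact: cvg_cst.
rewrite mulr0 in h5; apply: cvg_trans h5; apply: near_eq_cvg; near=> h.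
by rewrite mulrA mulVf ?mul1r.
Unshelve. all: by end_near. Qed.

(** Away from the origin u is even differentiable in L^2, with derivative
    u_t. *)
Lemma wave_contu (a : R) t : 0 < a ->
  \int[mu]_(r in `]a, +oo[) ((u s r - u t r) ^+ 2) @[s --> t] --> 0.
Proof.
move=> a0; have sut := wave_sqt t a0.
pose c := \int[mu]_(r in `]a, +oo[) (ut t r ^+ 2).
have le h : h != 0 -> \int[mu]_(r in `]a, +oo[) ((u (t + h) r - u t r) ^+ 2) <=
    (2 * h ^+ 2) * (\int[mu]_(r in `]a, +oo[) (dquot t h r ^+ 2) + c).
  move=> h0; have sZ := wave_sq_dquot t h a0.
  have iZ : intg `]a, +oo[ (fun r => dquot t h r ^+ 2) := sq_intg0 sZ.
  have iu : intg `]a, +oo[ (fun r => ut t r ^+ 2) := sq_intg0 sut.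
  have iZu : intg `]a, +oo[ (fun r => dquot t h r ^+ 2 + ut t r ^+ 2) by exact: intgD.
  rewrite -RintegralD// -RintegralZl//.
  apply: le_Rintegral => //.
  - by apply: sq_intg0; apply: sqB => //; exact: wave_squ.
  - exact: intgZ.
  - move=> r _.
    have -> : u (t + h) r - u t r = h * (dquot t h r + ut t r) by rewrite /dquot; field.
    have := sqr_ge0 (h * (dquot t h r - ut t r)); nra.
have h20 : (2 * h ^+ 2 : R) @[h --> (0:R)^'] --> 2 * (0 : R) ^+ 2.
  apply: cvgM; first exact: cvg_cst.
  by apply: cvg_within_filter; exact: exprn_continuous.
have lim0 : (2 * h ^+ 2) * (\int[mu]_(r in `]a, +oo[) (dquot t h r ^+ 2) + c) @[h --> 0^']
    --> (2 * 0 ^+ 2) * (0 + c).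
  by apply: cvgM => //; apply: cvgD; [exact: dquot_cvg0|exact: cvg_cst].
rewrite expr0n mulr0 mul0r in lim0.
have c1 : \int[mu]_(r in `]a, +oo[) ((u (t + h) r - u t r) ^+ 2) @[h --> 0^'] --> 0.
  apply: (squeeze_cvgr _ (cvg_cst 0) lim0); near=> h.
  rewrite Rintegral_sqr_ge0/= le//.
  by near: h; exact: nbhs_dnbhs_neq.
have st : s - t @[s --> t] --> (0 : R).
  by rewrite -(subrr t); apply: cvgB => //; exact: cvg_cst.
apply/cvgr0Pnorm_lt => e e0; move/cvgr0Pnorm_lt : c1 => /(_ e e0).
move=> h0; have : \forall s \near t, s - t != 0 ->
    `|\int[mu]_(r in `]a, +oo[) ((u (t + (s - t)) r - u t r) ^+ 2)| < e by apply: (st _ h0).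
apply: filterS => s h.
have [->|sn] := eqVneq s t.
  rewrite (_ : \int[mu]_(x in _) _ = 0) ?normr0//.
  rewrite (@eq_Rintegral _ _ _ mu _ (cst 0)) => [|r _]; last by rewrite subrr expr0n.
  by rewrite Rintegral_cst// mul0r.
by have := h _; rewrite subrKC; apply; rewrite subr_eq0.
Unshelve. all: by end_near. Qed.

Lemma wave_deriveu (a : R) t K : 0 < a -> sq `]a, +oo[ K ->
  is_derive t (1 : R) (fun s => \int[mu]_(r in `]a, +oo[) (u s r * K r))
    (\int[mu]_(r in `]a, +oo[) (ut t r * K r)).
Proof.
move=> a0 sK; apply/is_derive_cvgP.
have h : \int[mu]_(r in `]a, +oo[) (dquot t h r * K r) @[h --> 0^'] --> 0.
  apply: (@ip_cvg0 _ _ _ _ `]a, +oo[%classic (dquot t)) => //; last exact: dquot_cvg0.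
  by near=> h; exact: wave_sq_dquot.
set I := \int[mu]_(r in `]a, +oo[) (ut t r * K r).
have h' : \int[mu]_(r in `]a, +oo[) (dquot t h r * K r) + I @[h --> 0^'] --> 0 + I.
  by apply: cvgD => //; exact: cvg_cst.
rewrite add0r in h'; apply: cvg_trans h'; apply: near_eq_cvg; near=> k.
have su s : sq `]a, +oo[ (u s) by exact: wave_squ.
have suB : sq `]a, +oo[ (fun r => u (t + k) r - u t r) by exact: sqB.
have skB : sq `]a, +oo[ (fun r => k^-1 * (u (t + k) r - u t r)) by exact: sqZ.
rewrite /dquot ipBl//; last exact: wave_sqt.
rewrite subrK -ipBl// -RintegralZl//; last exact: sq_intgM.
by apply: eq_Rintegral => r _; rewrite mulrA.
Unshelve. all: by end_near. Qed.

End WaveInTime.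

(** * Transport along characteristics *)

Section Transport.
Context {R : realType}.
Notation mu := (@lebesgue_measure R).
Implicit Types (f g F X Y Z : R -> R) (r s c d t h : R) (D : set R) (m n : nat).

Lemma test_shift (a b c : R) P p p1 p2 : test a b P p p1 p2 ->
  test (a + c) (b + c) (fun r => P (r - c)) (fun r => p (r - c))
    (fun r => p1 (r - c)) (fun r => p2 (r - c)).
Proof.
move=> [[C C0 hC] [T T0 hT] c2 hl hr]; split.
- by exists C => // y; exact: hC.
- by exists T => // y k; have := hT (y - c) k; rewrite (addrAC y).
- move=> y; apply: (@continuous_comp _ _ _ (fun r => r - c) p2); last exact: c2.
  by apply: (@cvgB _ R); [exact: cvg_id|exact: cvg_cst].
- by move=> y ya; apply: hl; rewrite lerBlDr.
- by move=> y yb; rewrite addrK; apply: hr; rewrite lerBrDr.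
Qed.

Lemma test_weaken (a a' b : R) P p p1 p2 : a' <= a -> test a b P p p1 p2 -> test a' b P p p1 p2.
Proof.
move=> aa [hC hT c2 hl hr]; split => // y ya; apply: hl; exact: le_trans ya aa.
Qed.

(** The remainder is O(h^2) in L^2 because 1 / r is square integrable away from
    the origin. *)
Lemma L2_diff (a : R) t (K : R -> R -> R) (K' : R -> R) C : 0 < a ->
  (forall s, measurable_fun `]a, +oo[ (K s)) -> measurable_fun `]a, +oo[ K' ->
  (forall h r, `|h| <= 1 -> a < r -> `|K (t + h) r - K t r - h * K' r| <= C * h ^+ 2 * r^-1) ->
  \int[mu]_(r in `]a, +oo[) ((h^-1 * (K (t + h) r - K t r) - K' r) ^+ 2) @[h --> 0^'] --> 0.
Proof.
move=> a0 mK mK' hK.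
have lim0 : (`|C| * `|h|) ^+ 2 * a^-1 @[h --> (0:R)^'] --> (`|C| * `|0 : R|) ^+ 2 * a^-1.
  apply: cvgM; last exact: cvg_cst.
  have cN : `|C| * `|h| @[h --> (0:R)^'] --> `|C| * `|0 : R|.
    apply: cvgM; first exact: cvg_cst.
    by apply: cvg_within_filter; exact: norm_continuous.
  exact: (cvgM cN cN).
rewrite normr0 mulr0 expr0n mul0r in lim0.
apply: (squeeze_cvgr _ (cvg_cst 0) lim0); near=> h.
have h0 : h != 0 by near: h; exact: nbhs_dnbhs_neq.
have h1 : `|h| <= 1 by near: h; apply: dnbhs0_le.
rewrite Rintegral_sqr_ge0/=.
apply: (sq_dom a0 _ _ _).2.
- exact: mulr_ge0.
- apply: measurable_funB => //; apply: measurable_funM => //.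
  exact: measurable_funB.
- move=> r ar; have r0 : 0 < r^-1 by rewrite invr_gt0 (lt_trans a0).
  have -> : h^-1 * (K (t + h) r - K t r) - K' r = h^-1 * (K (t + h) r - K t r - h * K' r).
    by field.
  rewrite normrM normfV ler_pdivrMl ?normr_gt0//.
  apply: (le_trans (hK h r h1 ar)).
  have -> : `|h| * (`|C| * `|h| * r^-1) = `|C| * h ^+ 2 * r^-1.
    by rewrite -(@real_normK _ h) ?num_real//; move: (r^-1) => k; ring.
  rewrite ler_wpM2r ?(ltW r0)// ler_wpM2r ?sqr_ge0//.
  exact: ler_norm.
Unshelve. all: by end_near. Qed.

Context {a b : R} {P p p1 p2 : R -> R} (tst : test a b P p p1 p2).
Context {sg : R} (sg2 : sg ^+ 2 = 1).

Lemma sg_norm h : `|sg * h| = `|h|.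
Proof.
suff -> : `|sg * h| = `|sg| * `|h| by rewrite (_ : `|sg| = 1) ?mul1r//;
  apply/eqP; rewrite -sqr_norm_eq1 sg2.
by rewrite normrM.
Qed.

(** ker_u and ker_ut are the duals of hardy 1 and hardy 0 (hardy1_pairing,
    hardy0_pairing) applied to the test function translated by sg s; dker_u
    and dker_ut are their derivatives in s. *)
Definition ker_u s r := r * p (r - sg * s) - r ^+ 2 * p1 (r - sg * s).
Definition dker_u s r := - sg * (r * p1 (r - sg * s) - r ^+ 2 * p2 (r - sg * s)).
Definition ker_ut s r := p (r - sg * s) - r ^- 1 * P (r - sg * s).
Definition dker_ut s r := - sg * (p1 (r - sg * s) - r ^- 1 * p (r - sg * s)).

Lemma test_at s : test (a + sg * s) (b + sg * s) (fun r => P (r - sg * s)) (fun r => p (r - sg * s))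
    (fun r => p1 (r - sg * s)) (fun r => p2 (r - sg * s)).
Proof. exact: test_shift. Qed.

Variables (A : R) (A0 : 0 < A).
Let mD : measurable (`]A, +oo[%classic : set R). Proof. exact: measurable_itv. Qed.

Lemma ker_u_sq s : sq `]A, +oo[ (ker_u s).
Proof.
apply: sqB => //; last by apply: (sq_pow_test (test_at s) 2 A0); right; left.
by apply: (sq_pow_test (test_at s) 1 A0); left.
Qed.

Lemma dker_u_sq s : sq `]A, +oo[ (dker_u s).
Proof.
apply: sqZ => //; apply: sqB => //; last by apply: (sq_pow_test (test_at s) 2 A0); right; right.
by apply: (sq_pow_test (test_at s) 1 A0); right; left.
Qed.

Lemma sq_pow0 q : sq `]A, +oo[ (fun r => r ^+ 0 * q r) -> sq `]A, +oo[ q.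
Proof. by apply: sq_eq => // r _; rewrite mul1r. Qed.

Lemma ker_ut_sq s : sq `]A, +oo[ (ker_ut s).
Proof.
apply: sqB => //; last by apply: (sq_powN_test (test_at s) 0 A0); left.
by apply: sq_pow0; apply: (sq_pow_test (test_at s) 0 A0); left.
Qed.

Lemma dker_ut_sq s : sq `]A, +oo[ (dker_ut s).
Proof.
apply: sqZ => //; apply: sqB => //; last by apply: (sq_powN_test (test_at s) 0 A0); right.
by apply: sq_pow0; apply: (sq_pow_test (test_at s) 0 A0); right; left.
Qed.

(** Besides the quadratic remainders: for r large, the points r - sg (t + h)
    with |h| <= 1 lie beyond the support of p, where all the increments
    vanish. This makes the remainders of ker_u and ker_ut decay in r. *)
Lemma taylor_at t : exists2 C, 0 <= C & forall h r,
  let y := r - sg * t in let y' := r - sg * (t + h) in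
  [/\ `|P y' - P y + sg * h * p y| <= C * h ^+ 2,
      `|p y' - p y + sg * h * p1 y| <= C * h ^+ 2,
      `|p1 y' - p1 y + sg * h * p2 y| <= C * h ^+ 2 &
      (`|h| <= 1 -> `|b| + `|t| + 1 <= r ->
        [/\ P y' = P y, p y' = 0, p y = 0, p1 y' = 0 & p1 y = 0 /\ p2 y = 0])].
Proof.
have [C C0 hC] := test_taylor tst; exists C => // h r y y'.
have e : y' = y + - (sg * h) by rewrite /y /y'; ring.
have [] := hC y (- (sg * h)); rewrite -e sqrrN exprMn sg2 mul1r !mulNr !opprK => h1 h2 h3.
split => // h1' br.
have sgt : sg * t <= `|t| by rewrite -sg_norm ler_norm.
have sgh : sg * h <= 1 by apply: le_trans h1'; rewrite -sg_norm ler_norm.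
have bb := ler_norm b.
have yb : b <= y by rewrite /y; lra.
have yb' : b <= y' by rewrite /y'; lra.
have [P1 ? ? ?] := test_right tst yb; have [P2 ? ? ?] := test_right tst yb'.
by split => //; rewrite P1 P2.
Qed.

Lemma ker_u_diff t :
  \int[mu]_(r in `]A, +oo[) ((h^-1 * (ker_u (t + h) r - ker_u t r) - dker_u t r) ^+ 2) @[h --> 0^'] --> 0.
Proof.
have [C C0 hC] := taylor_at t; set B := `|b| + `|t| + 1.
have B0 : 0 <= B by rewrite !addr_ge0.
apply: (@L2_diff _ _ _ _ (C * (B ^+ 2 + B ^+ 3))) => //.
- by move=> s; exact: sq_meas (ker_u_sq s).
- exact: sq_meas (dker_u_sq t).
move=> h r h1 Ar; have r0 := lt_trans A0 Ar.
have [_ e1 e2 e3] := hC h r; rewrite /ker_u /dker_u.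
have [Br|/ltW rB] := leP B r.
  have [_ -> -> -> [-> ->]] := e3 h1 Br.
  rewrite !mulr0 !subrr !mulr0 subrr normr0.
  by rewrite divr_ge0 ?(ltW r0)// mulr_ge0 ?sqr_ge0// mulr_ge0// addr_ge0// exprn_ge0.
move: e1 e2; set x1 := p (r - sg * (t + h)); set x2 := p (r - sg * t).
set y1 := p1 (r - sg * (t + h)); set y2 := p1 (r - sg * t); set z := p2 _ => e1 e2.
have -> : r * x1 - r ^+ 2 * y1 - (r * x2 - r ^+ 2 * y2) - h * (- sg * (r * y2 - r ^+ 2 * z)) =
  r * (x1 - x2 + sg * h * y2) - r ^+ 2 * (y1 - y2 + sg * h * z) by ring.
have r2 : 0 <= r ^+ 2 by exact: sqr_ge0.
apply: (le_trans (ler_normB _ _)); rewrite (normrM r) (normrM (r ^+ 2)) (gtr0_norm r0) (ger0_norm r2).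
have Ch : 0 <= C * h ^+ 2 by rewrite mulr_ge0// sqr_ge0.
apply: (@le_trans _ _ ((r + r ^+ 2) * (C * h ^+ 2))).
  by rewrite mulrDl lerD// ler_wpM2l// ltW.
rewrite ler_pdivlMr// mulrAC (mulrAC C) [X in _ <= X]mulrC ler_wpM2r//.
rewrite mulrDl -expr2 -exprSr lerD// lerXn2r ?nnegrE ?(ltW r0)//.
Qed.

Lemma ker_ut_diff t :
  \int[mu]_(r in `]A, +oo[) ((h^-1 * (ker_ut (t + h) r - ker_ut t r) - dker_ut t r) ^+ 2) @[h --> 0^'] --> 0.
Proof.
have [C C0 hC] := taylor_at t; set B := `|b| + `|t| + 1.
have B0 : 0 <= B by rewrite !addr_ge0.
apply: (@L2_diff _ _ _ _ (C * (B + 1))) => //.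
- by move=> s; exact: sq_meas (ker_ut_sq s).
- exact: sq_meas (dker_ut_sq t).
move=> h r h1 Ar; have r0 := lt_trans A0 Ar.
have [e0 e1 _ e3] := hC h r; rewrite /ker_ut /dker_ut expr1.
have [Br|/ltW rB] := leP B r.
  have [-> -> -> _ [-> _]] := e3 h1 Br.
  rewrite (mulr0 r^-1) !subrr !mulr0 subrr normr0.
  by rewrite divr_ge0 ?(ltW r0)// mulr_ge0 ?sqr_ge0// mulr_ge0// addr_ge0.
move: e0 e1; set x1 := p (r - sg * (t + h)); set x2 := p (r - sg * t).
set y1 := P (r - sg * (t + h)); set y2 := P (r - sg * t); set z := p1 _ => e0 e1.
have -> : x1 - r^-1 * y1 - (x2 - r^-1 * y2) - h * (- sg * (z - r^-1 * x2)) =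
  (x1 - x2 + sg * h * z) - r^-1 * (y1 - y2 + sg * h * x2) by move: (r^-1) => k; ring.
have ri : 0 < r^-1 by rewrite invr_gt0.
apply: (le_trans (ler_normB _ _)); rewrite (normrM r^-1) (gtr0_norm ri).
have Ch : 0 <= C * h ^+ 2 by rewrite mulr_ge0// sqr_ge0.
have -> : C * (B + 1) * h ^+ 2 * r^-1 = B * r^-1 * (C * h ^+ 2) + r^-1 * (C * h ^+ 2).
  by move: (r^-1) => k; ring.
rewrite lerD// ?ler_wpM2l ?(ltW ri)//.
apply: (le_trans e1); rewrite ler_peMl//.
by rewrite ler_pdivlMr// mul1r.
Qed.

Context {u ut : R -> R -> R} (wv : is_free_wave u ut).

(** The pairing of w - sg v with the moving test function, in a form that can
    be differentiated in time; flux_hardy gives it back. *)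
Definition flux s := \int[mu]_(r in `]A, +oo[) (u s r * ker_u s r)
  - sg * \int[mu]_(r in `]A, +oo[) (wave_Y ut s r * ker_ut s r).

Lemma test_after s : A <= a + sg * s ->
  test A (b + sg * s) (fun r => P (r - sg * s)) (fun r => p (r - sg * s))
    (fun r => p1 (r - sg * s)) (fun r => p2 (r - sg * s)).
Proof. by move=> As; exact: test_weaken As (test_at s). Qed.

(** The derivative of the first pairing in u comes from u_t, that of the
    second one in u_t from the weak equation tested against psi. They cancel
    against the motion of the test function, since sg^2 = 1. *)
Lemma flux_derive s : A <= a + sg * s -> is_derive s (1 : R) flux 0.
Proof.
move=> As; have ts := test_after As.
have su t : sq `]A, +oo[ (u t) by exact: (wave_squ wv).
have sY t : sq `]A, +oo[ (wave_Y ut t) by exact: sq_oyS (ltW A0) (wave_sqY wv t).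
have d1 := is_derive_ip mD su ker_u_sq (dker_u_sq s) (wave_contu wv s A0) (ker_u_diff s)
  (wave_deriveu wv s A0 (ker_u_sq s)).
have dY : is_derive s (1 : R) (fun t => \int[mu]_(r in `]A, +oo[) (wave_Y ut t r * ker_ut s r))
    (\int[mu]_(r in `]A, +oo[) (u s r *
       (r ^+ 2 * p2 (r - sg * s) - r * p1 (r - sg * s)))).
  have := wave_eqn wv (psi_Hdot1 A0 ts) (psi_L2 A0 ts) s.
  rewrite (dpsi_pairing A0 ts (wave_Hdot1 wv s)) opprK => d.
  apply: (eq_ind _ (fun F => is_derive s (1 : R) F _) d).
  by apply/funext => t; rewrite (psi_pairing A0 ts (wave_L2 wv t)).
have d2 := is_derive_ip mD sY ker_ut_sq (dker_ut_sq s) (wave_contY wv s (ltW A0)) (ker_ut_diff s) dY.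
have := is_deriveB d1 (is_deriveZ sg d2).
move=> d; apply: (is_derive_eq d); rewrite /GRing.scale/=.
have -> : \int[mu]_(r in `]A, +oo[) (ut s r * ker_u s r) =
   sg * \int[mu]_(r in `]A, +oo[) (wave_Y ut s r * dker_ut s r).
  rewrite -RintegralZl//; last by apply: sq_intgM => //; exact: dker_ut_sq.
  apply: eq_Rintegral => r; rewrite inE/= in_itv/= andbT => Ar.
  have r0 : r != 0 by rewrite gt_eqF// (lt_trans A0).
  rewrite /wave_Y /ker_u /dker_ut expr1.
  set x := p _; set y := p1 _.
  transitivity (sg ^+ 2 * (ut s r * (r * x - r ^+ 2 * y))); last by field.
  by rewrite sg2 mul1r.
have -> : \int[mu]_(r in `]A, +oo[) (u s r * dker_u s r) =
   sg * \int[mu]_(r in `]A, +oo[) (u s r *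
       (r ^+ 2 * p2 (r - sg * s) - r * p1 (r - sg * s))).
  rewrite -RintegralZl//; last first.
    apply: sq_intgM => //; apply: sqB => //.
      by apply: (sq_pow_test (test_at s) 2 A0); right; right.
    by apply: (sq_pow_test (test_at s) 1 A0); right; left.
  by apply: eq_Rintegral => r _; rewrite /dker_u; ring.
ring.
Qed.

Lemma flux_hardy s : A <= a + sg * s ->
  flux s = \int[mu]_(r in `]A, +oo[)
    ((hardy 1 (wave_X u s) r - sg * hardy 0 (wave_Y ut s) r) * p (r - sg * s)).
Proof.
move=> As; have ts := test_after As.
have sp := sq_p0 A0 ts.
have s1 := hardy_sq 1 A0 (wave_sqX wv s); have s0 := hardy_sq 0 A0 (wave_sqY wv s).
have sgs := sqZ sg mD s0.
rewrite /flux -(hardy1_pairing A0 ts (wave_Hdot1 wv s)) -(hardy0_pairing A0 ts (wave_sqY wv s)).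
rewrite ipBl//; congr (_ - _).
rewrite -RintegralZl//; last exact: sq_intgM.
by apply: eq_Rintegral => r _; rewrite mulrA.
Qed.

End Transport.

Section TransportTheorem.
Context {R : realType}.
Notation mu := (@lebesgue_measure R).

(** The flux is constant in time as long as the support of the moving test
    function stays in (A, oo); the smaller of the two end points is such an A
    for all the times between 0 and T. *)
Lemma transport (u ut : R -> R -> R) (sg T a b : R) P p p1 p2 :
  is_free_wave u ut -> sg ^+ 2 = 1 -> test a b P p p1 p2 -> 0 < a -> 0 < a + sg * T ->
  \int[mu]_(r in `](a + sg * T), +oo[)
    ((hardy 1 (wave_X u T) r - sg * hardy 0 (wave_Y ut T) r) * p (r - sg * T)) =
  \int[mu]_(r in `]a, +oo[)
    ((hardy 1 (wave_X u 0) r - sg * hardy 0 (wave_Y ut 0) r) * p r).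
Proof.
move=> wv sg2 tst a0 aT0; set A := Num.min a (a + sg * T).
have A0 : 0 < A by rewrite lt_min a0.
have Aa : A <= a + sg * 0 by rewrite mulr0 addr0 ge_min lexx.
have AT : A <= a + sg * T by rewrite ge_min lexx orbT.
have E : @flux R P p p1 sg A u ut 0 = @flux R P p p1 sg A u ut T.
  apply: is_derive_const => s s1 s2; apply: (flux_derive tst sg2 A0 wv).
  have : sg = 1 \/ sg = -1.
    by move/eqP: sg2; rewrite sqrf_eq1 => /orP[] /eqP; [left|right].
  have A1 : A <= a by rewrite ge_min lexx.
  by move: s1 s2; have [T0|T0] := leP 0 T => s1 s2 [sgE|sgE]; move: AT; rewrite sgE; lra.
rewrite (flux_hardy tst A0 wv Aa) (flux_hardy tst A0 wv AT) in E.
have hl y : y <= a -> p y = 0 by move=> /(test_left tst)[].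
have A1 : A <= a by rewrite ge_min lexx.
rewrite (Rintegral_oyS A1) in E; last by move=> r _ ra; rewrite hl ?mulr0// subr0.
rewrite (Rintegral_oyS AT) in E; last first.
  by move=> r _ ra; rewrite hl ?mulr0// lerBlDr.
by rewrite -E; apply: eq_Rintegral => r _; rewrite mulr0 subr0.
Qed.

End TransportTheorem.

(** * Mollifiers *)

Section ClampedPolynomials.
Context {R : realType}.
Notation mu := (@lebesgue_measure R).
Implicit Types (Q : {poly R}) (r s y k : R).

Lemma poly_bounded Q : exists2 C : R, 0 <= C & forall s, `|s| <= 1 -> `|Q.[s]| <= C.
Proof.
elim/poly_ind: Q => [|Q c [C C0 hC]]; first by exists 0 => // s _; rewrite horner0 normr0.
exists (C + `|c|) => [|s s1]; first exact: addr_ge0.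
rewrite hornerMXaddC (le_trans (ler_normD _ _))// lerD2r normrM.
by rewrite -[C]mulr1 ler_pM// hC.
Qed.

Lemma poly_taylor Q : exists2 C : R, 0 <= C & forall s s', `|s| <= 1 -> `|s'| <= 1 ->
  `|Q.[s'] - Q.[s] - (s' - s) * Q^`().[s]| <= C * (s' - s) ^+ 2.
Proof.
elim/poly_ind: Q => [|Q c [C C0 hC]].
  by exists 0 => // s s' _ _; rewrite deriv0 !horner0 mulr0 !subr0 normr0 mul0r.
have [C' C'0 hC'] := poly_bounded Q^`().
exists (C + C') => [|s s' s1 s1']; first exact: addr_ge0.
rewrite derivD derivM derivX derivC addr0 mulr1 !hornerMXaddC hornerD hornerMX.
set q' := Q.[s']; set q := Q.[s]; set dq := Q^`().[s].
have -> : q' * s' + c - (q * s + c) - (s' - s) * (dq * s + q) =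
  s' * (q' - q - (s' - s) * dq) + (s' - s) ^+ 2 * dq by ring.
rewrite (le_trans (ler_normD _ _))// [X in _ <= X]mulrDl lerD//.
  by rewrite normrM -[X in _ <= X]mul1r ler_pM// hC.
rewrite normrM (ger0_norm (sqr_ge0 _)) mulrC ler_wpM2r ?sqr_ge0//.
exact: hC'.
Qed.

Lemma poly_lipschitz Q : exists2 C : R, 0 <= C & forall s s', `|s| <= 1 -> `|s'| <= 1 ->
  `|Q.[s'] - Q.[s]| <= C * `|s' - s|.
Proof.
have [C C0 hC] := poly_taylor Q; have [C' C'0 hC'] := poly_bounded Q^`().
exists (C * 2 + C') => [|s s' s1 s1']; first by rewrite addr_ge0// mulr_ge0.
have -> : Q.[s'] - Q.[s] = (Q.[s'] - Q.[s] - (s' - s) * Q^`().[s]) + (s' - s) * Q^`().[s].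
  by rewrite subrK.
rewrite (le_trans (ler_normD _ _))// [X in _ <= X]mulrDl lerD//; last first.
  by rewrite normrM mulrC ler_wpM2r// hC'.
rewrite (le_trans (hC _ _ s1 s1'))// -mulrA ler_wpM2l//.
rewrite -real_normK ?num_real// expr2 ler_wpM2r//.
by rewrite (le_trans (ler_normB _ _))// -[2]/(1 + 1) lerD.
Qed.

Definition clamp y : R := Num.max (-1) (Num.min 1 y).

Lemma clamp_norm y : `|clamp y| <= 1.
Proof. by rewrite /clamp ler_norml le_max lexx/= ge_max ge_min lexx/= andbT; lra. Qed.

Lemma clamp_le y : y <= -1 -> clamp y = -1.
Proof. by move=> y1; rewrite /clamp min_r ?max_l//; lra. Qed.

Lemma clamp_ge y : 1 <= y -> clamp y = 1.
Proof. by move=> y1; rewrite /clamp min_l// max_r// lerN10. Qed.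

Lemma clamp_id y : -1 <= y -> y <= 1 -> clamp y = y.
Proof. by move=> y1 y2; rewrite /clamp min_r// max_r. Qed.

Lemma clamp_lip y k : `|clamp (y + k) - clamp y| <= `|k|.
Proof.
rewrite /clamp !maxEle !minEle ler_norml.
have := ler_norm k; have := ler_norm (- k); rewrite normrN.
by do ?case: ifP; move=> *; apply/andP; split; lra.
Qed.

(** Beyond an end point the composition with clamp is constant. Near an end
    point the derivative of Q is at most a multiple of the distance to it, so
    that the first-order term itself is quadratically small there. *)
Lemma clamp_taylor Q : Q^`().[1] = 0 -> Q^`().[-1] = 0 ->
  exists2 C : R, 0 <= C & forall y k,
    `|Q.[clamp (y + k)] - Q.[clamp y] - k * Q^`().[clamp y]| <= C * k ^+ 2.
Proof.
move=> Q1 QN1; have [C C0 hC] := poly_taylor Q.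
have [L L0 hL] := poly_lipschitz Q^`().
exists (C + L) => [|y k]; first exact: addr_ge0.
have hk := clamp_lip y k; have n1 := clamp_norm y; have n2 := clamp_norm (y + k).
have -> : Q.[clamp (y + k)] - Q.[clamp y] - k * Q^`().[clamp y] =
  (Q.[clamp (y + k)] - Q.[clamp y] - (clamp (y + k) - clamp y) * Q^`().[clamp y]) +
  ((clamp (y + k) - clamp y) - k) * Q^`().[clamp y] by ring.
(* The first summand above is the Taylor remainder of Q on [-1, 1]; the second
   one is nonzero only if the segment from y to y + k leaves [-1, 1]. *)
have hk2 : (clamp (y + k) - clamp y) ^+ 2 <= k ^+ 2.
  by rewrite -(@real_normK _ k) ?num_real// -real_normK ?num_real// lerXn2r ?nnegrE.
rewrite (le_trans (ler_normD _ _))// [X in _ <= X]mulrDl lerD//.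
  by rewrite (le_trans (hC _ _ n1 n2))// ler_wpM2l.
have k0 := normr_ge0 k.
have Lk : 0 <= L * k ^+ 2 by rewrite mulr_ge0// sqr_ge0.
have [y1|y1] := leP y (-1); first by rewrite (clamp_le y1) QN1 mulr0 normr0.
have [y2|y2] := leP 1 y; first by rewrite (clamp_ge y2) Q1 mulr0 normr0.
rewrite (clamp_id (ltW y1) (ltW y2)) in hk *.
rewrite -(@real_normK _ k) ?num_real// expr2 mulrA mulrC normrM [X in _ <= X]mulrC mulrC.
have yn : `|y| <= 1 by rewrite ler_norml !ltW.
have [z1|z1] := leP (y + k) (-1).
  rewrite (clamp_le z1); apply: ler_pM => //; last by rewrite ler_norml; have := ler_norm (- k); rewrite normrN => ?; apply/andP; split; lra.
  have := hL (-1) y; rewrite QN1 subr0 normrN normr1 => /(_ (lexx _)) h.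
  apply: (le_trans (h yn)).
  rewrite ler_wpM2l// opprK [`|y + 1|]ger0_norm; last lra.
  by have := ler_norm (- k); rewrite normrN => ?; lra.
have [z2|z2] := leP 1 (y + k).
  rewrite (clamp_ge z2); apply: ler_pM => //; last by rewrite ler_norml; have := ler_norm k => ?; apply/andP; split; lra.
  have := hL 1 y; rewrite Q1 subr0 normr1 => /(_ (lexx _)) h.
  apply: (le_trans (h yn)).
  rewrite ler_wpM2l// [`|y - 1|]ler0_norm; last lra.
  by have := ler_norm k => ?; lra.
rewrite clamp_id ?(ltW z1) ?(ltW z2)//.
by rewrite (_ : y + k - y - k = 0) ?normr0 ?mulr0 ?mulr_ge0//; ring.
Qed.

Lemma clamp_continuous : continuous clamp.
Proof.
move=> y; apply/cvgrPdist_lt => e e0; near=> z.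
have -> : z = y + (z - y) by rewrite subrKC.
rewrite distrC (le_lt_trans (clamp_lip _ _))//.
Unshelve. all: by end_near. Qed.

(** A primitive of (1 - X^2)^4. This power and its first three derivatives
    vanish at -1 and 1, which makes the clamped function smooth enough to be a
    test function. *)
Definition Bpoly : {poly R} :=
  'X - (4 / 3)%:P * 'X^3 + (6 / 5)%:P * 'X^5 - (4 / 7)%:P * 'X^7 + (1 / 9)%:P * 'X^9.

Definition Bpoly1 : {poly R} := (1 - 'X^2) ^+ 4.
Definition Bpoly2 : {poly R} := (- 8)%:P * 'X * (1 - 'X^2) ^+ 3.
Definition Bpoly3 : {poly R} := (1 - 'X^2) ^+ 2 * ((56)%:P * 'X^2 - (8)%:P).

Lemma horner_Bpoly1 s : Bpoly1.[s] = (1 - s ^+ 2) ^+ 4.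
Proof. by rewrite /Bpoly1 !hornerE. Qed.

Lemma horner_Bpoly2 s : Bpoly2.[s] = - 8 * s * (1 - s ^+ 2) ^+ 3.
Proof. by rewrite /Bpoly2 !hornerE. Qed.

Lemma horner_Bpoly3 s : Bpoly3.[s] = (1 - s ^+ 2) ^+ 2 * (56 * s ^+ 2 - 8).
Proof. by rewrite /Bpoly3 !hornerE. Qed.

Lemma horner_deriv_Bpoly s : Bpoly^`().[s] = Bpoly1.[s].
Proof.
rewrite horner_Bpoly1 /Bpoly !(derivD, derivN, derivM, derivX, derivXn, derivC).
rewrite !(hornerD, hornerN, hornerM, hornerXn, hornerX, hornerC, hornerMn).
by field.
Qed.

Lemma deriv_Bpoly1 : Bpoly1^`() = Bpoly2.
Proof.
rewrite /Bpoly1 /Bpoly2 deriv_exp derivB derivXn derivC; set z := 1 - 'X^2.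
rewrite (_ : (-8)%:P = - 8 :> {poly R}); last by rewrite polyCN polyC_natr.
by rewrite /= expr1; ring.
Qed.

Lemma deriv_Bpoly2 : Bpoly2^`() = Bpoly3.
Proof.
rewrite /Bpoly2 /Bpoly3 derivM derivM deriv_exp derivB derivXn !derivC derivX.
rewrite (_ : (-8)%:P = - 8 :> {poly R}); last by rewrite polyCN polyC_natr.
rewrite !polyC_natr /= expr1; ring.
Qed.

Definition moll_int (x e r : R) := e * (Bpoly.[clamp ((r - x) / e)] - Bpoly.[-1]).
Definition moll (x e r : R) := Bpoly1.[clamp ((r - x) / e)].
Definition moll1 (x e r : R) := e^-1 * Bpoly2.[clamp ((r - x) / e)].
Definition moll2 (x e r : R) := e^-1 ^+ 2 * Bpoly3.[clamp ((r - x) / e)].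

Lemma moll_test x e : 0 < e ->
  test (x - e) (x + e) (moll_int x e) (moll x e) (moll1 x e) (moll2 x e).
Proof.
move=> e0; have en0 : e != 0 by rewrite gt_eqF.
have one : (1 : R) - 1 ^+ 2 = 0 by rewrite expr1n subrr.
have one' : (1 : R) - (-1) ^+ 2 = 0 by rewrite sqrrN expr1n subrr.
split.
- have [C0 C00 h0] := poly_bounded (Bpoly - (Bpoly.[-1])%:P).
  have [C1 C10 h1] := poly_bounded Bpoly1.
  have [C2 C20 h2] := poly_bounded Bpoly2.
  have [C3 C30 h3] := poly_bounded Bpoly3.
  have ei : 0 <= e^-1 by rewrite invr_ge0 ltW.
  exists (e * C0 + C1 + e^-1 * C2 + e^-1 ^+ 2 * C3).
    by rewrite !addr_ge0// ?mulr_ge0// ?exprn_ge0// ltW.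
  move=> y; set s := clamp ((y - x) / e); have sn : `|s| <= 1 by exact: clamp_norm.
  have p0 : `|moll_int x e y| <= e * C0.
    rewrite /moll_int normrM gtr0_norm// ler_pM2l//.
    by have := h0 s sn; rewrite hornerD hornerN hornerC.
  have p1 : `|moll x e y| <= C1 by exact: h1.
  have p2 : `|moll1 x e y| <= e^-1 * C2.
    by rewrite /moll1 normrM ger0_norm// ler_wpM2l// h2.
  have p3 : `|moll2 x e y| <= e^-1 ^+ 2 * C3.
    by rewrite /moll2 normrM ger0_norm ?exprn_ge0// ler_wpM2l ?exprn_ge0// h3.
  have q0 : 0 <= e * C0 by rewrite mulr_ge0// ltW.
  have q2 : 0 <= e^-1 * C2 by exact: mulr_ge0.
  have q3 : 0 <= e^-1 ^+ 2 * C3 by rewrite mulr_ge0// exprn_ge0.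
  move: (e * C0) (e^-1 * C2) (e^-1 ^+ 2 * C3) p0 p1 p2 p3 q0 q2 q3 => A B D ? ? ? ? ? ? ?.
  by split; lra.
- have [C0 C00 h0] : exists2 C : R, 0 <= C & forall y k,
      `|Bpoly.[clamp (y + k)] - Bpoly.[clamp y] - k * Bpoly1.[clamp y]| <= C * k ^+ 2.
    have [||C C0 hC] := @clamp_taylor Bpoly; rewrite ?horner_deriv_Bpoly ?horner_Bpoly1 ?one ?one' ?expr0n//.
    by exists C => // y k; have := hC y k; rewrite horner_deriv_Bpoly.
  have [C1 C10 h1] : exists2 C : R, 0 <= C & forall y k,
      `|Bpoly1.[clamp (y + k)] - Bpoly1.[clamp y] - k * Bpoly2.[clamp y]| <= C * k ^+ 2.
    by rewrite -deriv_Bpoly1; apply: clamp_taylor; rewrite deriv_Bpoly1 horner_Bpoly2 ?one ?one' expr0n mulr0.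
  have [C2 C20 h2] : exists2 C : R, 0 <= C & forall y k,
      `|Bpoly2.[clamp (y + k)] - Bpoly2.[clamp y] - k * Bpoly3.[clamp y]| <= C * k ^+ 2.
    by rewrite -deriv_Bpoly2; apply: clamp_taylor; rewrite deriv_Bpoly2 horner_Bpoly3 ?one ?one' expr0n mul0r.
  have ei : 0 <= e^-1 by rewrite invr_ge0 ltW.
  exists (e^-1 * C0 + e^-1 ^+ 2 * C1 + e^-1 ^+ 3 * C2).
    by rewrite !addr_ge0// ?mulr_ge0// ?exprn_ge0.
  have q0 : 0 <= e^-1 * C0 by exact: mulr_ge0.
  have q1 : 0 <= e^-1 ^+ 2 * C1 by rewrite mulr_ge0// exprn_ge0.
  have q2 : 0 <= e^-1 ^+ 3 * C2 by rewrite mulr_ge0// exprn_ge0.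
  have w (A B D E z : R) : 0 <= B -> z <= A * E ^+ 2 -> A <= D -> z <= D * E ^+ 2.
    by move=> _ zA AD; apply: le_trans zA _; rewrite ler_wpM2r// sqr_ge0.
  move=> y k; have E : (y + k - x) / e = (y - x) / e + k / e by field.
  split.
  + apply: (w (e^-1 * C0) 0) => //; last lra.
    have := h0 ((y - x) / e) (k / e); rewrite -E /moll_int /moll => h.
    set a := Bpoly.[_] in h *; set b := Bpoly.[clamp ((y - x) / e)] in h *; set c := Bpoly1.[_] in h *.
    have -> : e * (a - Bpoly.[-1]) - e * (b - Bpoly.[-1]) - k * c = e * (a - b - k / e * c) by field.
    rewrite normrM gtr0_norm//; apply: (@le_trans _ _ (e * (C0 * (k / e) ^+ 2))).
      by rewrite ler_pM2l.
    by rewrite le_eqVlt; apply/orP; left; apply/eqP; field.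
  + apply: (w (e^-1 ^+ 2 * C1) 0) => //; last lra.
    have := h1 ((y - x) / e) (k / e); rewrite -E /moll /moll1 => h.
    set a := Bpoly1.[_] in h *; set b := Bpoly1.[clamp ((y - x) / e)] in h *; set c := Bpoly2.[_] in h *.
    have -> : a - b - k * (e^-1 * c) = a - b - k / e * c by field.
    apply: (le_trans h).
    by rewrite le_eqVlt; apply/orP; left; apply/eqP; field.
  + apply: (w (e^-1 ^+ 3 * C2) 0) => //; last lra.
    have := h2 ((y - x) / e) (k / e); rewrite -E /moll1 /moll2 => h.
    set a := Bpoly2.[_] in h *; set b := Bpoly2.[clamp ((y - x) / e)] in h *; set c := Bpoly3.[_] in h *.
    have -> : e^-1 * a - e^-1 * b - k * (e^-1 ^+ 2 * c) = e^-1 * (a - b - k / e * c) by field.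
    rewrite normrM ger0_norm//; apply: (@le_trans _ _ (e^-1 * (C2 * (k / e) ^+ 2))).
      by rewrite ler_wpM2l.
    by rewrite le_eqVlt; apply/orP; left; apply/eqP; field.
- move=> r; apply: cvgM; first exact: cvg_cst.
  apply: (@continuous_comp _ _ _ (fun r => clamp ((r - x) / e)) (fun s => Bpoly3.[s])).
    apply: (@continuous_comp _ _ _ (fun r => (r - x) / e) clamp); last exact: clamp_continuous.
    apply: cvgM; last exact: cvg_cst.
    by apply: (@cvgB _ R); [exact: cvg_id|exact: cvg_cst].
  exact: continuous_horner.
- move=> y ye; have c : clamp ((y - x) / e) = -1.
    by apply: clamp_le; rewrite ler_pdivrMr// mulN1r; lra.
  rewrite /moll_int /moll /moll1 /moll2 c subrr horner_Bpoly1 horner_Bpoly2 horner_Bpoly3 one'.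
  by rewrite !expr0n/= !(mulr0, mul0r).
- move=> y ye; have c : clamp ((y - x) / e) = 1.
    by apply: clamp_ge; rewrite ler_pdivlMr// mul1r; lra.
  have c' : clamp ((x + e - x) / e) = 1.
    by apply: clamp_ge; rewrite ler_pdivlMr// mul1r; lra.
  rewrite /moll_int /moll /moll1 /moll2 c c' horner_Bpoly1 horner_Bpoly2 horner_Bpoly3 one.
  by rewrite !expr0n/= !(mulr0, mul0r).
Qed.

(** The integral of (1 - s^2)^4 over [-1, 1]. *)
Definition moll_wt : R := Bpoly.[1] - Bpoly.[-1].

Lemma moll_wt_gt0 : 0 < moll_wt.
Proof.
rewrite /moll_wt /Bpoly !(hornerD, hornerN, hornerM, hornerXn, hornerX, hornerC).
lra.
Qed.

Lemma moll_le1 x e r : `|moll x e r| <= 1.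
Proof.
rewrite /moll horner_Bpoly1; have := clamp_norm ((r - x) / e).
move: (clamp _) => s s1; have : s ^+ 2 <= 1.
  by rewrite -real_normK ?num_real// expr_le1.
have s2 := sqr_ge0 s => s21.
by rewrite normrX expr_le1// ler_norml; apply/andP; split; lra.
Qed.

Lemma moll_mass x e : 0 < e ->
  \int[mu]_(r in `[x - e, x + e]) moll x e r = e * moll_wt.
Proof.
move=> e0; have en0 : e != 0 by rewrite gt_eqF.
have ee : x - e <= x + e by lra.
rewrite -(ac_eq ee (test_acP (moll_test x e0) _ _)) /moll_int.
have c' : clamp ((x + e - x) / e) = 1.
  by apply: clamp_ge; rewrite ler_pdivlMr// mul1r; lra.
have c : clamp ((x - e - x) / e) = -1.
  by apply: clamp_le; rewrite ler_pdivrMr// mulN1r; lra.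
by rewrite c c' subrr mulr0 subr0.
Qed.

End ClampedPolynomials.

(** * Translations and localization *)

Section Translation.
Context {R : realType}.
Notation mu := (@lebesgue_measure R).
Implicit Types (f g F X Y Z : R -> R) (r s a c d t h : R) (D : set R) (m n : nat).

Definition transl (c : R) : measurableTypeR R -> measurableTypeR R := fun x => x + c.

Lemma measurable_transl c : measurable_fun [set: measurableTypeR R] (transl c).
Proof. by apply: measurable_funD => //; exact: measurable_cst. Qed.

HB.instance Definition _ c := isMeasurableFun.Build _ _ _ _ (transl c) (measurable_transl c).

Lemma lebesgue_measure_transl c (A : set (measurableTypeR R)) : measurable A ->
  pushforward mu (transl c) A = mu A.
Proof.
move=> mA; apply/esym/lebesgue_measure_unique => //= _ [[a b]] _ <-.
rewrite /pushforward (_ : transl c @^-1` `]a, b] = `](a - c), (b - c)]%classic).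
  rewrite !lebesgue_measure_itv/= !lte_fin ltrD2r.
  by case: ifPn => // _; rewrite -!EFinD; congr EFin; ring.
by apply/seteqP; split => x; rewrite /transl/= !in_itv/= ltrBlDr lerBrDr.
Qed.

Lemma transl_preimage a c : transl c @^-1` `](a + c), +oo[ = `]a, +oo[%classic.
Proof. by apply/seteqP; split => x; rewrite /transl/= !in_itv/= !andbT ltrD2r. Qed.

Lemma ge0_integral_transl a c (f : R -> \bar R) : measurable_fun `](a + c), +oo[ f ->
  (forall r, a + c < r -> (0 <= f r)%E) ->
  (\int[mu]_(r in `](a + c)%R, +oo[) f r = \int[mu]_(r in `]a, +oo[) f ((r : R) + c)%R)%E.
Proof.
move=> mf f0; rewrite -[RHS]/(\int[mu]_(r in `]a, +oo[) (f \o transl c) r)%E -(transl_preimage a c).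
rewrite -(ge0_integral_pushforward (measurable_transl c))//.
  by apply: eq_measure_integral => A mA _; exact/esym/lebesgue_measure_transl.
by move=> r; rewrite inE/= in_itv/= andbT; exact: f0.
Qed.

Lemma Rintegral_transl a c F : measurable_fun `](a + c), +oo[ F ->
  \int[mu]_(r in `](a + c), +oo[) F r = \int[mu]_(r in `]a, +oo[) F (r + c).
Proof.
move=> mF; have mF' := (measurable_EFinP _ _).2 mF.
rewrite /Rintegral; congr fine; rewrite [LHS]integralE [RHS]integralE.
rewrite ge0_integral_transl//; last exact: measurable_funepos.
rewrite ge0_integral_transl//; last exact: measurable_funeneg.
by congr (_ - _)%E; apply: eq_integral => r _; rewrite ?funeposE ?funenegE.
Qed.

Lemma measurable_fun_transl a c F : measurable_fun `](a + c), +oo[ F ->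
  measurable_fun `]a, +oo[ (fun r => F (r + c)).
Proof.
move=> mF; rewrite -(transl_preimage a c).
apply: (@measurable_comp _ _ _ _ _ _ (`](a + c), +oo[%classic : set (measurableTypeR R)) F _ (transl c)) => //.
  by move=> _ [r /= + <-].
exact: measurable_funTS (measurable_transl c).
Qed.

Lemma sq_transl a c F : sq `](a + c), +oo[ F -> sq `]a, +oo[ (fun r => F (r + c)).
Proof.
move=> /(sqP _ (measurable_itv _))[mF iF]; apply/sqP => //; split.
  exact: measurable_fun_transl.
move: iF; rewrite ge0_integral_transl//; first exact/measurable_EFinP/measurable_funX.
by move=> r _; rewrite lee_fin sqr_ge0.
Qed.

Lemma sq_loc_integrable a X : sq `]a, +oo[ X -> locally_integrable [set: R] (X \_ `]a, +oo[).
Proof.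
move=> sX; have mX : measurable_fun [set: R] (X \_ `]a, +oo[).
  by apply/(measurable_restrictT _ _).1 => //; exact: (sq_meas sX).
split => //; first exact: openT.
move=> K _ cK; have mK := compact_measurable cK.
have iX : intg setT (fun r => (X \_ `]a, +oo[) r ^+ 2).
  have /(intg_patch _ (measurable_itv _)) := sq_intg0 sX.
  by apply: intg_eq => // r _; rewrite !patchE; case: ifPn => // _; rewrite expr0n.
have i1 : intg K (fun=> 1).
  apply: measurable_bounded_integrable => //; first exact: compact_finite_measure.
  by exists 1; split => // M M1 r _ /=; rewrite normr1 ltW.
have iK : intg K (X \_ `]a, +oo[).
  apply: (@intg_le _ _ _ (fun r => (X \_ `]a, +oo[) r ^+ 2 + 1)) => //.
  - exact: measurable_funTS.
  - move=> r _; move: ((X \_ `]a, +oo[) r) => x.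
    rewrite -(@real_normK _ x) ?num_real//; have := normr_ge0 x.
    by move: `|x| => y y0; nra.
  - by apply: intgD => //; exact: intgS iX.
by move/integrableP : iK => [].
Qed.

(** At a Lebesgue point x of X, orthogonality bounds |X x| times the mass of
    the mollifier, which is proportional to e, by the integral of |X r - X x|
    over ]x - e, x + e[, which is o(e). *)
Lemma orth_molls_eq0 a X : sq `]a, +oo[ X ->
  (forall x e, 0 < e -> a < x - e -> \int[mu]_(r in `]a, +oo[) (X r * moll x e r) = 0) ->
  {ae mu, forall r, a < r -> X r = 0}.
Proof.
move=> sX orth; have locX := sq_loc_integrable sX.
have := lebesgue_differentiation locX.
apply: ae_filterS => x lx ax.
set XX := X \_ `]a, +oo[ in locX lx.
have XXx : XX x = X x by rewrite /XX patchE mem_set//= in_itv/= andbT.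
suff : (`|X x|%:E <= 0)%E by rewrite lee_fin normr_le0 => /eqP.
have l4 : ((2 / moll_wt)%:E * davg XX x e)%E @[e --> (0:R)^'+] --> 0%E.
  by rewrite -(mule0 (2 / moll_wt)%:E); apply: cvgeZl.
apply: (cvge_to_ge l4); near=> e.
have e0 : 0 < e by near: e; exact: nbhs_right_gt.
have ae : a < x - e by rewrite ltrBrDr -ltrBrDl; near: e; apply: nbhs_right_lt; rewrite subr_gt0.
set J := `]x - e, x + e[%classic.
have xx : x - e < x + e by lra.
have J_sub : J `<=` `]a, +oo[%classic.
  by move=> r; rewrite /J/= !in_itv/= andbT => /andP[xr _]; exact: lt_trans xr.
have mJ : measurable J by exact: measurable_itv.
have muJ : mu J = (2 * e)%:E.
  rewrite /J lebesgue_measure_itv/= lte_fin xx -EFinD; congr EFin; ring.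
have tst := moll_test x e0.
have b0 r : a < r -> ~ J r -> moll x e r = 0.
  rewrite /J/= in_itv/= => ar /negP; rewrite negb_and -!leNgt => /orP[h|h].
    by have [] := test_left tst h.
  by have [] := test_right tst h.
have ib c : intg J (fun=> c).
  apply: measurable_bounded_integrable => //; first exact: (eq_ind_r (fun z => (z < +oo)%E) (ltry _) muJ).
  by exists `|c|; split; [exact: num_real|move=> M M1 r _ /=; exact: ltW].
have iX : intg J X.
  apply: (@intg_le _ _ _ (fun r => X r ^+ 2 + 1)) => //.
  - by apply: measurable_funS (sq_meas sX).
  - move=> r _; move: (X r) => z; rewrite -(@real_normK _ z) ?num_real//.
    by have := normr_ge0 z; move: `|z| => y y0; nra.
  - by apply: intgD => //; apply: intgS (sq_intg0 sX).
have cb : measurable_fun J (moll x e).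
  by apply: measurable_funTS; apply: continuous_measurable_fun; exact: (test_cp tst).
have ibp : intg J (moll x e).
  by apply: (@intg_le _ _ _ (fun=> 1)) => // r _; exact: moll_le1.
have iXp : intg J (fun r => X r * moll x e r).
  apply: (@intg_le _ _ _ (fun r => `|X r|)) => //.
  - by apply: measurable_funM => //; exact: intg_meas iX.
  - by move=> r _; rewrite normrM ler_piMr// moll_le1.
  - exact: integrable_norm.
have E : \int[mu]_(r in J) (X r * moll x e r) = 0.
  rewrite -[RHS](orth x e e0 ae) [LHS]Rintegral_mkcond [RHS]Rintegral_mkcond.
  apply: eq_Rintegral => r _; rewrite !patchE.
  case: ifPn => rb; first by rewrite mem_set//; apply: J_sub; exact: set_mem rb.
  case: ifPn => // ra; rewrite b0 ?mulr0//.
    by move: ra; rewrite inE/= in_itv/= andbT.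
  by move=> h; move: rb; rewrite mem_set.
have Emass : \int[mu]_(r in J) moll x e r = e * moll_wt.
  rewrite -(moll_mass x e0) [LHS]Rintegral_mkcond [RHS]Rintegral_mkcond.
  apply: eq_Rintegral => r _; rewrite !patchE; case: ifPn => rb.
    rewrite mem_set//; move: rb; rewrite inE /J/= !in_itv/= => /andP[? ?].
    by rewrite !ltW.
  case: ifPn => // ra; rewrite b0//; last by move=> h; move: rb; rewrite mem_set.
  move: ra; rewrite inE/= in_itv/= => /andP[h _]; exact: lt_le_trans h.
have iXx : intg J (fun r => `|X r - X x|).
  by apply: integrable_norm; exact: (intgB mJ iX (ib (X x))).
have key : `|X x| * (e * moll_wt) <= \int[mu]_(r in J) `|X r - X x|.
  have -> : `|X x| * (e * moll_wt) = `|\int[mu]_(r in J) ((X x - X r) * moll x e r)|.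
    rewrite (@eq_Rintegral _ _ _ mu J (fun r => X x * moll x e r - X r * moll x e r)); last first.
      by move=> r _; rewrite mulrBl.
    rewrite RintegralB//; last exact: intgZ.
    rewrite RintegralZl// E subr0 Emass normrM [X in _ = _ * X]ger0_norm//.
    by rewrite mulr_ge0// ltW// moll_wt_gt0.
  have iD : intg J (fun r => (X x - X r) * moll x e r).
    apply: (intg_eq _ _ (intgB mJ (intgZ (X x) mJ ibp) iXp)) => // r _.
    by rewrite mulrBl.
  apply: (le_trans (le_normr_Rintegral _ iD)) => //.
  apply: le_Rintegral => //; first exact: integrable_norm iD.
  by move=> r _; rewrite normrM distrC ler_piMr// moll_le1.
have -> : davg XX x e = ((2 * e)^-1 * \int[mu]_(r in J) `|X r - X x|)%:E.
  rewrite /davg /iavg ball_itv -/J (_ : lebesgue_measure J = (2 * e)%:E)//.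
  rewrite [RHS]EFinM inver gt_eqF ?mulr_gt0//; congr (_ * _)%E.
  rewrite /Rintegral fineK; last exact: integrable_fin_num.
  apply: eq_integral => r rJ /=; rewrite /shift XXx /XX patchE mem_set//.
  by apply: J_sub; exact: set_mem rJ.
rewrite -EFinM lee_fin.
have : (2 * e)^-1 * (`|X x| * (e * moll_wt)) <=
       (2 * e)^-1 * \int[mu]_(r in J) `|X r - X x|.
  by rewrite ler_pM2l// invr_gt0 mulr_gt0.
have w0 : moll_wt != 0 :> R by rewrite gt_eqF// moll_wt_gt0.
have en0 : e != 0 by rewrite gt_eqF.
have -> : (2 * e)^-1 * (`|X x| * (e * moll_wt)) = (2 / moll_wt)^-1 * `|X x|.
  by field; rewrite ?en0 ?w0.
by rewrite ler_pdivrMl// divr_gt0// moll_wt_gt0.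
Unshelve. all: by end_near. Qed.

End Translation.

(** * Riemann invariants and the lower bound *)

Section LowerBound.
Context {R : realType}.
Notation mu := (@lebesgue_measure R).
Implicit Types (f g F X Y Z : R -> R) (r s a b c d t h : R) (D : set R) (m n : nat).

Lemma limf_esup_ge (G : set_system R) {PG : ProperFilter G} (F : R -> \bar R) (c : \bar R) :
  (\forall x \near G, (c <= F x)%E) -> (c <= limf_esup F G)%E.
Proof.
move=> cF; rewrite limf_esupE; apply: le_ereal_inf_tmp => _ [V GV <-].
have [x [Vx cx]] := filter_ex (filterI GV cF).
by apply: (le_trans cx); apply: ereal_sup_ubound; exists x.
Qed.

Lemma limf_esup_le (G : set_system R) (F : R -> \bar R) (c : \bar R) :
  (\forall x \near G, (F x <= c)%E) -> (limf_esup F G <= c)%E.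
Proof.
move=> cF; rewrite limf_esupE; apply: ge_ereal_inf.
exists (ereal_sup (F @` [set x | (F x <= c)%E])); first by exists [set x | (F x <= c)%E].
by apply: ub_ereal_sup => _ [x Fx <-].
Qed.

(** The Riemann invariants of the system w_t = v_r, v_t = w_r: with sg = 1 for
    w - v, with sg = -1 for w + v. *)
Definition riemann sg (u ut : R -> R -> R) t r :=
  hardy 1 (wave_X u t) r - sg * hardy 0 (wave_Y ut t) r.

Section Wave.
Context {u ut : R -> R -> R} (wv : is_free_wave u ut).

Lemma riemann_sq sg t a : 0 < a -> sq `]a, +oo[ (riemann sg u ut t).
Proof.
move=> a0; apply: sqB => //; first exact: hardy_sq (wave_sqX wv t).
by apply: sqZ => //; exact: hardy_sq (wave_sqY wv t).
Qed.

(** By transport, the difference of the two sides is orthogonal to all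
    mollifiers. *)
Lemma riemann_shift sg t a : sg ^+ 2 = 1 -> 0 < a -> 0 < a + sg * t ->
  {ae mu, forall r, a < r -> riemann sg u ut t (r + sg * t) = riemann sg u ut 0 r}.
Proof.
move=> sg2 a0 at0.
have s1 := sq_transl (riemann_sq sg t at0); have s0 := riemann_sq sg 0 a0.
have := orth_molls_eq0 (sqB (measurable_itv _) s1 s0) _.
move=> /(_ _) h; have {}h : {ae mu, forall r, a < r ->
    riemann sg u ut t (r + sg * t) - riemann sg u ut 0 r = 0}.
  apply: h => x e e0 ae; have tst := test_weaken (ltW ae) (moll_test x e0).
  have E := transport wv sg2 tst a0 at0; rewrite Rintegral_transl in E; last first.
    apply: measurable_funM; first exact: sq_meas (riemann_sq sg t at0).
    apply: measurable_funTS; apply: continuous_measurable_fun.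
    exact: (test_cp (test_shift (sg * t) tst)).
  have sp := sq_p0 a0 tst.
  rewrite ipBl//; apply/eqP; rewrite subr_eq0; apply/eqP; apply: (etrans _ E).
  by apply: eq_Rintegral => r _; rewrite addrK.
apply: ae_filterS h => r h ar.
by apply/eqP; rewrite -subr_eq0 h.
Qed.

Lemma riemann_norm sg t a : sg ^+ 2 = 1 -> 0 < a -> 0 < a + sg * t ->
  tail (fun r => riemann sg u ut t r ^+ 2) (a + sg * t) = tail (fun r => riemann sg u ut 0 r ^+ 2) a.
Proof.
move=> sg2 a0 at0; rewrite /tail Rintegral_transl; last first.
  by apply: measurable_funX; exact: sq_meas (riemann_sq sg t at0).
apply: ae_Rintegral; apply: ae_filterS (riemann_shift sg2 a0 at0).
by move=> r h; rewrite /= in_itv/= andbT => /h ->.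
Qed.

Lemma wave_energy b t : 0 < b ->
  energy b (u t, ut t) = (tail (fun r => wave_X u t r ^+ 2) b + tail (fun r => wave_Y ut t r ^+ 2) b)%:E.
Proof.
move=> b0; rewrite energyE//; first exact: ltW.
- exact: sq_oyS (ltW b0) (wave_sqX wv t).
- exact: sq_oyS (ltW b0) (wave_sqY wv t).
Qed.

Lemma hardy_tail_le m X b : 0 < b -> sq `]0, +oo[ X ->
  tail (fun r => hardy m X r ^+ 2) b <= tail (fun r => X r ^+ 2) b.
Proof.
move=> b0 sX; rewrite hardy_norm// lerBlDr lerDl mulr_ge0// mulr_ge0 ?sqr_ge0//.
by rewrite exprn_ge0// ltW.
Qed.

Lemma tail_riemann_le sg t b : sg ^+ 2 = 1 -> 0 < b ->
  tail (fun r => riemann sg u ut t r ^+ 2) b <=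
  2 * (tail (fun r => hardy 1 (wave_X u t) r ^+ 2) b + tail (fun r => hardy 0 (wave_Y ut t) r ^+ 2) b).
Proof.
move=> sg2 b0.
have i1 := sq_intg0 (hardy_sq 1 b0 (wave_sqX wv t)).
have i2 := sq_intg0 (hardy_sq 0 b0 (wave_sqY wv t)).
have i3 := intgD (measurable_itv _) i1 i2.
rewrite /tail -RintegralD// -RintegralZl//.
apply: le_Rintegral => //; first exact: sq_intg0 (riemann_sq sg t b0).
  exact: intgZ.
move=> r _; rewrite /riemann; set x := hardy 1 _ _; set y := hardy 0 _ _.
have : 0 <= (x + sg * y) ^+ 2 by exact: sqr_ge0.
have -> : 2 * (x ^+ 2 + y ^+ 2) = (x - sg * y) ^+ 2 + (x + sg * y) ^+ 2 + 2 * (1 - sg ^+ 2) * y ^+ 2 by ring.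
by rewrite sg2; lra.
Qed.

(** Two quantities are discarded: hardy_tail_le drops the component along the
    plane, and tail_riemann_le drops the other Riemann invariant. *)
Lemma exterior_energy_ge sg t a : sg ^+ 2 = 1 -> 0 < a -> sg * t = `|t| ->
  ((2^-1 * tail (fun r => riemann sg u ut 0 r ^+ 2) a)%:E <= exterior_energy a u ut t)%E.
Proof.
move=> sg2 a0 sgt; have b0 : 0 < a + `|t| by rewrite ltr_wpDr.
rewrite /exterior_energy wave_energy// lee_fin.
have := @riemann_norm sg t a sg2 a0; rewrite sgt => /(_ b0) <-.
have := tail_riemann_le t sg2 b0.
have := hardy_tail_le 1 b0 (wave_sqX wv t); have := hardy_tail_le 0 b0 (wave_sqY wv t).
move: (tail _ _) (tail _ _) (tail _ _) (tail _ _) (tail _ _) => x1 x2 x3 x4 x5; lra.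
Qed.

(** The invariant for sg = 1 controls the limit t -> +oo, the one for sg = -1
    the limit t -> -oo. Their squared norms at time 0 add up to twice that of
    (w, v), so the larger one is at least that of (w, v). *)
Lemma max_limsup_ge a : 0 < a ->
  ((2^-1 * (tail (fun r => hardy 1 (wave_X u 0) r ^+ 2) a +
            tail (fun r => hardy 0 (wave_Y ut 0) r ^+ 2) a))%:E <= max_limsup_exterior a u ut)%E.
Proof.
move=> a0.
have sp : (1 : R) ^+ 2 = 1 by rewrite expr1n.
have sm : (-1 : R) ^+ 2 = 1 by rewrite sqrrN expr1n.
have h1 : ((2^-1 * tail (fun r => riemann 1 u ut 0 r ^+ 2) a)%:E <=
    limf_esup (exterior_energy a u ut) (pinfty_nbhs R))%E.
  apply: limf_esup_ge; near=> t; apply: exterior_energy_ge => //.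
  by rewrite mul1r ger0_norm//; near: t; exact/nbhs_pinfty_ge/num_real.
have h2 : ((2^-1 * tail (fun r => riemann (-1) u ut 0 r ^+ 2) a)%:E <=
    limf_esup (exterior_energy a u ut) (ninfty_nbhs R))%E.
  apply: limf_esup_ge; near=> t; apply: exterior_energy_ge => //.
  by rewrite mulN1r ler0_norm//; near: t; exact/nbhs_ninfty_le/num_real.
have i1 := sq_intg0 (hardy_sq 1 a0 (wave_sqX wv 0)).
have i2 := sq_intg0 (hardy_sq 0 a0 (wave_sqY wv 0)).
have ip := sq_intg0 (riemann_sq 1 0 a0); have im := sq_intg0 (riemann_sq (-1) 0 a0).
have E : tail (fun r => riemann 1 u ut 0 r ^+ 2) a + tail (fun r => riemann (-1) u ut 0 r ^+ 2) a =
  2 * (tail (fun r => hardy 1 (wave_X u 0) r ^+ 2) a + tail (fun r => hardy 0 (wave_Y ut 0) r ^+ 2) a).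
  have i3 := intgD (measurable_itv _) i1 i2.
  rewrite /tail -RintegralD// -[in RHS]RintegralD// -RintegralZl//.
  by apply: eq_Rintegral => r _; rewrite /riemann; ring.
move: h1 h2 E; rewrite /max_limsup_exterior.
move: (tail _ a) (tail _ a) (tail _ a) (tail _ a) => x y q p h1 h2 E.
rewrite le_max; have [pq|qp] := leP p q; apply/orP.
  by right; apply: (le_trans _ h2); rewrite lee_fin; lra.
by left; apply: (le_trans _ h1); rewrite lee_fin; lra.
Unshelve. all: by end_near. Qed.

End Wave.

End LowerBound.

(** * Solutions with vanishing Riemann invariants *)

Section Vanishing.
Context {R : realType}.
Notation mu := (@lebesgue_measure R).
Implicit Types (f g F X Y Z : R -> R) (r s a b c d t h : R) (D : set R) (m n : nat).

Lemma mom_congr m X Z b r : b <= r -> {ae mu, forall x, b < x -> X x = Z x} ->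
  mom m X r = mom m Z r.
Proof.
move=> br XZ; apply: ae_Rintegral; apply: ae_filterS XZ => x XZ.
by rewrite /= in_itv/= andbT => rx; rewrite XZ// (le_lt_trans br).
Qed.

Lemma hardy_congr m X Z b : {ae mu, forall x, b < x -> X x = Z x} ->
  {ae mu, forall x, b < x -> hardy m X x = hardy m Z x}.
Proof.
move=> XZ; apply: ae_filterS (XZ) => x XZx bx.
by rewrite /hardy XZx// (mom_congr m (ltW bx) XZ).
Qed.

Lemma tail_congr X Z b : {ae mu, forall x, b < x -> X x = Z x} ->
  tail (fun x => X x ^+ 2) b = tail (fun x => Z x ^+ 2) b.
Proof.
move=> XZ; apply: ae_Rintegral; apply: ae_filterS XZ => x XZ.
by rewrite /= in_itv/= andbT => rx; rewrite XZ.
Qed.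

Lemma derive1_congr f g a : (forall r, a < r -> f r = g r) ->
  forall r, a < r -> derive1 f r = derive1 g r.
Proof.
move=> fg r ar; rewrite !derive1E; apply: near_eq_derive; near=> x.
by apply: fg; near: x; exact: lt_nbhsr.
Unshelve. all: by end_near. Qed.

Lemma tail_sqr_eq0 X b : sq `]b, +oo[ X -> tail (fun x => X x ^+ 2) b = 0 ->
  {ae mu, forall x, b < x -> X x = 0}.
Proof.
move=> sX X0.
have mX := intg_meas (sq_intg0 sX).
have [h _] := @ae_eq_integral_abs _ _ _ mu `]b, +oo[%classic (measurable_itv _)
  (EFin \o (fun x => X x ^+ 2)) ((measurable_EFinP _ _).2 mX).
have {}h : ae_eq mu `]b, +oo[%classic (EFin \o (fun x => X x ^+ 2)) (cst 0%E).
  apply: h; rewrite (@eq_integral _ _ _ mu _ (fun x => (X x ^+ 2)%:E)).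
    by rewrite EFin_sq//; congr EFin.
  by move=> x _; rewrite /= ger0_norm ?sqr_ge0.
apply: ae_filterS h => x /= hx bx.
have /hx[/eqP] : `]b, +oo[%classic x by rewrite /= in_itv/= bx.
by rewrite sqrf_eq0 => /eqP.
Qed.

Lemma test_Hdot1 (a b : R) P p p1 p2 : 0 < a -> test a b P p p1 p2 -> rad_Hdot1 p.
Proof.
move=> a0 tst; have dp := test_dp tst.
have dpE r : derive1 p r = p1 r by rewrite derive1E; exact: derive_val.
split.
- by apply/aeW => r _; have [] := dp r.
- apply/rad_L2_sq; apply: (sq_ext0 a0).
  + apply: measurable_funM; first exact: measurable_funX.
    rewrite (_ : derive1 p = p1); last exact/funext.
    by apply: measurable_funTS; apply: continuous_measurable_fun; exact: test_cp1 tst.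
  + by move=> r _ ra; rewrite dpE; have [_ _ -> _] := test_left tst ra; rewrite mulr0.
  + by apply: sq_eq (sq_p1 a0 tst 2) => // r _; rewrite dpE.
- move=> r s _ rs; rewrite (ac_eq (ltW rs) (test_acp tst r s)).
  by apply: eq_Rintegral => x _; rewrite dpE.
- apply: cvg_near_cst; near=> r; have br : b <= r by near: r; exact: near_right.
  by have [_ -> _ _] := test_right tst br.
Unshelve. all: by end_near. Qed.

Lemma test_L2 (a b : R) P p p1 p2 : 0 < a -> test a b P p p1 p2 -> rad_L2 p.
Proof.
move=> a0 tst; apply/rad_L2_sq; apply: (sq_ext0 a0).
- apply: measurable_funM; first exact: measurable_funX.
  by apply: measurable_funTS; apply: continuous_measurable_fun; exact: test_cp tst.
- by move=> r _ ra; have [_ -> _ _] := test_left tst ra; rewrite mulr0.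
- exact: sq_p a0 tst 2.
Qed.

Section Wave.
Context {u ut : R -> R -> R} (wv : is_free_wave u ut).

Lemma tail_riemann0 sg t a b : sg ^+ 2 = 1 -> 0 < a -> a + `|t| <= b ->
  {ae mu, forall r, a < r -> riemann sg u ut 0 r = 0} ->
  tail (fun r => riemann sg u ut t r ^+ 2) b = 0.
Proof.
move=> sg2 a0 ab h0.
have sgt : sg * t <= `|t| by rewrite -(sg_norm sg2 t) ler_norm.
have aB : a <= b - sg * t by lra.
have b0 : 0 < b - sg * t by lra.
have -> : b = (b - sg * t) + sg * t by rewrite subrK.
rewrite (riemann_norm wv sg2)//; last by rewrite subrK; have := normr_ge0 t; lra.
rewrite (@tail_congr _ (cst 0)).
  by rewrite /tail (@eq_Rintegral _ _ _ mu _ (cst 0)) ?Rintegral_cst ?mul0r// => r _; rewrite /= expr0n.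
by apply: ae_filterS h0 => r h br; apply: h; exact: le_lt_trans br.
Qed.

Lemma hardy_vanish t a b : 0 < a -> a + `|t| <= b ->
  (forall sg, {ae mu, forall r, a < r -> riemann sg u ut 0 r = 0}) ->
  {ae mu, forall r, b < r -> hardy 1 (wave_X u t) r = 0} /\
  {ae mu, forall r, b < r -> hardy 0 (wave_Y ut t) r = 0}.
Proof.
move=> a0 ab h0; have b0 : 0 < b by have := normr_ge0 t; lra.
have sp : (1 : R) ^+ 2 = 1 by rewrite expr1n.
have sm : (-1 : R) ^+ 2 = 1 by rewrite sqrrN expr1n.
have p0 := tail_sqr_eq0 (riemann_sq wv 1 t b0) (tail_riemann0 sp a0 ab (h0 1)).
have m0 := tail_sqr_eq0 (riemann_sq wv (-1) t b0) (tail_riemann0 sm a0 ab (h0 (-1))).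
split; apply: ae_filterS2 p0 m0 => r h1 h2 br; have := h1 br; have := h2 br; rewrite /riemann; lra.
Qed.

Lemma wave_profile t a b : 0 < a -> a + `|t| <= b ->
  (forall sg, {ae mu, forall r, a < r -> riemann sg u ut 0 r = 0}) ->
  exists C1 C2, {ae mu, forall r, b < r -> wave_X u t r = C1 * r ^- 2} /\
    {ae mu, forall r, b < r -> wave_Y ut t r = C2 * r ^- 1}.
Proof.
move=> a0 ab h0; have b0 : 0 < b by have := normr_ge0 t; lra.
have [hX hY] := hardy_vanish a0 ab h0.
have [C1 hC1] := hardy_eq0 b0 (wave_sqX wv t) hX.
have [C2 hC2] := hardy_eq0 b0 (wave_sqY wv t) hY.
by exists C1, C2.
Qed.

End Wave.

End Vanishing.

(** * Evolution of data in the plane *)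

Section Evolution.
Context {R : realType}.
Notation mu := (@lebesgue_measure R).
Implicit Types (f g F X Y Z : R -> R) (r s a b c d t h : R) (D : set R) (m n : nat).

Lemma test_int_p1 (a b : R) P p p1 p2 : 0 < a -> test a b P p p1 p2 ->
  \int[mu]_(r in `]a, +oo[) p1 r = 0.
Proof.
move=> a0 tst; have [_ pa _ _] := test_left tst (lexx a).
rewrite (_ : 0 = - p a); last by rewrite pa oppr0.
apply: (@ac_int_oy _ _ p) => [c _||].
- exact: test_acp tst a c.
- have := sq_intgM (measurable_itv _) (sq_powN 0 a0) (sq_p1 a0 tst 1).
  apply: intg_eq => // r; rewrite inE/= in_itv/= andbT => ar.
  by rewrite !expr1 mulrA mulVf ?mul1r// gt_eqF// (lt_trans a0).
- apply: cvg_near_cst; near=> r; have br : b <= r by near: r; exact: near_right.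
  by have [_ -> _ _] := test_right tst br.
Unshelve. all: by end_near. Qed.

Lemma test_intg_p (a b : R) P p p1 p2 : 0 < a -> test a b P p p1 p2 -> intg `]a, +oo[ p.
Proof.
move=> a0 tst; have := sq_intgM (measurable_itv _) (sq_powN 0 a0) (sq_p a0 tst 1).
apply: intg_eq => // r; rewrite inE/= in_itv/= andbT => ar.
by rewrite !expr1 mulrA mulVf ?mul1r// gt_eqF// (lt_trans a0).
Qed.

Lemma test_int_p (a b : R) P p p1 p2 : 0 < a -> test a b P p p1 p2 ->
  \int[mu]_(r in `]a, +oo[) p r = P b.
Proof.
move=> a0 tst; have [Pa _ _ _] := test_left tst (lexx a).
rewrite (_ : P b = - (P a - P b)); last by rewrite Pa sub0r opprK.
apply: (@ac_int_oy _ _ (fun r => P r - P b)) => [c lac||].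
- have [ip h] := test_acP tst a c; split => // x ax xc.
  by rewrite -h//; ring.
- exact: test_intg_p tst.
- apply: cvg_near_cst; near=> r; have br : b <= r by near: r; exact: near_right.
  by have [-> _ _ _] := test_right tst br; rewrite subrr.
Unshelve. all: by end_near. Qed.

Lemma moll_ge0 x e r : 0 <= moll x e r :> R.
Proof. by rewrite /moll horner_Bpoly1 -[4%N]/(2 * 2)%N exprM sqr_ge0. Qed.

Lemma moll_int_end x e : 0 < e -> moll_int x e (x + e) = e * moll_wt :> R.
Proof.
move=> e0; rewrite -(moll_mass x e0).
have xe : x - e <= x + e by lra.
rewrite -(ac_eq xe (test_acP (moll_test x e0) _ _)).
by have [-> _ _ _] := test_left (moll_test x e0) (lexx _); rewrite subr0.
Qed.

Context {u ut : R -> R -> R} (wv : is_free_wave u ut).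

(** Where u_r = C1 r^(-4) and u_t = C2 r^(-3), the product r^4 u_r does not
    depend on r, so C2' = 0; and u = - C1 r^(-3) / 3 gives C1' = - 3 C2. For a
    weak solution the two constants are read off from pairings with one
    mollifier supported outside the cone. *)
Lemma profile_evolution a d1 d2 t : 0 < a ->
  {ae mu, forall r, a < r -> wave_X u 0 r = d1 * r ^- 2} ->
  {ae mu, forall r, a < r -> wave_Y ut 0 r = d2 * r ^- 1} ->
  {ae mu, forall r, a + `|t| < r -> wave_X u t r = (d1 - 3 * t * d2) * r ^- 2} /\
  {ae mu, forall r, a + `|t| < r -> wave_Y ut t r = d2 * r ^- 1}.
Proof.
move=> a0 hX0 hY0; set A := a + `|t|.
have t0 := normr_ge0 t.
have A0 : 0 < A by rewrite ltr_pwDl.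
have aA : a <= A by rewrite lerDl.
have hX0A : {ae mu, forall r, A < r -> wave_X u 0 r = d1 * r ^- 2}.
  by apply: ae_filterS hX0 => r h Ar; apply: h; exact: le_lt_trans Ar.
have hY0A : {ae mu, forall r, A < r -> wave_Y ut 0 r = d2 * r ^- 1}.
  by apply: ae_filterS hY0 => r h Ar; apply: h; exact: le_lt_trans Ar.
have riemann0 sg : {ae mu, forall r, a < r -> riemann sg u ut 0 r = 0}.
  apply: ae_filterS2 (hardy_congr 1 hX0) (hardy_congr 0 hY0) => r h1 h2 ar.
  by rewrite /riemann h1// h2// !hardy_pow ?(lt_trans a0 ar)// mulr0 subr0.
have prof s : `|s| <= `|t| -> exists C1 C2,
    {ae mu, forall r, A < r -> wave_X u s r = C1 * r ^- 2} /\
    {ae mu, forall r, A < r -> wave_Y ut s r = C2 * r ^- 1}.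
  by move=> st; apply: (wave_profile wv a0) => //; rewrite lerD2l.
(* Any mollifier supported in (A, oo) would do. *)
pose x := A + 2.
have tst : test A (x + 1) (moll_int x 1) (moll x 1) (moll1 x 1) (moll2 x 1).
  by apply: test_weaken (moll_test x ltr01); rewrite /x; lra.
set p := moll x 1 in tst *; set p1 := moll1 x 1 in tst *.
have ip := test_intg_p A0 tst.
pose k := \int[mu]_(r in `]A, +oo[) (r * p r).
have mass : \int[mu]_(r in `]A, +oo[) p r = moll_wt.
  by rewrite (test_int_p A0 tst) moll_int_end// mul1r.
have irp : intg `]A, +oo[ (fun r => r * p r).
  have := sq_intgM (measurable_itv _) (sq_powN 0 A0) (sq_p A0 tst 2).
  apply: intg_eq => // r; rewrite inE/= in_itv/= andbT => ar.
  by rewrite expr1 expr2 -mulrA mulrA mulVf ?mul1r// gt_eqF// (lt_trans A0).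
have k0 : k != 0.
  have : A * moll_wt <= k.
    rewrite -mass -RintegralZl//; apply: le_Rintegral => //; first exact: intgZ.
    by move=> r; rewrite /= in_itv/= andbT => Ar; rewrite ler_wpM2r ?moll_ge0// ltW.
  by move=> h; rewrite gt_eqF// (lt_le_trans _ h)// mulr_gt0// moll_wt_gt0.
(* N reads off the constant of u_t. Up to sign, its derivative is the pairing
   of r^4 u_r, a constant in r, with the derivative of p, whose integral is
   zero. *)
pose N s := \int[mu]_(r in `]0, +oo[) (ut s r * p r * r ^+ 4).
have NE s C2 : {ae mu, forall r, A < r -> wave_Y ut s r = C2 * r ^- 1} -> N s = C2 * k.
  move=> hY; rewrite /N (Rintegral_oyS (ltW A0)); last first.
    by move=> r _ rA; have [_ -> _ _] := test_left tst rA; rewrite mulr0 mul0r.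
  rewrite -RintegralZl//; apply: ae_Rintegral; apply: ae_filterS hY => r hY.
  rewrite /= in_itv/= andbT => Ar; have r0 : r != 0 by rewrite gt_eqF// (lt_trans A0).
  transitivity (wave_Y ut s r * p r * r ^+ 2); first by rewrite /wave_Y; ring.
  by rewrite hY//; field.
have dN s : `|s| <= `|t| -> is_derive s (1 : R) N 0.
  move=> st; have := wave_eqn wv (test_Hdot1 A0 tst) (test_L2 A0 tst) s.
  move=> d; apply: (is_derive_eq d).
  have [C1 [C2 [hX _]]] := prof s st.
  rewrite (Rintegral_oyS (ltW A0)); last first.
    move=> r _ rA; have [_ _ p1r _] := test_left tst rA.
    have dp := test_dp tst r; rewrite (_ : derive1 p r = 0) ?mulr0 ?mul0r//.
    by rewrite derive1E -[RHS]p1r; exact: derive_val.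
  rewrite (@ae_Rintegral _ _ _ (fun r => C1 * p1 r)).
    rewrite RintegralZl//; first by rewrite (test_int_p1 A0 tst) mulr0 oppr0.
    have := sq_intgM (measurable_itv _) (sq_powN 0 A0) (sq_p1 A0 tst 1).
    apply: intg_eq => // r; rewrite inE/= in_itv/= andbT => ar.
    by rewrite !expr1 mulrA mulVf ?mul1r// gt_eqF// (lt_trans A0).
  apply: ae_filterS hX => r hX; rewrite /= in_itv/= andbT => Ar.
  have dp := test_dp tst r; rewrite (_ : derive1 p r = p1 r); last first.
    by rewrite derive1E; exact: derive_val.
  have r0 : r != 0 by rewrite gt_eqF// (lt_trans A0).
  transitivity (wave_X u s r * p1 r * r ^+ 2); first by rewrite /wave_X; ring.
  by rewrite hX//; field.
have between s : Num.min 0 t <= s -> s <= Num.max 0 t -> `|s| <= `|t|.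
  have [tp|tn] := leP 0 t; move=> s1 s2.
    by rewrite !ger0_norm.
  by rewrite !ler0_norm ?lerN2// ltW.
have C2E s C2 : `|s| <= `|t| -> {ae mu, forall r, A < r -> wave_Y ut s r = C2 * r ^- 1} -> C2 = d2.
  move=> st hY; apply: (mulIf k0); rewrite -(NE _ _ hY) -(NE _ _ hY0A).
  apply: is_derive_const => y y1 y2; apply: dN.
  apply: (@le_trans _ _ `|s|) => //.
  move: y1 y2; have [sp|sn] := leP s 0 => y1 y2; first by rewrite !ler0_norm ?lerN2//.
  by rewrite !ger0_norm// ltW.
have hYs s : `|s| <= `|t| -> {ae mu, forall r, A < r -> wave_Y ut s r = d2 * r ^- 1}.
  by move=> st; have [C1 [C2 [_ hY]]] := prof s st; rewrite -(C2E s C2 st hY).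
split; last exact: hYs.
(* V reads off the constant of u, and its derivative that of u_t. *)
pose K r := r ^+ 3 * p r; have sK : sq `]A, +oo[ K by exact: sq_p A0 tst 3.
pose V s := \int[mu]_(r in `]A, +oo[) (u s r * K r).
have VE s C1 : {ae mu, forall r, A < r -> wave_X u s r = C1 * r ^- 2} ->
    V s = - (C1 / 3) * moll_wt.
  move=> hX; rewrite -mass -RintegralZl//; apply: eq_Rintegral => r.
  rewrite inE/= in_itv/= andbT => Ar; have r0 := lt_trans A0 Ar.
  rewrite (Hdot1_mom r0 (wave_Hdot1 wv s)) -/(wave_X u s) (mom_congr 1 (ltW Ar) hX) mom_pow//.
  by rewrite /K -[(1.*2.+1)%N]/(3%N); field; rewrite gt_eqF.
have dV s : `|s| <= `|t| -> is_derive s (1 : R) V (d2 * moll_wt).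
  move=> st; apply: (is_derive_eq (wave_deriveu wv s A0 sK)).
  rewrite -mass -RintegralZl//; apply: ae_Rintegral; apply: ae_filterS (hYs s st) => r hY.
  rewrite /= in_itv/= andbT => Ar; have r0 : r != 0 by rewrite gt_eqF// (lt_trans A0).
  transitivity (wave_Y ut s r * r * p r); first by rewrite /wave_Y /K; ring.
  by rewrite hY//; field.
have [C1 [C2 [hX _]]] := prof t (lexx _).
suff -> : d1 - 3 * t * d2 = C1 by [].
have : V 0 - d2 * moll_wt * 0 = V t - d2 * moll_wt * t.
  apply: (@is_derive_const _ (fun s => V s - d2 * moll_wt * s)) => s s1 s2.
  have := is_deriveB (dV s (between s s1 s2)) (is_deriveZ (d2 * moll_wt) (is_derive_id s (1 : R))).
  by move=> d; apply: (is_derive_eq d); rewrite /GRing.scale/= mulr1 subrr.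
rewrite (VE 0 d1 hX0A) (VE t C1 hX) mulr0 subr0 mulrAC -mulrBl => /(mulIf (lt0r_neq0 moll_wt_gt0)) E.
lra.
Qed.

Lemma exterior_energy_profile a d1 d2 t : 0 < a ->
  {ae mu, forall r, a < r -> wave_X u 0 r = d1 * r ^- 2} ->
  {ae mu, forall r, a < r -> wave_Y ut 0 r = d2 * r ^- 1} ->
  exterior_energy a u ut t = ((d1 - 3 * t * d2) ^+ 2 * (3^-1 * (a + `|t|) ^- 3) +
    d2 ^+ 2 * (a + `|t|)^-1)%:E.
Proof.
move=> a0 hX0 hY0; have b0 : 0 < a + `|t| by rewrite ltr_pwDl.
have [hX hY] := profile_evolution t a0 hX0 hY0.
rewrite /exterior_energy wave_energy// (tail_congr hX) (tail_congr hY).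
rewrite (@tail_pow _ 1)// (@tail_pow _ 0)//.
by rewrite -[0.*2.+1%:R]/(1 : R) invr1 mul1r expr1.
Qed.

(** The energy of the r^(-3) profile in u outside the ball of radius a + |t|
    is proportional to (a + |t|)^(-3), which beats the squared linear growth
    of its coefficient. *)
Lemma max_limsup_profile a d1 d2 : 0 < a ->
  {ae mu, forall r, a < r -> wave_X u 0 r = d1 * r ^- 2} ->
  {ae mu, forall r, a < r -> wave_Y ut 0 r = d2 * r ^- 1} ->
  max_limsup_exterior a u ut = 0%E.
Proof.
move=> a0 hX0 hY0.
(* M comes from |d1 - 3 t d2| <= (|d1| / a + 3 |d2|) (a + |t|). *)
pose M := (`|d1| / a + 3 * `|d2|) ^+ 2 / 3 + d2 ^+ 2.
have M0 : 0 <= M by rewrite addr_ge0 ?sqr_ge0// divr_ge0 ?sqr_ge0.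
have bound t e : 0 < e -> M / e <= `|t| -> (exterior_energy a u ut t <= e%:E)%E.
  move=> e0 Mt; rewrite (exterior_energy_profile t a0 hX0 hY0) lee_fin.
  have t0 := normr_ge0 t; set A := a + `|t|.
  have A0 : 0 < A by rewrite ltr_pwDl.
  have h1 : `|d1 - 3 * t * d2| <= (`|d1| / a + 3 * `|d2|) * A.
    apply: (le_trans (ler_normB _ _)); rewrite [X in _ <= X]mulrDl lerD//.
      by rewrite -mulrA ler_peMr// mulrC ler_pdivlMr// mul1r lerDl.
    rewrite !normrM (ger0_norm (_ : 0 <= 3))// mulrAC ler_wpM2l ?mulr_ge0//.
    by rewrite lerDr ltW.
  have h2 : (d1 - 3 * t * d2) ^+ 2 <= (`|d1| / a + 3 * `|d2|) ^+ 2 * A ^+ 2.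
    rewrite -exprMn -(@real_normK _ (d1 - _)) ?num_real// lerXn2r ?nnegrE//.
    exact: le_trans h1.
  have h3 : (d1 - 3 * t * d2) ^+ 2 * (3^-1 * A ^- 3) + d2 ^+ 2 * A^-1 <= M * A^-1.
    rewrite /M [X in _ <= X]mulrDl lerD2r.
    have -> : (`|d1| / a + 3 * `|d2|) ^+ 2 / 3 * A^-1 =
      (`|d1| / a + 3 * `|d2|) ^+ 2 * A ^+ 2 * (3^-1 * A ^- 3).
      by field; rewrite (gt_eqF A0) (gt_eqF a0).
    by rewrite ler_wpM2r// mulr_ge0// invr_ge0 exprn_ge0// ltW.
  apply: (le_trans h3); rewrite ler_pdivrMr// -ler_pdivrMl// mulrC.
  by rewrite (le_trans Mt)// lerDr ltW.
have ge0 t : (0 <= exterior_energy a u ut t)%E.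
  rewrite (exterior_energy_profile t a0 hX0 hY0) lee_fin.
  have A0 : 0 < a + `|t| by rewrite ltr_pwDl.
  by rewrite addr_ge0// mulr_ge0 ?sqr_ge0// ?mulr_ge0// invr_ge0 ?exprn_ge0// ltW.
have lim0 (G : set_system R) : ProperFilter G -> (forall N : R, \forall t \near G, N <= `|t|) ->
    limf_esup (exterior_energy a u ut) G = 0%E.
  move=> PG GN; apply/eqP; rewrite eq_le; apply/andP; split.
    apply/lee_addgt0Pr => e e0; rewrite add0e; apply: limf_esup_le.
    by have := GN (M / e); apply: filterS => t; exact: bound.
  by apply: limf_esup_ge; apply: nearW.
rewrite /max_limsup_exterior !lim0 ?maxxx// => N.
- near=> t; have : `|N| <= - t.
    by rewrite lerNr; near: t; exact/nbhs_ninfty_le/num_real.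
  by have := ler_norm N; have := ler_norm (- t); rewrite normrN; lra.
- near=> t; have : `|N| <= t by near: t; exact/nbhs_pinfty_ge/num_real.
  by have := ler_norm N; have := ler_norm t; lra.
Unshelve. all: by end_near. Qed.

End Evolution.

(** * The solution at time zero *)

Section Data.
Context {R : realType}.
Notation mu := (@lebesgue_measure R).
Context {u ut : R -> R -> R} {f g : R -> R} (dat : has_data u ut f g).

Lemma data_X a : 0 <= a -> {ae mu, forall r, a < r -> r ^+ 2 * derive1 f r = wave_X u 0 r}.
Proof.
move=> a0; apply/aeW => r ar; congr (_ * _).
by apply: (derive1_congr (a := 0)) => [x x0|]; [rewrite dat.1|exact: le_lt_trans ar].
Qed.

Lemma data_Y a : 0 <= a -> {ae mu, forall r, a < r -> r ^+ 2 * g r = wave_Y ut 0 r}.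
Proof.
by move=> a0; apply: ae_filterS dat.2 => r h ar; rewrite /wave_Y h// (le_lt_trans a0).
Qed.

Lemma in_plane_profile a : 0 < a -> in_plane_outside a f g -> exists d1 d2,
  {ae mu, forall r, a < r -> wave_X u 0 r = d1 * r ^- 2} /\
  {ae mu, forall r, a < r -> wave_Y ut 0 r = d2 * r ^- 1}.
Proof.
move=> a0 [c1 [c2 [fc gc]]]; exists (- (3 * c1)), c2; split.
  apply: ae_filterS (data_X (ltW a0)) => r h ar; have r0 := lt_trans a0 ar.
  rewrite -h// (@derive1_congr _ _ (fun x => c1 * x ^- 3) a)//.
  have d := is_derive_plane_elt c1 r0; rewrite derive1E derive_val; field.
  by rewrite gt_eqF.
apply: ae_filterS2 (data_Y (ltW a0)) gc => r h1 h2 ar; have r0 := lt_trans a0 ar.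
by rewrite -h1// h2//; field; rewrite gt_eqF.
Qed.

End Data.

Theorem proposition4p1 (R : realType) :
  exists c : R, 0 < c /\
    forall f g : R -> R, rad_Hdot1 f -> rad_L2 g ->
    forall u ut : R -> R -> R, is_free_wave u ut -> has_data u ut f g ->
    forall a : R, 0 < a ->
      (c%:E * energy a (orth_perp a (f, g)) <= max_limsup_exterior a u ut)%E
      /\ (in_plane_outside a f g -> max_limsup_exterior a u ut = 0%E).
Proof.
exists 2^-1; split; first by rewrite invr_gt0.
move=> f g Hf Lg u ut wv dat a a0; split; last first.
  by move=> /(in_plane_profile dat a0)[d1 [d2 [hX hY]]]; exact: (max_limsup_profile wv a0 hX hY).
rewrite energy_orth_perp//.
rewrite (tail_congr (hardy_congr 1 (data_X dat (ltW a0)))).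
rewrite (tail_congr (hardy_congr 0 (data_Y dat (ltW a0)))) -EFinM.
exact: max_limsup_ge.
Qed.
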